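(* Let $p$ be a prime and let $1\to G_1\to G_2\to G_3\to 1$ be a short exact sequence of topologically finitely generated nilpotent pro-$p$ groups and continuous homomorphisms. Assume that $\mathbb{Q}_p\subset k$ is a weakly cartesian pair of Hausdorff topological fields. Then the induced sequence of pro-unipotent groups over $k$ $$1\to G_1\widehat{\otimes}k\to G_2\widehat{\otimes}k\to G_3\widehat{\otimes}k\to 1$$ is exact.
   Context: $\mathbb{Q}_p$ carries the $p$-adic topology. A topological group is topologically finitely generated if it contains a dense algebraically finitely generated subgroup. A topological field is a field with a topology for which addition, multiplication, additive inversion and multiplicative inversion are continuous. A topological vector space $V$ over a Hausdorff topological field $F$ is weakly cartesian if every finite-dimensional subspace of $V$ is closed and is linearly homeomorphic to $F^r$ (product topology) for some $r$. If $F$ is a closed subfield of a Hausdorff topological field $K$, then $F\subset K$ is a weakly cartesian pair if $K$ is weakly cartesian as a topological vector space over $F$. For $k$ a Hausdorff topological field of characteristic zero: an affine algebraic group over $k$ is unipotent if it has a closed embedding into the group of upper-unitriangular $m\times m$ matrices for some $m$; an affine group scheme over $k$ is pro-unipotent if all its finite-dimensional quotient group schemes are unipotent (equivalently it is an inverse limit of unipotent groups). For $U$ unipotent, $U(k)$ has the topology transported from $\mathrm{Lie}(U)\cong k^r$ along the bijection $\exp:\mathrm{Lie}(U)\to U(k)$; for $U=\varprojlim_iU_i$ pro-unipotent, $U(k)=\varprojlim_iU_i(k)$ has the inverse limit topology. The continuous Mal'cev $k$-completion $G\widehat{\otimes}k$ of a topological group $G$ is the pro-unipotent group over $k$ representing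 $U\mapsto\mathrm{Hom}_{\mathrm{cont}}(G,U(k))$ on pro-unipotent groups over $k$; it is functorial in $G$. *)

(* Defs.v *)
From HB Require Import structures.
From mathcomp Require Import all_boot all_order all_algebra.
From mathcomp Require Import all_classical all_reals all_analysis.

Set Implicit Arguments.
Unset Strict Implicit.
Unset Printing Implicit Defensive.

Import Order.TTheory GRing.Theory Num.Theory.
Local Open Scope classical_set_scope.
Local Open Scope ring_scope.

(** * Topological fields and vector spaces *)

HB.mixin Record isTopologicalField K of GRing.Field K & Topological K := {
  fmul_continuous : continuous (fun z : K * K => z.1 * z.2) ;
  finv_continuous : forall x : K, x != 0 -> {for x, continuous (@GRing.inv K)}
}.

#[short(type="topologicalFieldType")]
HB.structure Definition TopologicalField :=
  {K of GRing.Field K & TopologicalZmodule K & isTopologicalField K}.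

(* The topologicalLmodType of MathComp-Analysis needs a numDomainType of
   scalars, which a p-adic field is not, and a parallel HB structure would
   clash with it. *)
Record topologicalVector (F : topologicalFieldType) := TopologicalVector {
  tvs_zmod : topologicalZmodType;
  tvs_scale : F -> tvs_zmod -> tvs_zmod;
  tvs_scaleA : forall a b x,
    tvs_scale a (tvs_scale b x) = tvs_scale (a * b) x;
  tvs_scale1 : left_id 1 tvs_scale;
  tvs_scaleDr : right_distributive tvs_scale +%R;
  tvs_scaleDl : forall x, {morph tvs_scale^~ x : a b / a + b};
  tvs_scale_continuous :
    continuous (fun z : F * tvs_zmod => tvs_scale z.1 z.2)
}.

Definition tvs_sort (F : topologicalFieldType) (V : topologicalVector F) :
  Type := tvs_zmod V.
Coercion tvs_sort : topologicalVector >-> Sortclass.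

HB.instance Definition _ (F : topologicalFieldType) (V : topologicalVector F) :=
  TopologicalZmodule.copy (tvs_sort V) (tvs_zmod V).
HB.instance Definition _ (F : topologicalFieldType) (V : topologicalVector F) :=
  GRing.Zmodule_isLmodule.Build F (tvs_sort V)
    (@tvs_scaleA F V) (@tvs_scale1 F V) (@tvs_scaleDr F V) (@tvs_scaleDl F V).

Definition finite_dim_subspace (F : fieldType) (V : lmodType F) (W : set V) :=
  exists (n : nat) (v : 'I_n -> V),
    W = [set x | exists c : 'I_n -> F, x = \sum_i c i *: v i].

(* [f] is a linear homeomorphism of F^r (with the product topology, which is
   the topology of ['rV[F]_r]) onto [W] with its subspace topology. *)
Definition linear_homeo_onto (F : topologicalFieldType)
    (V : topologicalVector F) (r : nat) (f : {linear 'rV[F]_r -> V})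
    (W : set V) :=
  [/\ injective f, range f = W &
      forall A : set 'rV[F]_r,
        open A <-> exists2 B : set V, open B & A = f @^-1` B].

Definition weakly_cartesian (F : topologicalFieldType)
    (V : topologicalVector F) :=
  forall W : set V, finite_dim_subspace W ->
    closed W /\ exists (r : nat) (f : {linear 'rV[F]_r -> V}),
      linear_homeo_onto f W.

(* A closed subfield, presented by its inclusion map. *)
Record closedSubfield (F K : topologicalFieldType) := ClosedSubfield {
  subfield_incl :> {rmorphism F -> K};
  subfield_topology : forall A : set F,
    open A <-> exists2 B : set K, open B & A = subfield_incl @^-1` B;
  subfield_closed : closed (range subfield_incl)
}.

Section OverSubfield.
Variables (F K : topologicalFieldType) (j : closedSubfield F K).

Let scale (a : F) (x : K) : K := j a * x.

Let scaleA a b x : scale a (scale b x) = scale (a * b) x.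
Proof. by rewrite /scale rmorphM mulrA. Qed.
Let scale1 : left_id 1 scale.
Proof. by move=> x; rewrite /scale rmorph1 mul1r. Qed.
Let scaleDr : right_distributive scale +%R.
Proof. by move=> a x y; rewrite /scale mulrDr. Qed.
Let scaleDl x : {morph scale^~ x : a b / a + b}.
Proof. by move=> a b; rewrite /scale rmorphD mulrDl. Qed.

Let j_continuous : continuous (j : F -> K).
Proof.
by apply/continuousP => B oB; apply/(subfield_topology j); exists B.
Qed.

Let scale_continuous : continuous (fun z : F * K => scale z.1 z.2).
Proof.
move=> z.
apply: (@continuous_comp _ (K * K)%type K
  (fun z : F * K => (j z.1, z.2)) (fun z => z.1 * z.2)); last first.
  exact: fmul_continuous.
apply: cvg_pair => /=; last exact: cvg_snd.
by apply: continuous_comp; [exact: cvg_fst | exact: j_continuous].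
Qed.

(* [K] regarded as a topological vector space over [F]. *)
Definition over_subfield : topologicalVector F :=
  TopologicalVector scaleA scale1 scaleDr scaleDl scale_continuous.

End OverSubfield.

Definition weakly_cartesian_pair (F K : topologicalFieldType)
    (j : closedSubfield F K) :=
  weakly_cartesian (over_subfield j).

(** * The field of p-adic numbers *)

Definition padic_abs (p : nat) (q : rat) : rat :=
  if q == 0 then 0
  else p%:R ^ ((logn p `|denq q|%N)%:Z - (logn p `|numq q|%N)%:Z).

(* [F] is the completion of the rationals for the p-adic absolute value. The
   absolute value of Q_p takes values in p^Z and 0, hence in [rat]. *)
Definition is_Qp (p : nat) (F : topologicalFieldType) :=
  exists abs : F -> rat,
    [/\ (forall x, 0 <= abs x /\ (abs x = 0 -> x = 0)),
        (forall x y, abs (x * y) = abs x * abs y),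
        (forall x y, abs (x + y) <= Num.max (abs x) (abs y)),
        (forall q : rat, abs (ratr q) = padic_abs p q) &
    [/\ (forall (x : F) (A : set F), nbhs x A <->
           exists2 e : rat, 0 < e & [set y | abs (y - x) < e] `<=` A),
        dense (range (ratr : rat -> F)) &
        (forall u : nat -> F,
           (forall e : rat, 0 < e -> exists N : nat, forall m n : nat,
              (N <= m)%N -> (N <= n)%N -> abs (u m - u n) < e) ->
           exists l : F, u @ \oo --> l)]].

(** * Topological groups *)

HB.mixin Record isTopologicalGroup G of Group G & Topological G := {
  gmul_continuous : continuous (fun z : G * G => (z.1 * z.2)%g) ;
  ginv_continuous : continuous (fun x : G => (x^-1)%g)
}.

#[short(type="topologicalGroupType")]
HB.structure Definition TopologicalGroup :=
  {G of Group G & Topological G & isTopologicalGroup G}.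

Definition is_subgroup (G : groupType) (H : set G) :=
  H 1%g /\ forall x y, H x -> H y -> H (x * y^-1)%g.

Definition subgroup_generated (G : groupType) (A : set G) : set G :=
  smallest (@is_subgroup G) A.

Fixpoint lower_central (G : groupType) (n : nat) : set G :=
  if n is n'.+1 then
    subgroup_generated
      [set z | exists x y : G, @lower_central G n' x /\ z = commg x y]
  else [set: G].

Definition nilpotent_group (G : groupType) :=
  exists c : nat, @lower_central G c = [set 1%g].

Definition topologically_fg (G : topologicalGroupType) :=
  exists (n : nat) (s : 'I_n -> G), dense (subgroup_generated (range s)).

(* The subgroup [N] has index [n]: [t] lists representatives of its left
   cosets. *)
Definition has_index (G : groupType) (N : set G) (n : nat) :=
  exists t : 'I_n -> G, forall x : G, exists! i : 'I_n, N ((t i)^-1 * x)%g.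

Definition is_normal (G : groupType) (N : set G) :=
  is_subgroup N /\ forall x y, N x -> N (y^-1 * x * y)%g.

Definition pro_p_group (p : nat) (G : topologicalGroupType) :=
  [/\ compact [set: G], hausdorff_space G, totally_disconnected [set: G] &
      forall N : set G, open N -> is_normal N ->
        exists e : nat, has_index N (p ^ e)].

Definition short_exact_groups (G1 G2 G3 : groupType)
    (i : {multiplicative G1 -> G2}) (q : {multiplicative G2 -> G3}) :=
  [/\ injective i, (forall y, q y = 1%g <-> range i y) & range q = [set: G3]].

(** * Affine group schemes *)

Section Compose.
Variables (k : fieldType) (A B C : comAlgType k).
Definition alg_comp (g : {lrmorphism B -> C}) (f : {lrmorphism A -> B}) :
  {lrmorphism A -> C} := g \o f.
End Compose.

(* A representable group functor R |-> Hom_k-alg(coord_alg, R), where R ranges over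
   the nonzero commutative k-algebras. Values at the zero algebra are trivial
   and carry no information; naturality of unit and inverse follows from that
   of the product. *)
Record affineGroup (k : fieldType) := AffineGroup {
  coord_alg : comAlgType k;
  pt_mul : forall R : comAlgType k,
    {lrmorphism coord_alg -> R} -> {lrmorphism coord_alg -> R} ->
    {lrmorphism coord_alg -> R};
  pt_one : forall R : comAlgType k, {lrmorphism coord_alg -> R};
  pt_inv : forall R : comAlgType k,
    {lrmorphism coord_alg -> R} -> {lrmorphism coord_alg -> R};
  pt_mulA : forall R, associative (@pt_mul R);
  pt_1mul : forall R, left_id (pt_one R) (@pt_mul R);
  pt_mul1 : forall R, right_id (pt_one R) (@pt_mul R);
  pt_Vmul : forall R, left_inverse (pt_one R) (@pt_inv R) (@pt_mul R);
  pt_mulV : forall R, right_inverse (pt_one R) (@pt_inv R) (@pt_mul R);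
  pt_mul_natural : forall (R S : comAlgType k) (h : {lrmorphism R -> S})
    (x y : {lrmorphism coord_alg -> R}),
    alg_comp h (pt_mul x y) = pt_mul (alg_comp h x) (alg_comp h y)
}.

(* U(R) *)
Definition points (k : fieldType) (U : affineGroup k) (R : comAlgType k) : Type
  := {lrmorphism coord_alg U -> R}.

Section Points.
Variables (k : fieldType) (U : affineGroup k) (R : comAlgType k).
HB.instance Definition _ := gen_eqMixin (points U R).
HB.instance Definition _ := gen_choiceMixin (points U R).
HB.instance Definition _ := isGroup.Build (points U R)
  (@pt_mulA k U R) (@pt_1mul k U R) (@pt_mul1 k U R)
  (@pt_Vmul k U R) (@pt_mulV k U R).

Definition eval_pt (x : points U R) : {lrmorphism coord_alg U -> R} := x.
End Points.

(* Homomorphisms of group schemes, as maps of coordinate algebras (Yoneda). *)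
Record schemeHom (k : fieldType) (U V : affineGroup k) := SchemeHom {
  comap : {lrmorphism coord_alg V -> coord_alg U};
  comap_mul : forall (R : comAlgType k) (x y : points U R),
    (alg_comp (x * y)%g comap : points V R)
      = ((alg_comp x comap : points V R) * (alg_comp y comap : points V R))%g
}.

(* U(R) -> V(R) *)
Definition on_points (k : fieldType) (U V : affineGroup k) (f : schemeHom U V)
  (R : comAlgType k) (x : points U R) : points V R := alg_comp x (comap f).

(* Faithful flatness of f is equivalent to injectivity of comap f, as Hopf
   algebras over a field are faithfully flat over their Hopf subalgebras. *)
Definition quotient_map (k : fieldType) (U V : affineGroup k)
  (f : schemeHom U V) := injective (comap f).

Definition short_exact_schemes (k : fieldType) (U V W : affineGroup k)
    (f : schemeHom U V) (g : schemeHom V W) :=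
  [/\ (forall R : comAlgType k, injective (@on_points k U V f R)),
      (forall (R : comAlgType k) (y : points V R),
         on_points g y = 1%g <-> exists x : points U R, on_points f x = y) &
      quotient_map g].

(** * Unipotent and pro-unipotent groups *)

Definition generates_algebra (k : fieldType) (A : comAlgType k) (X : set A) :=
  forall S : {pred A}, GRing.subalg_closed S ->
    (forall x, X x -> x \in S) -> forall a, a \in S.

Definition algebraic (k : fieldType) (U : affineGroup k) :=
  exists (n : nat) (x : 'I_n -> coord_alg U), generates_algebra (range x).

(* A homomorphism from U to the group of upper unitriangular m x m matrices is,
   by Yoneda, a unitriangular matrix [rho] over [coord_alg U]; the point x is sent
   to [map_mx x rho]. It is a closed embedding when the comorphism is onto,
   i.e., when the entries of [rho] generate [coord_alg U]. *)
Definition unitriangular_embedding (k : fieldType) (U : affineGroup k) (m : nat)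
    (rho : 'M[coord_alg U]_m) :=
  [/\ (forall i : 'I_m, rho i i = 1),
      (forall i j : 'I_m, (j < i)%N -> rho i j = 0),
      (forall (R : comAlgType k) (x y : points U R),
         map_mx (eval_pt (x * y)%g) rho
           = map_mx (eval_pt x) rho *m map_mx (eval_pt y) rho) &
      generates_algebra [set a | exists i j, a = rho i j]].

Definition unipotent (k : fieldType) (U : affineGroup k) :=
  algebraic U /\
  exists (m : nat) (rho : 'M[coord_alg U]_m), unitriangular_embedding rho.

Definition prounipotent (k : fieldType) (U : affineGroup k) :=
  forall (Q : affineGroup k) (f : schemeHom U Q),
    quotient_map f -> algebraic Q -> unipotent Q.

(** * The topology on k-points *)

Definition kpoints (k : fieldType) (U : affineGroup k) : Type :=
  points U k^o.

HB.instance Definition _ (k : fieldType) (U : affineGroup k) :=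
  Group.copy (kpoints U) (points U k^o).

(* Lie(U), as the point derivations at the unit of U(k). *)
Definition lie (k : fieldType) (U : affineGroup k) : set (coord_alg U -> k) :=
  [set D | scalar D /\
    forall a b, D (a * b)
      = eval_pt (1%g : points U k^o) a * D b
        + D a * eval_pt (1%g : points U k^o) b].

Definition lie_comb (k : fieldType) (U : affineGroup k) (r : nat)
    (b : 'I_r -> coord_alg U -> k) (c : 'rV[k]_r) : coord_alg U -> k :=
  fun a => \sum_i c 0 i * b i a.

Definition lie_basis (k : fieldType) (U : affineGroup k) (r : nat)
    (b : 'I_r -> coord_alg U -> k) :=
  (forall i, lie (b i)) /\
  forall D, lie D -> exists! c : 'rV[k]_r, D = lie_comb b c.

(* The exponential series of a nilpotent m x m matrix. *)
Definition mx_exp (k : fieldType) (m : nat) (X : 'M[k]_m) : 'M[k]_m :=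
  \sum_(n < m) (n`!%:R)^-1 *: X ^+ n.

(* exp D = u, computed in the unitriangular group: [map_mx D rho] is the image
   of D in the strictly upper triangular matrices. *)
Definition is_exp (k : fieldType) (U : affineGroup k) (m : nat)
    (rho : 'M[coord_alg U]_m) (D : coord_alg U -> k) (u : kpoints U) :=
  map_mx (eval_pt u : coord_alg U -> k) rho = mx_exp (map_mx D rho).

(* The open sets of the topology transported along exp from Lie(U) = k^r; they
   do not depend on the embedding or on the basis. *)
Definition unipotent_open (k : topologicalFieldType) (U : affineGroup k)
    (V : set (kpoints U)) :=
  exists (m : nat) (rho : 'M[coord_alg U]_m) (r : nat) (b : 'I_r -> coord_alg U -> k),
    [/\ unitriangular_embedding rho, lie_basis b &
        open [set c : 'rV[k]_r |
                exists2 u, is_exp rho (lie_comb b c) u & V u]].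

(* Subbase of the inverse limit topology: preimages of open sets of Q(k), for Q
   in the system of all unipotent quotients of U. *)
Definition kpoints_subbase (k : topologicalFieldType) (U : affineGroup k) :
    set (set (kpoints U)) :=
  [set W | exists (Q : affineGroup k) (f : schemeHom U Q) (V : set (kpoints Q)),
     [/\ quotient_map f, unipotent Q, unipotent_open V &
         W = [set u | V (on_points f u)]]].

Definition top_kpoints (k : topologicalFieldType) (U : affineGroup k) : Type :=
  kpoints U.

Section TopKpoints.
Variables (k : topologicalFieldType) (U : affineGroup k).
HB.instance Definition _ := Group.copy (top_kpoints U) (kpoints U).
HB.instance Definition _ :=
  isSubBaseTopological.Build (top_kpoints U) (@kpoints_subbase k U) id.
End TopKpoints.

(** * Continuous Mal'cev completion *)

(* [M] with [eta] represents U |-> Hom_cont(G, U(k)) on pro-unipotent groups,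
   [eta] being the universal element. *)
Definition is_malcev_completion (k : topologicalFieldType)
    (G : topologicalGroupType) (M : affineGroup k)
    (eta : {multiplicative G -> top_kpoints M}) :=
  [/\ prounipotent M, continuous eta &
      forall (U : affineGroup k) (h : {multiplicative G -> top_kpoints U}),
        prounipotent U -> continuous h ->
        exists f : schemeHom M U,
          (forall x, on_points f (eta x) = h x) /\
          (forall f' : schemeHom M U,
             (forall x, on_points f' (eta x) = h x) -> comap f' =1 comap f)].

(* [f] is the homomorphism obtained from [phi] by functoriality. *)
Definition is_induced (k : topologicalFieldType) (G H : topologicalGroupType)
    (M N : affineGroup k) (etaG : {multiplicative G -> top_kpoints M})
    (etaH : {multiplicative H -> top_kpoints N})
    (phi : {multiplicative G -> H}) (f : schemeHom M N) :=
  forall x, on_points f (etaG x) = etaH (phi x).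

(* Main.v *)
(* Let R(G) be the algebra of continuous polynomial functions G -> k, those
   killed by some power of the augmentation ideal of the group ring.  Evaluation
   at the canonical points identifies the coordinate ring of the Mal'cev
   completion of G with R(G): R(G) is the coordinate ring of a pro-unipotent
   group, because G is topologically finitely generated, and that group is
   universal, because regular functions on a unipotent group U pull back to
   continuous polynomial functions along continuous homomorphisms G -> U(k).

   The theorem thus says that R(G2) -> R(G1) is onto, with kernel generated by
   the functions in R(G3) vanishing at 1, and that R(G3) -> R(G2) is injective.
   To climb from H = i(G1) to G2, adjoin the left-normed commutators of
   topological generators one at a time, by decreasing weight.  Let L be a closed
   normal subgroup and y central modulo L.  If some power of y lies in L, then
   polynomial functions extend uniquely from L to L<y>, by Newton interpolation
   in the exponent of y.  Otherwise the closure of L<y> is a semidirect product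
   L Y with a continuous coordinate a : LY -> Q_p, extension is by composition
   with LY -> L, and F = sum_j binom(a, j) * ext(F_j), with F_j the j-th right
   difference of F along y.  Nilpotency makes these extensions polynomial. *)
Require Import Defs.
From Stdlib Require List.
From HB Require Import structures.
From mathcomp Require Import all_boot all_order all_algebra.
From mathcomp Require Import all_classical all_reals all_analysis.
From mathcomp Require Import ring finmap.

Set Implicit Arguments.
Unset Strict Implicit.
Unset Printing Implicit Defensive.

Import Order.TTheory GRing.Theory Num.Theory.
Local Open Scope classical_set_scope.
Local Open Scope ring_scope.

(** Finitely many points of G detect zero among the functions of bounded degree in R(G). This gives
    finite dimension, hence the comultiplication, and Hopf identities can be checked at group
    elements. Continuity of a map to U(k) is likewise a condition on functions, because exp and log
    are polynomial in matrix entries and in coordinates.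

    The obstacle in climbing is that left translation of l y^n by y^b replaces l by y^b l y^(-b),
    and conjugation minus the identity need not lower the polynomial degree. It does lower a
    weighted degree, in which differences deep in the lower central series count more; in the split
    case this costs a factor c in the degree. In the case y^r = u in L nothing is lost: conjugation
    by y^b followed by right multiplication by u^(b/r) is left multiplication by u^(b/r).

    The ideal statement is carried along because exactness in the middle concerns points in every
    k-algebra: a point of M2 that dies in M3 kills the ideal, so it descends to the coordinate ring
    of M1. *)

Lemma lrmorphism_eq (k : fieldType) (A B : comAlgType k)
  (f g : {lrmorphism A -> B}) : f =1 g -> f = g.
Proof.
move=> /funext; case: f g => [f [[f1] [f2] [f3]]] [g [[g1] [g2] [g3]]] /= fg.
move: f1 f2 f3; rewrite fg => f1 f2 f3.
by rewrite (Prop_irrelevance f1 g1) (Prop_irrelevance f2 g2)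
  (Prop_irrelevance f3 g3).
Qed.

(** * Separating families of functionals *)

Section LinearAlgebra.
Variables (k : fieldType) (L : lmodType k).

Definition lin_closed (V : set L) :=
  V 0 /\ forall a u v, V u -> V v -> V (a *: u + v).

Lemma lin_closedD V u v : lin_closed V -> V u -> V v -> V (u + v).
Proof. by move=> [_ H] Vu Vv; rewrite -[u]scale1r; apply: H. Qed.

Lemma lin_closedZ V a u : lin_closed V -> V u -> V (a *: u).
Proof. by move=> [V0 H] Vu; rewrite -[_ *: _]addr0; apply: H. Qed.

Lemma lin_closedB V u v : lin_closed V -> V u -> V v -> V (u - v).
Proof. by move=> [_ H] Vu Vv; rewrite addrC -scaleN1r; apply: H. Qed.

Lemma lin_closed_sum V (I : Type) (r : seq I) (P : pred I) (F : I -> L) :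
  lin_closed V -> (forall i, P i -> V (F i)) -> V (\sum_(i <- r | P i) F i).
Proof.
move=> VL VF; elim/big_ind: _ => //; first by case: VL.
by move=> x y; apply: lin_closedD.
Qed.

Fixpoint lspan (B : seq L) : set L :=
  if B is b :: B' then [set u | exists a v, lspan B' v /\ u = a *: b + v]
  else [set 0].

Lemma lspan_closed B : lin_closed (lspan B).
Proof.
elim: B => [|b B [IH0 IH]] /=; split => //=.
- by move=> a u v -> ->; rewrite scaler0 addr0.
- by exists 0, 0; rewrite scale0r addr0.
- move=> a u v [c [u' [Bu' ->]]] [d [v' [Bv' ->]]].
  exists (a * c + d), (a *: u' + v'); split; first exact: IH.
  by rewrite scalerDr scalerDl scalerA addrACA.
Qed.

Lemma lspan_mem B b : List.In b B -> lspan B b.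
Proof.
elim: B => //= c B IH [->|/IH Bb].
  by exists 1, 0; rewrite scale1r addr0; split=> //; case: (lspan_closed B).
by exists 0, b; rewrite scale0r add0r.
Qed.

Variables (T : Type) (ev : T -> L -> k).
Hypothesis evL : forall t, scalar (ev t).

Lemma ev0 t : ev t 0 = 0.
Proof. by have := evL t (-1) 0 0; rewrite scaler0 add0r mulN1r addNr. Qed.

Lemma evD t u v : ev t (u + v) = ev t u + ev t v.
Proof. by rewrite -[u in LHS]scale1r evL mul1r. Qed.

Lemma evZ t a u : ev t (a *: u) = a * ev t u.
Proof. by rewrite -[_ *: _]addr0 evL ev0 addr0. Qed.

Lemma evB t u v : ev t (u - v) = ev t u - ev t v.
Proof. by rewrite evD -scaleN1r evZ mulN1r. Qed.

Lemma ev_sum t (I : Type) (r : seq I) (P : pred I) (F : I -> L) :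
  ev t (\sum_(i <- r | P i) F i) = \sum_(i <- r | P i) ev t (F i).
Proof. by apply: (big_morph (ev t)); [exact: evD | exact: ev0]. Qed.

Definition separated (V : set L) (E : set T) :=
  forall v, V v -> (forall t, E t -> ev t v = 0) -> v = 0.

(** If points separating [lspan B] fail to separate [lspan (b :: B)], the vectors they kill form a
    line, and one further point detects it. *)
Lemma finite_separation B : separated (lspan B) setT ->
  exists E : seq T, separated (lspan B) (fun t => List.In t E).
Proof.
elim: B => [|b B IH] sepB; first by exists [::] => v /= ->.
have [|E sepE] := IH.
  move=> v Bv; apply: sepB; exists 0, v; by rewrite scale0r add0r.
have [H|] := pselect (separated (lspan (b :: B)) (fun t => List.In t E)).
  by exists E.
move=> /existsNP [_] /not_implyP [[a [v [Bv ->]]]] /not_implyP [uE u0].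
have a0 : a != 0.
  apply: contra_notN u0 => /eqP a0; move: uE; rewrite a0 scale0r add0r.
  exact: sepE.
have [t0 ut0] : exists t, ev t (a *: b + v) <> 0.
  apply/existsNP => H; apply: u0; apply: sepB => // ; by exists a, v.
exists (t0 :: E) => w [c [w' [Bw' ->]]] wE.
set u := a *: b + v in uE ut0 u0.
have wuE : c *: b + w' = (c / a) *: u.
  apply/eqP; rewrite -subr_eq0; apply/eqP; apply: sepE.
    rewrite scalerDr scalerA divfK // opprD addrACA subrr add0r.
    by apply: lin_closedB (lspan_closed B) _ _ => //; apply: lin_closedZ (lspan_closed B) _.
  move=> t Et; rewrite evB // evZ // uE // mulr0 subr0; apply: wE; by right.
have := wE t0 (or_introl erefl); rewrite wuE evZ => /eqP.
rewrite mulf_eq0 => /orP[/eqP -> | /eqP //]; by rewrite scale0r.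
Qed.

(** Gram-Schmidt for functionals: a point of [E] that is not identically zero on [V] splits [V] into
    its kernel, treated by induction, and a vector [psi] corrected to be killed by the points
    already chosen. *)
Lemma dual_basis_points (V : set L) (E : seq T) :
  lin_closed V -> separated V (fun t => List.In t E) ->
  exists (n : nat) (e : 'I_n -> L) (t : 'I_n -> T),
    [/\ forall i, V (e i), forall i, List.In (t i) E,
        forall i j, ev (t j) (e i) = (i == j)%:R &
        forall v, V v -> v = \sum_i ev (t i) v *: e i].
Proof.
elim: E V => [|t0 E IH] V VL sep.
  exists 0%N, (fun=> 0), (fun i : 'I_0 => False_rect T (elimF idP (ltn0 i) (ltn_ord i))).
  split; try by case.
  by move=> v Vv; rewrite big_ord0; apply: sep.
pose V0 := [set v | V v /\ ev t0 v = 0].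
have V0L : lin_closed V0.
  split; first by split; [case: VL | rewrite ev0].
  move=> a u v [Vu u0] [Vv v0]; split; first by case: VL => _; apply.
  by rewrite evL u0 v0 mulr0 addr0.
have [|n [e [t [eV tE et Ve]]]] := IH V0 V0L.
  move=> v [Vv v0] vE; apply: sep => // s [<-//|]; exact: vE.
have [H|] := pselect (forall v, V v -> ev t0 v = 0).
  exists n, e, t; split => //; first by move=> i; case: (eV i).
  - by move=> i; right.
  - by move=> v Vv; apply: Ve; split => //; apply: H.
move=> /existsNP [w] /not_implyP [Vw /eqP w0].
have [u [Vu u1]] : exists u, V u /\ ev t0 u = 1.
  by exists ((ev t0 w)^-1 *: w); rewrite evZ // mulVf //; split=> //; apply: lin_closedZ.
pose psi := u - \sum_i ev (t i) u *: e i.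
have Vpsi : V psi.
  apply: lin_closedB => //; apply: lin_closed_sum => // i _.
  by apply: lin_closedZ => //; case: (eV i).
have psit i : ev (t i) psi = 0.
  rewrite evB // ev_sum // (bigD1 i) //= big1 ?addr0; last first.
    by move=> j ji; rewrite evZ // et (negbTE ji) mulr0.
  by rewrite evZ // et eqxx mulr1 subrr.
have psi0 : ev t0 psi = 1.
  rewrite evB // ev_sum // big1 ?subr0 // => i _.
  by rewrite evZ // (proj2 (eV i)) mulr0.
exists n.+1, (fun i => if unlift ord0 i is Some j then e j else psi),
  (fun i => if unlift ord0 i is Some j then t j else t0); split.
- by move=> i; case: unliftP => // j _; case: (eV j).
- by move=> i; case: unliftP => [j _|_]; [right | left].
- move=> i j; case: (unliftP ord0 i) => [i' ->|->]; case: (unliftP ord0 j) => [j' ->|->].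
  + by rewrite et (inj_eq (lift_inj (h := ord0))).
  + by rewrite (proj2 (eV i')).
  + by rewrite psit.
  + by rewrite psi0.
- move=> v Vv; rewrite big_ord_recl unlift_none.
  under eq_bigr do rewrite liftK.
  have Vv0 : V0 (v - ev t0 v *: psi).
    split; first by apply: lin_closedB => //; apply: lin_closedZ.
    by rewrite evB // evZ // psi0 mulr1 subrr.
  rewrite -[LHS](subrKC (ev t0 v *: psi)) {1}(Ve _ Vv0); congr (_ + _).
  by apply: eq_bigr => i _; rewrite evB // evZ // psit mulr0 subr0.
Qed.

Lemma dual_basis (V : set L) (B : seq L) :
  lin_closed V -> V `<=` lspan B -> separated (lspan B) setT ->
  exists (n : nat) (e : 'I_n -> L) (t : 'I_n -> T),
    [/\ forall i, V (e i),
        forall i j, ev (t j) (e i) = (i == j)%:R &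
        forall v, V v -> v = \sum_i ev (t i) v *: e i].
Proof.
move=> VL VB sepB; have [E sepE] := finite_separation sepB.
have [|n [e [t [eV _ et Ve]]]] := @dual_basis_points V E VL.
  by move=> v /VB; apply: sepE.
by exists n, e, t.
Qed.

End LinearAlgebra.

(** A subspace maximal among those avoiding [a] is a complement of the line through [a]; the
    functional reads off the coefficient along [a]. *)
Lemma functional_separation (k : fieldType) (L : lmodType k) (a : L) :
  a != 0 -> exists f : {scalar L}, f a != 0.
Proof.
move=> a0.
pose P (W : set L) := (forall c u v, W u -> W v -> W (c *: u + v)) /\ ~ W a.
have [W [[WL Wa] Wmax]] : exists W, P W /\ forall W', W `<` W' -> ~ P W'.
  apply: Zorn_bigcup => F FP totF; split; last by move=> [X /FP[_ Xa]].
  move=> c u v [X FX Xu] [Y FY Yv].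
  have [XY|YX] := totF _ _ FX FY.
    by exists Y => //; case: (FP _ FY) => + _; apply => //; apply: XY.
  by exists X => //; case: (FP _ FX) => + _; apply => //; apply: YX.
(* [P] does not ask for 0, so that the union of the empty chain satisfies it; maximality restores
   0. *)
have W0 : W 0.
  apply: contrapT => nW0; apply: (Wmax [set 0]); last first.
    split; first by move=> c u v -> ->; rewrite scaler0 addr0.
    by move=> /= /eqP; apply/negP.
  rewrite properEneq; split.
    apply/eqP => W0; by apply: nW0; rewrite W0.
  move=> u Wu; exfalso; apply: nW0.
  by rewrite -(addNr u) -scaleN1r; apply: WL.
have WC : lin_closed W by [].
have ex x : exists c : k, W (x - c *: a).
  have [Wx|nWx] := pselect (W x); first by exists 0; rewrite scale0r subr0.
  apply: contrapT => nex.
  apply: (Wmax [set u | exists c w, W w /\ u = c *: x + w]).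
    rewrite properEneq; split; last first.
      by move=> w Ww; exists 0, w; rewrite scale0r add0r.
    apply/eqP => WE; apply: nWx; rewrite WE; exists 1, 0.
    by rewrite scale1r addr0.
  split.
    move=> c _ _ [d [w [Ww ->]]] [d' [w' [Ww' ->]]].
    exists (c * d + d'), (c *: w + w'); split; first exact: WL.
    by rewrite scalerDr scalerDl scalerA addrACA.
  move=> [c [w [Ww aE]]].
  have [c0|c0] := eqVneq c 0.
    by apply: Wa; rewrite aE c0 scale0r add0r.
  apply: nex; exists c^-1; rewrite aE scalerDr scalerA mulVf // scale1r.
  rewrite opprD addrA subrr add0r -scalerN -[_ *: _]addr0; apply: WL => //.
  by rewrite -scaleN1r; apply: lin_closedZ.
have [f fW] := choice ex.
have fu x c : W (x - c *: a) -> f x = c.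
  move=> Wc; apply/eqP; apply: contra_notT Wa => nfc.
  have : W ((x - c *: a) - (x - f x *: a)) by exact: lin_closedB (fW x).
  rewrite opprB addrC addrA subrK -scalerBl => Wa'.
  rewrite -[a]scale1r -(mulVf (_ : f x - c != 0)); last first.
    by rewrite subr_eq0.
  by rewrite -scalerA; apply: lin_closedZ.
have fL : scalar f.
  move=> c u v; apply: fu.
  rewrite scalerDl -scalerA opprD addrACA -scalerBr; apply: WL; exact: fW.
pose g : {scalar L} := HB.pack f (GRing.isLinear.Build k L k *%R f fL).
exists g => /=; rewrite (fu a 1) ?oner_neq0 // scale1r subrr.
exact: W0.
Qed.

Definition mk_lrmorphism (k : fieldType) (A R : comAlgType k) (f : A -> R)
    (fL : linear f) (fM : monoid_morphism f) : {lrmorphism A -> R} :=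
  HB.pack f (GRing.isLinear.Build k A R *:%R f fL)
    (GRing.isMonoidMorphism.Build A R f fM).

Definition mk_scalar (k : fieldType) (L : lmodType k) (f : L -> k)
    (fL : scalar f) : {scalar L} :=
  HB.pack f (GRing.isLinear.Build k L k *%R f fL).

Lemma mem_In (T : eqType) (x : T) s : x \in s -> List.In x s.
Proof.
by elim: s => //= y s IH; rewrite inE => /orP[/eqP ->|/IH]; [left | right].
Qed.

Section Unbundled.
Variables (k : fieldType) (L M : lmodType k) (f : L -> M).
Hypothesis fL : linear f.

Lemma linear_unb0 : f 0 = 0.
Proof. by have := fL (-1) 0 0; rewrite scaler0 addr0 scaleN1r addNr. Qed.

Lemma linear_unbD u v : f (u + v) = f u + f v.
Proof. by rewrite -[u in LHS]scale1r fL scale1r. Qed.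

Lemma linear_unbZ a u : f (a *: u) = a *: f u.
Proof. by rewrite -[_ *: u]addr0 fL linear_unb0 addr0. Qed.

Lemma linear_unbN u : f (- u) = - f u.
Proof. by rewrite -scaleN1r linear_unbZ scaleN1r. Qed.

Lemma linear_unb_sum (I : Type) (r : seq I) (P : pred I) (F : I -> L) :
  f (\sum_(i <- r | P i) F i) = \sum_(i <- r | P i) f (F i).
Proof.
by apply: (big_morph f); [exact: linear_unbD | exact: linear_unb0].
Qed.
End Unbundled.

Section WellDefined.
Variables (k : fieldType) (A B : lmodType k) (T T' : Type).
Variables (ev : T -> A -> k) (ev' : T' -> B -> k).
Hypothesis evL : forall t, scalar (ev t).
Hypothesis evL' : forall t, scalar (ev' t).
Hypothesis sep : forall a, (forall t, ev t a = 0) -> a = 0.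
Hypothesis sep' : forall a, (forall t, ev' t a = 0) -> a = 0.

(* Functionals detect tensors: an element of A (x) B killed by all products
   of functionals is killed by every bilinear map. *)
Lemma bilinear_vanish (M : lmodType k) (beta : A -> B -> M) (s : seq (A * B)) :
  (forall b, linear (beta^~ b)) -> (forall a, linear (beta a)) ->
  (forall t t', \sum_(p <- s) ev t p.1 * ev' t' p.2 = 0) ->
  \sum_(p <- s) beta p.1 p.2 = 0.
Proof.
move=> bl br H.
pose V := lspan [seq p.1 | p <- s].
have [||n [e [t [_ _ Ve]]]] :=
    @dual_basis k A T ev evL V [seq p.1 | p <- s] (lspan_closed _).
- by [].
- by move=> v _ vt; apply: sep => t; apply: vt.
have -> : \sum_(p <- s) beta p.1 p.2
    = \sum_j beta (e j) (\sum_(p <- s) ev (t j) p.1 *: p.2).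
  under [RHS]eq_bigr => j _ do rewrite (linear_unb_sum (br _)).
  rewrite exchange_big /=; apply: eq_big_seq => p ps.
  have {1}-> : p.1 = \sum_i ev (t i) p.1 *: e i.
    by apply: Ve; apply: lspan_mem; apply: mem_In; apply: map_f.
  rewrite (linear_unb_sum (bl _)); apply: eq_bigr => j _.
  by rewrite (linear_unbZ (bl _)) (linear_unbZ (br _)).
rewrite big1 // => j _.
have -> : \sum_(p <- s) ev (t j) p.1 *: p.2 = 0; last exact: (linear_unb0 (br _)).
apply: sep' => t'; rewrite (ev_sum evL').
by rewrite -[RHS](H (t j) t'); apply: eq_bigr => p _; rewrite (evZ evL').
Qed.

Lemma bilinear_eq (M : lmodType k) (beta : A -> B -> M) (s s' : seq (A * B)) :
  (forall b, linear (beta^~ b)) -> (forall a, linear (beta a)) ->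
  (forall t t', \sum_(p <- s) ev t p.1 * ev' t' p.2
              = \sum_(p <- s') ev t p.1 * ev' t' p.2) ->
  \sum_(p <- s) beta p.1 p.2 = \sum_(p <- s') beta p.1 p.2.
Proof.
move=> bl br H.
pose s2 := s ++ [seq (- p.1, p.2) | p <- s'].
have := @bilinear_vanish M beta s2 bl br.
rewrite big_cat big_map /= => H2; apply/eqP; rewrite -subr_eq0; apply/eqP.
rewrite -sumrN -[RHS]H2; last first.
  move=> t t'; rewrite big_cat big_map /= H -big_split big1 //= => p _.
  by rewrite -sub0r (evB evL) (ev0 evL) sub0r mulNr subrr.
by congr (_ + _); apply: eq_bigr => p _; rewrite (linear_unbN (bl _)).
Qed.
End WellDefined.

Section Trilinear.
Variables (k : fieldType) (A B C : lmodType k) (T T' T'' : Type).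
Variables (ev : T -> A -> k) (ev' : T' -> B -> k) (ev'' : T'' -> C -> k).
Hypothesis evL : forall t, scalar (ev t).
Hypothesis evL' : forall t, scalar (ev' t).
Hypothesis evL'' : forall t, scalar (ev'' t).
Hypothesis sep : forall a, (forall t, ev t a = 0) -> a = 0.
Hypothesis sep' : forall a, (forall t, ev' t a = 0) -> a = 0.
Hypothesis sep'' : forall a, (forall t, ev'' t a = 0) -> a = 0.

(** A dual basis for the first factors reduces this to [bilinear_eq] in the other two. *)
Lemma trilinear_eq (M : lmodType k) (tau : A -> B -> C -> M)
    (s s' : seq (A * B * C)) :
  (forall b c, linear (fun a => tau a b c)) ->
  (forall a c, linear (fun b => tau a b c)) ->
  (forall a b, linear (fun c => tau a b c)) ->
  (forall t t' t'', \sum_(p <- s) ev t p.1.1 * ev' t' p.1.2 * ev'' t'' p.2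
                  = \sum_(p <- s') ev t p.1.1 * ev' t' p.1.2 * ev'' t'' p.2) ->
  \sum_(p <- s) tau p.1.1 p.1.2 p.2 = \sum_(p <- s') tau p.1.1 p.1.2 p.2.
Proof.
move=> t1 t2 t3 H.
pose V := lspan [seq p.1.1 | p <- s ++ s'].
have [||n [e [t [_ _ Ve]]]] :=
    @dual_basis k A T ev evL V [seq p.1.1 | p <- s ++ s'] (lspan_closed _).
- by [].
- by move=> v _ vt; apply: sep => t; apply: vt.
have E r : (forall p, p \in r -> p \in s ++ s') ->
    \sum_(p <- r) tau p.1.1 p.1.2 p.2
    = \sum_j \sum_(p <- [seq (ev (t j) p.1.1 *: p.1.2, p.2) | p <- r])
        tau (e j) p.1 p.2.
  move=> rs; under [RHS]eq_bigr => j _ do rewrite big_map /=.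
  rewrite exchange_big /=; apply: eq_big_seq => p /rs pr.
  have {1}-> : p.1.1 = \sum_i ev (t i) p.1.1 *: e i.
    by apply: Ve; apply: lspan_mem; apply: mem_In; apply: (map_f (fun p => p.1.1)).
  rewrite (linear_unb_sum (t1 _ _)); apply: eq_bigr => j _.
  by rewrite (linear_unbZ (t1 _ _)) (linear_unbZ (t2 _ _)).
rewrite !E; try by move=> p; rewrite mem_cat => ->; rewrite ?orbT.
apply: eq_bigr => j _.
apply: (bilinear_eq evL' evL'' sep' sep'' (t2 (e j)) (t3 (e j))) => t' t''.
rewrite !big_map /=; have := H (t j) t' t''.
by congr (_ = _); apply: eq_bigr => p _; rewrite (evZ evL').
Qed.
End Trilinear.

(** * Affine groups from Hopf algebras *)

Section HopfGroup.
Variables (k : fieldType) (A : comAlgType k) (T : Type) (ev : T -> A -> k).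
Hypothesis evL : forall t, scalar (ev t).
Hypothesis sep : forall a, (forall t, ev t a = 0) -> a = 0.
Variables (mulT : T -> T -> T) (delta : A -> seq (A * A)).
Hypothesis deltaE : forall t t' a,
  ev (mulT t t') a = \sum_(p <- delta a) ev t p.1 * ev t' p.2.
Hypothesis mulTA : forall t t' t'' a,
  ev (mulT (mulT t t') t'') a = ev (mulT t (mulT t' t'')) a.
Hypothesis delta1 : forall t t',
  \sum_(p <- delta 1) ev t p.1 * ev t' p.2 = ev t 1 * ev t' 1.
Hypothesis deltaM : forall t t' a b,
  \sum_(p <- delta (a * b)) ev t p.1 * ev t' p.2 =
  \sum_(p <- delta a) \sum_(q <- delta b) ev t (p.1 * q.1) * ev t' (p.2 * q.2).
Variables (eps : {lrmorphism A -> k^o}) (S : {lrmorphism A -> A}).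
Hypothesis epsl : forall a, \sum_(p <- delta a) (eps p.1 : k) *: p.2 = a.
Hypothesis epsr : forall a, \sum_(p <- delta a) (eps p.2 : k) *: p.1 = a.
Hypothesis Sl : forall a, \sum_(p <- delta a) S p.1 * p.2 = (eps a : k)%:A.
Hypothesis Sr : forall a, \sum_(p <- delta a) p.1 * S p.2 = (eps a : k)%:A.

Let bl (R : comAlgType k) (x y : {linear A -> R}) (b : A) :
  linear (fun a => x a * y b).
Proof. by move=> c u v; rewrite linearP mulrDl scalerAl. Qed.

Let br (R : comAlgType k) (x y : {linear A -> R}) (a : A) :
  linear (fun b => x a * y b).
Proof. by move=> c u v; rewrite linearP mulrDr scalerAr. Qed.

Definition hopf_mul_fun (R : comAlgType k) (x y : {lrmorphism A -> R}) a : R :=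
  \sum_(p <- delta a) x p.1 * y p.2.

Let mulE (R : comAlgType k) (x y : {lrmorphism A -> R}) s s' :
  (forall t t', \sum_(p <- s) ev t p.1 * ev t' p.2
              = \sum_(p <- s') ev t p.1 * ev t' p.2) ->
  \sum_(p <- s) x p.1 * y p.2 = \sum_(p <- s') x p.1 * y p.2.
Proof. exact: (bilinear_eq evL evL sep sep (bl x y) (br x y)). Qed.

(** [delta a] is just some list representing a tensor, so it is not additive in [a]. By
    [bilinear_eq] the list may be replaced by any other with the same values on pairs of
    functionals. *)
Lemma hopf_mul_linear R x y : linear (@hopf_mul_fun R x y).
Proof.
move=> c a b; rewrite /hopf_mul_fun.
rewrite (@mulE _ _ _ _ ([seq (c *: p.1, p.2) | p <- delta a] ++ delta b)).
  rewrite big_cat big_map /= scaler_sumr; congr (_ + _).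
  by apply: eq_bigr => p _; rewrite linearZ /= scalerAl.
move=> t t'; rewrite big_cat big_map /= -!deltaE evL; congr (_ + _).
rewrite deltaE mulr_sumr; apply: eq_bigr => p _.
by rewrite (evZ evL) mulrA.
Qed.

Lemma hopf_mul_monoid R x y : monoid_morphism (@hopf_mul_fun R x y).
Proof.
split=> [|a b]; rewrite /hopf_mul_fun.
  rewrite (@mulE _ _ _ _ [:: (1, 1)]); first by rewrite big_seq1 !rmorph1 mulr1.
  by move=> t t'; rewrite delta1 big_seq1.
rewrite (@mulE _ _ _ _
  [seq (p.1 * q.1, p.2 * q.2) | p <- delta a, q <- delta b]).
  rewrite big_allpairs_dep /= mulr_suml; apply: eq_bigr => p _.
  by rewrite mulr_sumr; apply: eq_bigr => q _; rewrite !rmorphM mulrACA.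
by move=> t t'; rewrite deltaM big_allpairs_dep.
Qed.

Definition hopf_mul R x y := mk_lrmorphism (@hopf_mul_linear R x y) (hopf_mul_monoid x y).

Definition hopf_one_fun (R : comAlgType k) (a : A) : R := (eps a : k)%:A.

Lemma hopf_one_linear R : linear (@hopf_one_fun R).
Proof. by move=> c a b; rewrite /hopf_one_fun linearP /= scalerDl scalerA. Qed.

Lemma hopf_one_monoid R : monoid_morphism (@hopf_one_fun R).
Proof.
split=> [|a b]; rewrite /hopf_one_fun; first by rewrite rmorph1 scale1r.
by rewrite rmorphM /= -scalerAl mul1r scalerA.
Qed.

Definition hopf_one R := mk_lrmorphism (@hopf_one_linear R) (hopf_one_monoid R).

Definition hopf_inv (R : comAlgType k) (x : {lrmorphism A -> R}) := alg_comp x S.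

Lemma hopf_mulA R : associative (@hopf_mul R).
Proof.
move=> x y z; apply: lrmorphism_eq => a; rewrite /= /hopf_mul_fun /=.
have tL (x1 y1 z1 : {linear A -> R}) :
    [/\ forall b c, linear (fun a => x1 a * y1 b * z1 c),
        forall a c, linear (fun b => x1 a * y1 b * z1 c) &
        forall a b, linear (fun c => x1 a * y1 b * z1 c)].
  split=> ? ? c u v; rewrite linearP ?mulrDr ?mulrDl -?scalerAl -?scalerAr //.
  by rewrite -?scalerAl.
have [t1 t2 t3] := tL x y z.
have H : \sum_(p <- [seq (p.1, q.1, q.2) | p <- delta a, q <- delta p.2])
      x p.1.1 * y p.1.2 * z p.2 =
    \sum_(p <- [seq (q.1, q.2, p.2) | p <- delta a, q <- delta p.1])
      x p.1.1 * y p.1.2 * z p.2.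
  apply: (trilinear_eq evL evL evL sep sep sep t1 t2 t3) => t t' t''.
  rewrite !big_allpairs_dep /=.
  transitivity (ev (mulT t (mulT t' t'')) a).
    rewrite deltaE; apply: eq_bigr => p _; rewrite deltaE mulr_sumr.
    by apply: eq_bigr => q _; rewrite mulrA.
  rewrite -mulTA deltaE; apply: eq_bigr => p _.
  by rewrite deltaE mulr_suml.
rewrite !big_allpairs_dep /= in H.
rewrite (eq_bigr _ (fun p _ => mulr_sumr _ _ _ _)).
under [RHS]eq_bigr do rewrite mulr_suml.
rewrite -H; apply: eq_bigr => p _.
by apply: eq_bigr => q _; rewrite mulrA.
Qed.

Lemma hopf_1mul R : left_id (hopf_one R) (@hopf_mul R).
Proof.
move=> x; apply: lrmorphism_eq => a; rewrite /= /hopf_mul_fun /=.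
rewrite -[in RHS](epsl a) linear_sum; apply: eq_bigr => p _.
by rewrite linearZ /= /hopf_one_fun -scalerAl mul1r.
Qed.

Lemma hopf_mul1 R : right_id (hopf_one R) (@hopf_mul R).
Proof.
move=> x; apply: lrmorphism_eq => a; rewrite /= /hopf_mul_fun /=.
rewrite -[in RHS](epsr a) linear_sum; apply: eq_bigr => p _.
by rewrite linearZ /= /hopf_one_fun -scalerAr mulr1.
Qed.

Lemma hopf_Vmul R : left_inverse (hopf_one R) (@hopf_inv R) (@hopf_mul R).
Proof.
move=> x; apply: lrmorphism_eq => a; rewrite /= /hopf_mul_fun /=.
rewrite /hopf_one_fun; have := congr1 x (Sl a); rewrite linear_sum linearZ /= rmorph1 => <-.
by apply: eq_bigr => p _; rewrite rmorphM.
Qed.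

Lemma hopf_mulV R : right_inverse (hopf_one R) (@hopf_inv R) (@hopf_mul R).
Proof.
move=> x; apply: lrmorphism_eq => a; rewrite /= /hopf_mul_fun /=.
rewrite /hopf_one_fun; have := congr1 x (Sr a); rewrite linear_sum linearZ /= rmorph1 => <-.
by apply: eq_bigr => p _; rewrite rmorphM.
Qed.

Lemma hopf_natural (R R' : comAlgType k) (h : {lrmorphism R -> R'})
    (x y : {lrmorphism A -> R}) :
  alg_comp h (hopf_mul x y) = hopf_mul (alg_comp h x) (alg_comp h y).
Proof.
apply: lrmorphism_eq => a; rewrite /= /hopf_mul_fun /= linear_sum.
by apply: eq_bigr => p _; rewrite rmorphM.
Qed.

(** The family [ev] is left general because the construction is used twice: with all linear forms
    under convolution, and with the elements of a topological group. *)
Definition hopf_group : affineGroup k :=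
  AffineGroup hopf_mulA hopf_1mul hopf_mul1 hopf_Vmul hopf_mulV hopf_natural.

End HopfGroup.

Lemma functional_separation0 (k : fieldType) (L : lmodType k) (a : L) :
  (forall l : {scalar L}, l a = 0) -> a = 0.
Proof.
move=> al; apply/eqP; apply: contraPT al => /functional_separation[l la].
by move=> /(_ l)/eqP; apply/negP.
Qed.

(** * Tensor products of algebras *)

Section Tensor.
Variables (k : fieldType) (A B : comAlgType k).

Definition tens_fun (s : seq (A * B)) (l : {scalar A}) (m : {scalar B}) : k :=
  \sum_(p <- s) l p.1 * m p.2.

(* The tensor product of A and B, realized as bilinear forms on the duals. *)
Record tensor := Tensor {
  tens_form : {scalar A} -> {scalar B} -> k;
  tens_formP : exists s, tens_form = tens_fun s
}.

Definition tens (s : seq (A * B)) : tensor :=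
  Tensor (ex_intro (fun s' => tens_fun s = tens_fun s') s erefl).

Definition tens_rep (F : tensor) : seq (A * B) := projT1 (cid (tens_formP F)).

Lemma tens_inj F G : tens_form F = tens_form G -> F = G.
Proof.
case: F G => [f Pf] [g Pg] /= fg; move: Pf; rewrite fg => Pf.
by rewrite (Prop_irrelevance Pf Pg).
Qed.

Lemma tens_repK F : tens (tens_rep F) = F.
Proof. by apply: tens_inj; rewrite /= /tens_rep; case: cid. Qed.

Lemma tensP s s' : (forall l m, tens_fun s l m = tens_fun s' l m) <->
  tens s = tens s'.
Proof.
split=> [H|]; first by apply: tens_inj => /=; apply/funext => l; apply/funext.
by move=> /(congr1 tens_form) /= H l m; rewrite H.
Qed.

Lemma tens_rep_form s l m : tens_fun (tens_rep (tens s)) l m = tens_fun s l m.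
Proof. by move: l m; apply/tensP; rewrite tens_repK. Qed.

HB.instance Definition _ := gen_eqMixin tensor.
HB.instance Definition _ := gen_choiceMixin tensor.

Definition tens_add F G := tens (tens_rep F ++ tens_rep G).
Definition tens_opp F := tens [seq (- p.1, p.2) | p <- tens_rep F].
Definition tens_scale c F := tens [seq (c *: p.1, p.2) | p <- tens_rep F].
Definition tens_prod (s s' : seq (A * B)) :=
  [seq (p.1 * q.1, p.2 * q.2) | p <- s, q <- s'].
Definition tens_mul F G := tens (tens_prod (tens_rep F) (tens_rep G)).

Lemma tens_fun_cat s s' l m :
  tens_fun (s ++ s') l m = tens_fun s l m + tens_fun s' l m.
Proof. by rewrite /tens_fun big_cat. Qed.

Lemma tens_fun_scale c s l m :
  tens_fun [seq (c *: p.1, p.2) | p <- s] l m = c * tens_fun s l m.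
Proof.
rewrite /tens_fun big_map mulr_sumr; apply: eq_bigr => p _.
by rewrite linearZ /= mulrA.
Qed.

Lemma tens_fun_opp s l m :
  tens_fun [seq (- p.1, p.2) | p <- s] l m = - tens_fun s l m.
Proof.
rewrite /tens_fun big_map -sumrN; apply: eq_bigr => p _.
by rewrite linearN mulNr.
Qed.

Let shift_scalar (C : comAlgType k) (l : {scalar C}) (c : C) : scalar (fun a => l (a * c)).
Proof. by move=> x u v; rewrite mulrDl -scalerAl linearP. Qed.

Lemma tens_fun_prod s s' l m :
  tens_fun (tens_prod s s') l m =
  \sum_(q <- s') tens_fun s (mk_scalar (shift_scalar l q.1))
                            (mk_scalar (shift_scalar m q.2)).
Proof. by rewrite /tens_fun /tens_prod big_allpairs_dep exchange_big. Qed.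

Lemma tens_prodC s s' l m :
  tens_fun (tens_prod s s') l m = tens_fun (tens_prod s' s) l m.
Proof.
rewrite /tens_fun /tens_prod !big_allpairs_dep exchange_big /=.
by apply: eq_bigr => p _; apply: eq_bigr => q _; rewrite [q.1 * _]mulrC [q.2 * _]mulrC.
Qed.

Lemma tens_prod_repl s s' l m :
  tens_fun (tens_prod (tens_rep (tens s)) s') l m = tens_fun (tens_prod s s') l m.
Proof.
by rewrite !tens_fun_prod; apply: eq_bigr => q _; rewrite tens_rep_form.
Qed.

Lemma tens_prod_repr s s' l m :
  tens_fun (tens_prod s (tens_rep (tens s'))) l m = tens_fun (tens_prod s s') l m.
Proof. by rewrite tens_prodC tens_prod_repl tens_prodC. Qed.

Lemma tens_mulE s s' : tens_mul (tens s) (tens s') = tens (tens_prod s s').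
Proof. by apply/tensP => l m; rewrite tens_prod_repl tens_prod_repr. Qed.

Lemma tens_addA : associative tens_add.
Proof.
move=> F G H; apply/tensP => l m.
by rewrite !(tens_fun_cat, tens_rep_form) addrA.
Qed.
Lemma tens_addC : commutative tens_add.
Proof.
by move=> F G; apply/tensP => l m; rewrite !tens_fun_cat addrC.
Qed.
Lemma tens_add0 : left_id (tens [::]) tens_add.
Proof.
move=> F; rewrite -[RHS]tens_repK; apply/tensP => l m.
by rewrite tens_fun_cat tens_rep_form /tens_fun big_nil add0r.
Qed.
Lemma tens_addN : left_inverse (tens [::]) tens_opp tens_add.
Proof.
move=> F; apply/tensP => l m.
by rewrite tens_fun_cat tens_rep_form tens_fun_opp addNr /tens_fun big_nil.
Qed.

HB.instance Definition _ :=
  GRing.isZmodule.Build tensor tens_addA tens_addC tens_add0 tens_addN.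

Lemma tens_mulA : associative tens_mul.
Proof.
move=> F G H; rewrite -[F]tens_repK -[G]tens_repK -[H]tens_repK !tens_mulE.
apply/tensP => l m; rewrite /tens_fun /tens_prod !big_allpairs_dep /=.
apply: eq_bigr => p _; rewrite big_allpairs_dep; apply: eq_bigr => q _ /=.
by apply: eq_bigr => r _; rewrite !mulrA.
Qed.
Lemma tens_mulC : commutative tens_mul.
Proof. by move=> F G; apply/tensP => l m; rewrite tens_prodC. Qed.
Lemma tens_mul1 : left_id (tens [:: (1, 1)]) tens_mul.
Proof.
move=> F; rewrite -[F]tens_repK tens_mulE; apply/tensP => l m.
rewrite /tens_fun /tens_prod big_allpairs_dep big_seq1.
by apply: eq_bigr => p _; rewrite !mul1r.
Qed.
Lemma tens_mulDl : left_distributive tens_mul +%R.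
Proof.
move=> F G H; rewrite -[F]tens_repK -[G]tens_repK -[H]tens_repK.
rewrite /GRing.add /= /tens_add !tens_mulE; apply/tensP => l m.
rewrite tens_fun_cat !tens_rep_form !tens_fun_prod -big_split /=.
by apply: eq_bigr => q _; rewrite tens_fun_cat !tens_rep_form.
Qed.

Lemma tens_1neq0 : tens [:: (1, 1)] != 0 :> tensor.
Proof.
apply/eqP => /tensP H.
have [l l1] := functional_separation (oner_neq0 A).
have [m m1] := functional_separation (oner_neq0 B).
have := H l m; rewrite /tens_fun big_seq1 big_nil /= => /eqP.
by rewrite mulf_eq0 (negbTE l1) (negbTE m1).
Qed.

HB.instance Definition _ := GRing.Zmodule_isComNzRing.Build tensor
  tens_mulA tens_mulC tens_mul1 tens_mulDl tens_1neq0.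

Lemma tens_scaleA (a b : k) (F : tensor) :
  tens_scale a (tens_scale b F) = tens_scale (a * b) F.
Proof.
apply/tensP => l m.
by rewrite !(tens_fun_scale, tens_rep_form) mulrA.
Qed.
Lemma tens_scale1 : left_id 1 tens_scale.
Proof.
move=> F; rewrite -[RHS]tens_repK; apply/tensP => l m.
by rewrite tens_fun_scale mul1r.
Qed.
Lemma tens_scaleDr : right_distributive tens_scale +%R.
Proof.
move=> c F G; apply/tensP => l m.
by rewrite !(tens_fun_scale, tens_fun_cat, tens_rep_form) mulrDr.
Qed.
Lemma tens_scaleDl F : {morph tens_scale^~ F : a b / a + b}.
Proof.
move=> a b; apply/tensP => l m.
by rewrite !(tens_fun_scale, tens_fun_cat, tens_rep_form) mulrDl.
Qed.

HB.instance Definition _ := GRing.Zmodule_isLmodule.Build k tensor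
  tens_scaleA tens_scale1 tens_scaleDr tens_scaleDl.

Lemma tens_scaleAl (c : k) (F G : tensor) : c *: (F * G) = (c *: F) * G.
Proof.
apply/tensP => l m; rewrite tens_fun_scale tens_rep_form tens_prod_repl.
rewrite /tens_fun /tens_prod !big_allpairs_dep /= big_map mulr_sumr.
apply: eq_bigr => p _; rewrite mulr_sumr; apply: eq_bigr => q _ /=.
by rewrite -scalerAl linearZ /= mulrA.
Qed.

HB.instance Definition _ := GRing.Lmodule_isLalgebra.Build k tensor tens_scaleAl.
HB.instance Definition _ := GRing.Lalgebra_isComAlgebra.Build k tensor.

Lemma tens_formD F G l m : tens_form (F + G) l m = tens_form F l m + tens_form G l m.
Proof.
by rewrite /= tens_fun_cat -[in RHS](tens_repK F) -[in RHS](tens_repK G).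
Qed.

Lemma tens_formZ c F l m : tens_form (c *: F) l m = c * tens_form F l m.
Proof. by rewrite /= tens_fun_scale -[in RHS](tens_repK F). Qed.

Lemma tens_form_scalar l m : scalar (fun F : tensor => tens_form F l m).
Proof. by move=> c F G; rewrite tens_formD tens_formZ. Qed.

Definition tens_inl_fun (a : A) : tensor := tens [:: (a, 1)].
Definition tens_inr_fun (b : B) : tensor := tens [:: (1, b)].

Lemma tens_inl_linear : linear tens_inl_fun.
Proof.
move=> c u v; apply/tensP => l m.
rewrite tens_fun_cat !tens_rep_form tens_fun_scale tens_rep_form.
by rewrite /tens_fun !big_seq1 linearP /= mulrDl mulrA.
Qed.
Lemma tens_inr_linear : linear tens_inr_fun.
Proof.
move=> c u v; apply/tensP => l m.
rewrite tens_fun_cat !tens_rep_form tens_fun_scale tens_rep_form.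
by rewrite /tens_fun !big_seq1 linearP /= mulrDr mulrCA.
Qed.
Lemma tens_inl_monoid : monoid_morphism tens_inl_fun.
Proof.
split=> // u v; rewrite [RHS]tens_mulE; apply/tensP => l m.
by rewrite /tens_fun /tens_prod /= !big_seq1 /= mulr1.
Qed.
Lemma tens_inr_monoid : monoid_morphism tens_inr_fun.
Proof.
split=> // u v; rewrite [RHS]tens_mulE; apply/tensP => l m.
by rewrite /tens_fun /tens_prod /= !big_seq1 /= mulr1.
Qed.
Definition tens_inl : {lrmorphism A -> tensor} :=
  mk_lrmorphism tens_inl_linear tens_inl_monoid.
Definition tens_inr : {lrmorphism B -> tensor} :=
  mk_lrmorphism tens_inr_linear tens_inr_monoid.

Section Lift.
Variables (R : comAlgType k) (x : {lrmorphism A -> R}) (y : {lrmorphism B -> R}).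

Definition tens_lift_fun (F : tensor) : R :=
  \sum_(p <- tens_rep F) x p.1 * y p.2.

(** Independence of the representing list: the linear forms on both factors detect tensors. *)
Lemma tens_lift_funE s : tens_lift_fun (tens s) = \sum_(p <- s) x p.1 * y p.2.
Proof.
apply: (@bilinear_eq k A B {scalar A} {scalar B} (fun l a => l a) (fun m b => m b)
  (fun l => @linearP _ _ _ _ l) (fun l => @linearP _ _ _ _ l) _ _ R
  (fun a b => x a * y b)).
- exact: functional_separation0.
- exact: functional_separation0.
- by move=> b c u v; rewrite linearP mulrDl scalerAl.
- by move=> a c u v; rewrite linearP mulrDr scalerAr.
- exact: tens_rep_form.
Qed.

Lemma tens_lift_linear : linear tens_lift_fun.
Proof.
move=> c F G; rewrite tens_lift_funE big_cat -/(tens_lift_fun _).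
rewrite tens_lift_funE big_map scaler_sumr; congr (_ + _).
by apply: eq_bigr => p _; rewrite linearZ /= scalerAl.
Qed.

Lemma tens_lift_monoid : monoid_morphism tens_lift_fun.
Proof.
split=> [|F G]; first by rewrite tens_lift_funE big_seq1 !rmorph1 mulr1.
rewrite tens_lift_funE big_allpairs_dep mulr_suml; apply: eq_bigr => p _.
by rewrite mulr_sumr; apply: eq_bigr => q _; rewrite !rmorphM mulrACA.
Qed.

Definition tens_lift := mk_lrmorphism tens_lift_linear tens_lift_monoid.

Lemma tens_lift_inl : alg_comp tens_lift tens_inl = x.
Proof.
apply: lrmorphism_eq => a.
by rewrite [LHS]tens_lift_funE big_seq1 rmorph1 mulr1.
Qed.
Lemma tens_lift_inr : alg_comp tens_lift tens_inr = y.
Proof.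
apply: lrmorphism_eq => a.
by rewrite [LHS]tens_lift_funE big_seq1 rmorph1 mul1r.
Qed.
End Lift.
End Tensor.

(** * Hopf algebra of an affine group and algebraic quotients *)

Section AffineGroupTheory.
Variables (k : fieldType) (U : affineGroup k).
Local Notation A := (coord_alg U).

(** The image of the unit is idempotent, and only the unit of a group is. *)
Lemma pt_one_natural (R S : comAlgType k) (h : {lrmorphism R -> S}) :
  alg_comp h (pt_one U R) = pt_one U S.
Proof.
set e := alg_comp h _.
have ee : pt_mul e e = e by rewrite -pt_mul_natural pt_1mul.
by rewrite -[LHS](pt_1mul (a := U)) -(pt_Vmul e) -pt_mulA ee.
Qed.

Lemma pt_inv_natural (R S : comAlgType k) (h : {lrmorphism R -> S})
    (x : {lrmorphism A -> R}) :
  alg_comp h (pt_inv x) = pt_inv (alg_comp h x).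
Proof.
rewrite -[LHS](pt_mul1 (a := U)) -(pt_mulV (alg_comp h x)) pt_mulA.
by rewrite -pt_mul_natural pt_Vmul pt_one_natural pt_1mul.
Qed.

Definition alg_id : {lrmorphism A -> A} :=
  mk_lrmorphism (f := fun a : A => a) (fun c u v => erefl) (erefl, fun u v => erefl).

Lemma alg_comp_id (R : comAlgType k) (x : {lrmorphism A -> R}) :
  alg_comp x alg_id = x.
Proof. exact: lrmorphism_eq. Qed.

Definition counit : {lrmorphism A -> k^o} := pt_one U k^o.
Definition antipode : {lrmorphism A -> A} := pt_inv alg_id.

Lemma structure_linear (R : comAlgType k) : linear (fun c : k^o => (c : k)%:A : R).
Proof. by move=> c u v; rewrite scalerDl scalerA. Qed.
Lemma structure_monoid (R : comAlgType k) : monoid_morphism (fun c : k^o => (c : k)%:A : R).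
Proof. by split=> [|u v]; rewrite ?scale1r // -scalerAl mul1r scalerA. Qed.

Lemma pt_oneE (R : comAlgType k) a : pt_one U R a = (counit a : k)%:A.
Proof.
by rewrite -(pt_one_natural (mk_lrmorphism (structure_linear R) (structure_monoid R))).
Qed.

Lemma pt_invE (R : comAlgType k) (x : {lrmorphism A -> R}) a :
  pt_inv x a = x (antipode a).
Proof. by rewrite -[x in LHS]alg_comp_id -pt_inv_natural. Qed.

Lemma tens_inlr (B C : comAlgType k) (b : B) (c : C) :
  tens_inl B C b * tens_inr B C c = tens [:: (b, c)].
Proof.
rewrite [LHS]tens_mulE; apply/tensP => l m.
by rewrite /tens_fun /tens_prod /= !big_seq1 /= mul1r mulr1.
Qed.

Lemma tens_sum (B C : comAlgType k) (s : seq (B * C)) :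
  \sum_(p <- s) tens_inl B C p.1 * tens_inr B C p.2 = tens s.
Proof.
under eq_bigr do rewrite tens_inlr.
apply: tens_inj; apply/funext => l; apply/funext => m.
pose ev (_ : unit) (F : tensor B C) := tens_form F l m.
have evL t : scalar (ev t) by exact: tens_form_scalar.
rewrite -/(ev tt _) (ev_sum evL tt); apply: eq_bigr => p _.
by rewrite /ev /= /tens_fun big_seq1.
Qed.

(** Yoneda: the two inclusions into [tensor A A] are the universal pair of points. Their product is
    the comultiplication, and every pair [x], [y] is their image under [tens_lift x y]. *)
Lemma comult_ex (a : A) : exists s : seq (A * A),
  forall (R : comAlgType k) (x y : {lrmorphism A -> R}),
    pt_mul x y a = \sum_(p <- s) x p.1 * y p.2.
Proof.
exists (tens_rep (pt_mul (tens_inl A A) (tens_inr A A) a)) => R x y.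
have -> : pt_mul x y = pt_mul (alg_comp (tens_lift x y) (tens_inl A A))
    (alg_comp (tens_lift x y) (tens_inr A A)).
  by rewrite tens_lift_inl tens_lift_inr.
by rewrite -pt_mul_natural.
Qed.

Definition comult (a : A) := projT1 (cid (comult_ex a)).

Lemma comultE (a : A) (R : comAlgType k) (x y : {lrmorphism A -> R}) :
  pt_mul x y a = \sum_(p <- comult a) x p.1 * y p.2.
Proof. by rewrite /comult; case: cid. Qed.

(** The inclusions into the tensor product are themselves a pair of points, so an identity valid for
    all pairs of points holds between tensors and passes to linear forms. *)
Lemma comult_tens (B C : comAlgType k) (s s' : seq (B * C)) :
  (forall (R : comAlgType k) (x : {lrmorphism B -> R}) (y : {lrmorphism C -> R}),
     \sum_(p <- s) x p.1 * y p.2 = \sum_(p <- s') x p.1 * y p.2) ->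
  forall (l : {scalar B}) (m : {scalar C}),
    \sum_(p <- s) l p.1 * m p.2 = \sum_(p <- s') l p.1 * m p.2.
Proof.
move=> H; apply/tensP; rewrite -!tens_sum; exact: H.
Qed.

Definition convol_fun (l m : {scalar A}) (a : A) : k :=
  \sum_(p <- comult a) l p.1 * m p.2.

Lemma convol_scalar l m : scalar (convol_fun l m).
Proof.
move=> c a b; rewrite /convol_fun.
rewrite (@comult_tens _ _ _ ([seq (c *: p.1, p.2) | p <- comult a] ++ comult b)).
  rewrite big_cat big_map /= mulr_sumr; congr (_ + _).
  by apply: eq_bigr => p _; rewrite linearZ /= mulrA.
move=> R x y; rewrite -comultE linearP big_cat big_map /= !comultE; congr (_ + _).
by rewrite scaler_sumr; apply: eq_bigr => p _; rewrite linearZ /= scalerAl.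
Qed.

Definition convol l m := mk_scalar (convol_scalar l m).

Lemma convolE l m a : convol l m a = \sum_(p <- comult a) l p.1 * m p.2.
Proof. by []. Qed.

Lemma comult_coassoc (a : A) (R : comAlgType k) (x y z : {lrmorphism A -> R}) :
  \sum_(p <- comult a) \sum_(q <- comult p.2) x p.1 * (y q.1 * z q.2) =
  \sum_(p <- comult a) \sum_(q <- comult p.1) x q.1 * y q.2 * z p.2.
Proof.
transitivity (pt_mul x (pt_mul y z) a).
  rewrite comultE; apply: eq_bigr => p _; rewrite comultE mulr_sumr.
  by apply: eq_bigr.
rewrite pt_mulA comultE; apply: eq_bigr => p _; rewrite comultE mulr_suml.
by apply: eq_bigr.
Qed.

(** Coassociativity is available for triples of points. It is applied to the universal triple in
    [tensor A (tensor A A)], followed by the linear form built from [l], [m] and [n]. *)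
Lemma convolA l m n a : convol (convol l m) n a = convol l (convol m n) a.
Proof.
have H := comult_coassoc a (tens_inl A (tensor A A))
  (alg_comp (tens_inr A (tensor A A)) (tens_inl A A))
  (alg_comp (tens_inr A (tensor A A)) (tens_inr A A)).
pose phi : {scalar tensor A (tensor A A)} :=
  mk_scalar (tens_form_scalar l (mk_scalar (tens_form_scalar m n))).
have phiM b c d : phi (tens_inl A (tensor A A) b *
    (tens_inr A (tensor A A) (tens_inl A A c) *
     tens_inr A (tensor A A) (tens_inr A A d))) = l b * (m c * n d).
  by rewrite -rmorphM !tens_inlr /phi /= /tens_fun big_seq1 /= /tens_fun big_seq1.
have := congr1 phi H; rewrite !linear_sum.
under eq_bigr do rewrite linear_sum.
under [in X in _ = X -> _]eq_bigr do rewrite linear_sum.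
move=> E; rewrite /convol /= /convol_fun.
transitivity (\sum_(p <- comult a) \sum_(q <- comult p.1) l q.1 * (m q.2 * n p.2)).
  apply: eq_bigr => p _; rewrite convolE mulr_suml.
  by apply: eq_bigr => q _; rewrite mulrA.
transitivity (\sum_(p <- comult a) \sum_(q <- comult p.2) l p.1 * (m q.1 * n q.2)).
  symmetry; move: E.
  under eq_bigr do under eq_bigr do rewrite phiM.
  under [in X in _ = X -> _]eq_bigr do under eq_bigr do rewrite -mulrA phiM.
  by [].
by apply: eq_bigr => p _; rewrite convolE mulr_sumr.
Qed.
End AffineGroupTheory.

Lemma In_mem (T : eqType) (x : T) s : List.In x s -> x \in s.
Proof.
by elim: s => //= y s IH [->|/IH]; rewrite inE ?eqxx // => ->; rewrite orbT.
Qed.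

(** * Finite-dimensional subcomodules and their matrix coefficients *)

Section Comodules.
Variables (k : fieldType) (U : affineGroup k).
Local Notation A := (coord_alg U).
Local Notation counit := (counit U).

Lemma comult_counitl a : \sum_(p <- comult a) (counit p.1 : k) *: p.2 = a.
Proof.
rewrite -[RHS]/(alg_id U a) -[in RHS](pt_1mul (alg_id U)) comultE.
by apply: eq_bigr => p _; rewrite pt_oneE -scalerAl mul1r.
Qed.

Lemma comult_counitr a : \sum_(p <- comult a) (counit p.2 : k) *: p.1 = a.
Proof.
rewrite -[RHS]/(alg_id U a) -[in RHS](pt_mul1 (alg_id U)) comultE.
by apply: eq_bigr => p _; rewrite pt_oneE -scalerAr mulr1.
Qed.

Definition counit_form : {scalar A} := mk_scalar (f := counit) (linearP counit).

Lemma convol1l (l : {scalar A}) a : convol counit_form l a = l a.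
Proof.
rewrite -[in RHS](comult_counitl a) linear_sum; apply: eq_bigr => p _.
by rewrite linearZ.
Qed.

(* For a point m, this is translation of functions on U by m on the right. *)
Definition transl (m : {scalar A}) (a : A) : A :=
  \sum_(p <- comult a) m p.2 *: p.1.

Lemma transl_form (l m : {scalar A}) a : l (transl m a) = convol l m a.
Proof.
rewrite /transl linear_sum; apply: eq_bigr => p _.
by rewrite linearZ /= mulrC.
Qed.

Lemma transl_linear m : linear (transl m).
Proof.
move=> c u v; apply/eqP; rewrite -subr_eq0; apply/eqP.
apply: functional_separation0 => l.
by rewrite linearB /= linearP /= !transl_form linearP subrr.
Qed.

Lemma transl_comp m n a : transl m (transl n a) = transl (convol m n) a.
Proof.
apply/eqP; rewrite -subr_eq0; apply/eqP.
apply: functional_separation0 => l.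
by rewrite linearB /= !transl_form -convolA -[X in _ - X]transl_form
  -transl_form transl_form -transl_form subrr.
Qed.

Lemma transl_counit a : transl counit_form a = a.
Proof. exact: comult_counitr. Qed.

Definition subcomodule (V : set A) :=
  lin_closed V /\ forall m v, V v -> V (transl m v).

(** The span of all translates of [X] works: it is stable because translates compose by convolution,
    and finite-dimensional because each translate of [x] is a combination of the first legs of
    [comult x]. *)
Lemma finite_subcomodule (X : seq A) : exists (V : set A) (B : seq A),
  [/\ subcomodule V, V `<=` lspan B & forall x, List.In x X -> V x].
Proof.
pose V : set A := fun v => forall W : set A, lin_closed W ->
  (forall x m, List.In x X -> W (transl m x)) -> W v.
have VL : lin_closed V.
  split=> [W [] //|c u v Vu Vv W WL WX].
  by case: (WL) => _; apply; [apply: Vu | apply: Vv].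
exists V, (flatten [seq [seq p.1 | p <- comult x] | x <- X]); split.
- split=> // m v Vv; apply: (Vv (fun w => V (transl m w))).
    split; first by rewrite (linear_unb0 (transl_linear m)); case: VL.
    by move=> c u w Vu Vw; rewrite transl_linear; case: VL => _; apply.
  by move=> x n Xx W WL WX; rewrite transl_comp; apply: WX.
- move=> v; apply; first exact: lspan_closed.
  move=> x m Xx; rewrite /transl big_seq.
  apply: lin_closed_sum (lspan_closed _) _ => // p xp.
  apply: lin_closedZ (lspan_closed _) _; apply: lspan_mem; apply: mem_In.
  apply/flattenP; exists [seq p.1 | p <- comult x]; last exact: map_f.
  by apply/mapP; exists x => //; apply: In_mem.
- by move=> x Xx W WL WX; rewrite -[x]transl_counit; apply: WX.
Qed.

Section MatrixCoefficients.
Variables (n : nat) (V : set A) (e : 'I_n -> A) (lam : 'I_n -> {scalar A}).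
Hypotheses (Vsub : subcomodule V) (Ve : forall i, V (e i)).
Hypothesis lamV : forall v, V v -> v = \sum_i lam i v *: e i.

Definition coeff_mx : 'M[A]_n :=
  \matrix_(i, j) \sum_(p <- comult (e j)) lam i p.1 *: p.2.

Lemma coeff_mx_form (m : {scalar A}) i j : m (coeff_mx i j) = lam i (transl m (e j)).
Proof.
rewrite transl_form mxE linear_sum; apply: eq_bigr => p _.
by rewrite linearZ.
Qed.

Lemma transl_basis (m : {scalar A}) j : transl m (e j) = \sum_i m (coeff_mx i j) *: e i.
Proof.
rewrite [LHS]lamV; last by apply: (proj2 Vsub).
by apply: eq_bigr => i _; rewrite coeff_mx_form.
Qed.

Lemma convol_coeff_mx (l m : {scalar A}) i j :
  convol l m (coeff_mx i j) = \sum_h l (coeff_mx i h) * m (coeff_mx h j).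
Proof.
rewrite coeff_mx_form -transl_comp transl_basis (linear_unb_sum (transl_linear _)).
rewrite linear_sum; apply: eq_bigr => h _.
by rewrite (linear_unbZ (transl_linear _)) linearZ /= -coeff_mx_form mulrC.
Qed.

(** The counit is applied to [transl_basis]. Consequently an algebra containing the matrix
    coefficients contains [V]. *)
Lemma coeff_mx_basis j : e j = \sum_i (counit (e i) : k) *: coeff_mx i j.
Proof.
apply/eqP; rewrite -subr_eq0; apply/eqP.
apply: functional_separation0 => l; apply/eqP; rewrite linearB subr_eq0 /=.
rewrite -convol1l -transl_form transl_basis !linear_sum; apply/eqP.
by apply: eq_bigr => i _; rewrite !linearZ /= mulrC.
Qed.

Lemma coeff_mx_mul (R : comAlgType k) (x y : {lrmorphism A -> R}) i j :
  pt_mul x y (coeff_mx i j) = \sum_h x (coeff_mx i h) * y (coeff_mx h j).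
Proof.
pose s := [seq (coeff_mx i h, coeff_mx h j) | h <- index_enum 'I_n].
have -> : \sum_h x (coeff_mx i h) * y (coeff_mx h j)
    = \sum_(p <- s) x p.1 * y p.2 by rewrite /s big_map.
rewrite comultE.
have bil := @bilinear_eq k A A {scalar A} {scalar A} (fun l a => l a)
  (fun l a => l a) _ _ _ _ R (fun a b => x a * y b) (comult (coeff_mx i j)) s.
apply: bil => [l|l| | |b|a|l m].
- exact: linearP.
- exact: linearP.
- exact: functional_separation0.
- exact: functional_separation0.
- by move=> c u v; rewrite linearP mulrDl scalerAl.
- by move=> c u v; rewrite linearP mulrDr scalerAr.
- by rewrite -convolE convol_coeff_mx /s big_map.
Qed.
End MatrixCoefficients.
End Comodules.

(** * Hopf subalgebras given by generators, and the quotients they define *)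

Section GeneratedAlgebra.
Variables (k : fieldType) (A : comAlgType k) (X : set A).

Definition gen_alg : {pred A} := fun a =>
  `[< forall S : {pred A}, GRing.subalg_closed S ->
       (forall x, X x -> x \in S) -> a \in S >].

Lemma gen_algP a : reflect (forall S : {pred A}, GRing.subalg_closed S ->
       (forall x, X x -> x \in S) -> a \in S) (a \in gen_alg).
Proof. exact: asboolP. Qed.

Lemma gen_alg_closed : GRing.subalg_closed gen_alg.
Proof.
split.
- by apply/gen_algP => S [].
- move=> c u v /gen_algP Hu /gen_algP Hv; apply/gen_algP => S SA SX.
  by case: (SA) => _ H _; apply: H; [apply: Hu | apply: Hv].
- move=> u v /gen_algP Hu /gen_algP Hv; apply/gen_algP => S SA SX.
  by case: (SA) => _ _ H; apply: H; [apply: Hu | apply: Hv].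
Qed.

Lemma gen_alg_gen x : X x -> x \in gen_alg.
Proof. by move=> Xx; apply/gen_algP => S _; apply. Qed.

Lemma gen_alg_ind (P : A -> Prop) : P 1 ->
  (forall c u v, P u -> P v -> P (c *: u + v)) ->
  (forall u v, P u -> P v -> P (u * v)) ->
  (forall x, X x -> P x) -> forall a, a \in gen_alg -> P a.
Proof.
move=> P1 PD PM PX a /gen_algP H; apply/asboolP.
apply: (H (fun a => `[< P a >])); last by move=> x /PX Px; apply/asboolP.
split; first exact/asboolP.
- by move=> c u v /asboolP Pu /asboolP Pv; apply/asboolP/PD.
- by move=> u v /asboolP Pu /asboolP Pv; apply/asboolP/PM.
Qed.

HB.instance Definition _ := GRing.isSubalgClosed.Build k A gen_alg
  (GRing.subalg_closed_semi gen_alg_closed).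

Record gen_subalg := GenSubalg {
  gen_val :> A; 
  gen_valP : gen_val \in gen_alg
}.
HB.instance Definition _ := [isSub for gen_val].
HB.instance Definition _ := [Choice of gen_subalg by <:].
HB.instance Definition _ := [SubChoice_isSubAlgebra of gen_subalg by <:].
HB.instance Definition _ := [SubNzRing_isSubComNzRing of gen_subalg by <:].

Definition gen_incl : {lrmorphism gen_subalg -> A} :=
  mk_lrmorphism (f := gen_val) (fun c u v => erefl) (erefl, fun u v => erefl).

Lemma gen_incl_inj : injective gen_incl.
Proof. exact: val_inj. Qed.
End GeneratedAlgebra.

Section SubHopf.
Variables (k : fieldType) (U : affineGroup k) (X : set (coord_alg U)).
Local Notation A := (coord_alg U).
Local Notation B := (gen_subalg X).
Local Notation incl := (gen_incl X).

Definition restricted_comult (a : A) (s : seq (B * B)) :=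
  forall (R : comAlgType k) (x y : {lrmorphism A -> R}),
    pt_mul x y a = \sum_(p <- s) x (incl p.1) * y (incl p.2).

Hypothesis comultX : forall x, X x -> exists s, restricted_comult x s.
Hypothesis antipodeX : forall x, X x -> antipode U x \in gen_alg X.

Lemma restricted_comult_ex (b : B) : exists s, restricted_comult (incl b) s.
Proof.
case: b => a /= Ba.
apply: (gen_alg_ind (P := fun a => exists s, restricted_comult a s) _ _ _ comultX Ba).
- exists [:: (1, 1)] => R x y; by rewrite big_seq1 !rmorph1 mulr1.
- move=> c u v [s Hs] [s' Hs'].
  exists ([seq (c *: p.1, p.2) | p <- s] ++ s') => R x y.
  rewrite big_cat big_map linearP /= Hs Hs' scaler_sumr; congr (_ + _).
  by apply: eq_bigr => p _; rewrite /= linearZ /= scalerAl.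
- move=> u v [s Hs] [s' Hs'].
  exists [seq (p.1 * q.1, p.2 * q.2) | p <- s, q <- s'] => R x y.
  rewrite big_allpairs_dep rmorphM /= Hs Hs' mulr_suml; apply: eq_bigr => p _.
  rewrite mulr_sumr; apply: eq_bigr => q _.
  by rewrite mulrACA -!rmorphM.
Qed.

Definition sub_comult (b : B) := projT1 (cid (restricted_comult_ex b)).

Lemma sub_comultE b : restricted_comult (incl b) (sub_comult b).
Proof. by rewrite /sub_comult; case: cid. Qed.

Lemma sub_antipode_in (b : B) : antipode U (incl b) \in gen_alg X.
Proof.
case: b => a /= Ba.
have [H1 HD HM] := gen_alg_closed X.
apply: (gen_alg_ind (P := fun a => antipode U a \in gen_alg X) _ _ _ antipodeX Ba).
- by rewrite rmorph1.
- by move=> c u v Hu Hv; rewrite linearP; apply: HD.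
- by move=> u v Hu Hv; rewrite rmorphM; apply: HM.
Qed.

Definition sub_antipode_fun (b : B) : B := GenSubalg (sub_antipode_in b).

Lemma sub_antipode_linear : linear sub_antipode_fun.
Proof. by move=> c u v; apply: val_inj; rewrite /= linearP. Qed.
Lemma sub_antipode_monoid : monoid_morphism sub_antipode_fun.
Proof.
by split=> [|u v]; apply: val_inj; rewrite /= ?rmorph1 ?rmorphM.
Qed.
Definition sub_antipode := mk_lrmorphism sub_antipode_linear sub_antipode_monoid.

Definition sub_counit : {lrmorphism B -> k^o} := alg_comp (counit U) incl.

Let ev (l : {scalar A}) (b : B) : k := l (incl b).

Let evL l : scalar (ev l).
Proof. by move=> c u v; exact: (linearP l). Qed.

Let ev_sep b : (forall l, ev l b = 0) -> b = 0.
Proof.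
by move=> H; apply: gen_incl_inj; rewrite linear0; apply: functional_separation0.
Qed.

Lemma sub_comult_tens b (l m : {scalar A}) :
  convol l m (incl b) = \sum_(p <- sub_comult b) ev l p.1 * ev m p.2.
Proof.
have := @comult_tens k A A (comult (incl b))
  [seq (incl p.1, incl p.2) | p <- sub_comult b].
rewrite /convol /= /convol_fun => -> => [|R x y]; first by rewrite big_map.
by rewrite -comultE big_map sub_comultE.
Qed.

Lemma sub_comult1 l m :
  \sum_(p <- sub_comult 1) ev l p.1 * ev m p.2 = ev l 1 * ev m 1.
Proof.
have : \sum_(p <- [seq (incl p.1, incl p.2) | p <- sub_comult 1]) l p.1 * m p.2
    = \sum_(p <- [:: (1, 1)]) l p.1 * m p.2.
  apply: comult_tens => R x y.
  by rewrite big_seq1 big_map -sub_comultE !rmorph1 mulr1.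
by rewrite big_seq1 big_map.
Qed.

Lemma sub_comultM l m a b :
  \sum_(p <- sub_comult (a * b)) ev l p.1 * ev m p.2 =
  \sum_(p <- sub_comult a) \sum_(q <- sub_comult b)
    ev l (p.1 * q.1) * ev m (p.2 * q.2).
Proof.
have : \sum_(p <- [seq (incl p.1, incl p.2) | p <- sub_comult (a * b)]) l p.1 * m p.2
    = \sum_(p <- [seq (incl (p.1 * q.1), incl (p.2 * q.2)) |
          p <- sub_comult a, q <- sub_comult b]) l p.1 * m p.2.
  apply: comult_tens => R x y; rewrite big_map -sub_comultE.
  have -> : pt_mul x y (incl (a * b)) = pt_mul x y (incl a) * pt_mul x y (incl b).
    exact: rmorphM.
  rewrite !sub_comultE.
  rewrite big_allpairs_dep mulr_suml; apply: eq_bigr => p _.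
  by rewrite mulr_sumr; apply: eq_bigr => q _ /=; rewrite !rmorphM mulrACA.
by rewrite big_map big_allpairs_dep.
Qed.

Lemma sub_counitl b : \sum_(p <- sub_comult b) (sub_counit p.1 : k) *: p.2 = b.
Proof.
apply: gen_incl_inj; rewrite linear_sum -[RHS]/(alg_id U (incl b)).
rewrite -[in RHS](pt_1mul (alg_id U)) sub_comultE; apply: eq_bigr => p _.
by rewrite linearZ /= pt_oneE -scalerAl mul1r.
Qed.

Lemma sub_counitr b : \sum_(p <- sub_comult b) (sub_counit p.2 : k) *: p.1 = b.
Proof.
apply: gen_incl_inj; rewrite linear_sum -[RHS]/(alg_id U (incl b)).
rewrite -[in RHS](pt_mul1 (alg_id U)) sub_comultE; apply: eq_bigr => p _.
by rewrite linearZ /= pt_oneE -scalerAr mulr1.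
Qed.

Lemma sub_antipodel b :
  \sum_(p <- sub_comult b) sub_antipode p.1 * p.2 = (sub_counit b : k)%:A.
Proof.
apply: gen_incl_inj; rewrite linear_sum linearZ rmorph1 /= -pt_oneE.
by rewrite -(pt_Vmul (alg_id U)) sub_comultE; apply: eq_bigr.
Qed.

Lemma sub_antipoder b :
  \sum_(p <- sub_comult b) p.1 * sub_antipode p.2 = (sub_counit b : k)%:A.
Proof.
apply: gen_incl_inj; rewrite linear_sum linearZ rmorph1 /= -pt_oneE.
by rewrite -(pt_mulV (alg_id U)) sub_comultE; apply: eq_bigr.
Qed.

Definition sub_group : affineGroup k :=
  hopf_group evL ev_sep (mulT := @convol k U) (fun l m b => sub_comult_tens b l m)
    (fun l m n b => convolA l m n (incl b)) sub_comult1 sub_comultM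
    sub_counitl sub_counitr sub_antipodel sub_antipoder.

Lemma sub_group_comap_mul (R : comAlgType k) (x y : points U R) :
  (alg_comp (x * y)%g (incl : {lrmorphism coord_alg sub_group -> A}) : points sub_group R) =
  ((alg_comp x incl : points sub_group R) * (alg_comp y incl : points sub_group R))%g.
Proof. by apply: lrmorphism_eq => b; rewrite [LHS]sub_comultE. Qed.

Definition sub_group_hom : schemeHom U sub_group :=
  SchemeHom (comap := incl : {lrmorphism coord_alg sub_group -> A})
    sub_group_comap_mul.

Lemma sub_group_quotient : quotient_map sub_group_hom.
Proof. exact: gen_incl_inj. Qed.

Lemma sub_group_generates : generates_algebra (A := coord_alg sub_group)
  [set b | X (incl b)].
Proof.
move=> S [S1 SD SM] SX [a Ba].
pose P a := exists Ba : a \in gen_alg X, GenSubalg Ba \in S.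
suff [Ba' Sa] : P a by rewrite (_ : GenSubalg Ba = GenSubalg Ba') //; apply: val_inj.
have [H1 HD HM] := gen_alg_closed X.
apply: (gen_alg_ind (P := P) _ _ _ _ Ba).
- by exists H1; rewrite (_ : GenSubalg H1 = 1) //; apply: val_inj.
- move=> c u v [Bu Su] [Bv Sv]; exists (HD _ _ _ Bu Bv).
  rewrite (_ : GenSubalg _ = c *: GenSubalg Bu + GenSubalg Bv); first exact: SD.
  exact: val_inj.
- move=> u v [Bu Su] [Bv Sv]; exists (HM _ _ Bu Bv).
  rewrite (_ : GenSubalg _ = GenSubalg Bu * GenSubalg Bv); first exact: SM.
  exact: val_inj.
- by move=> x Xx; exists (gen_alg_gen Xx); apply: SX.
Qed.
End SubHopf.

(** Inversion reverses products, so the antipode exchanges the legs of the comultiplication. *)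
Lemma antipode_coeff (k : fieldType) (U : affineGroup k) a (R : comAlgType k)
    (x y : {lrmorphism coord_alg U -> R}) s :
  (forall (R' : comAlgType k) (x' y' : {lrmorphism coord_alg U -> R'}),
     pt_mul x' y' a = \sum_(p <- s) x' p.1 * y' p.2) ->
  pt_mul x y (antipode U a) =
    \sum_(p <- [seq (antipode U p.2, antipode U p.1) | p <- s]) x p.1 * y p.2.
Proof.
move=> H; rewrite -pt_invE.
have -> : pt_inv (pt_mul x y) = pt_mul (pt_inv y) (pt_inv x).
  exact: (invgM (x : points U R) (y : points U R)).
rewrite H big_map; apply: eq_bigr => p _.
by rewrite (pt_invE x) (pt_invE y) mulrC.
Qed.

Lemma antipodeK (k : fieldType) (U : affineGroup k) a :
  antipode U (antipode U a) = a.
Proof.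
have H : pt_inv (antipode U) = alg_id U.
  exact: (invgK (alg_id U : points U (coord_alg U))).
by rewrite -[LHS](pt_invE (antipode U)) H.
Qed.

(** The matrix coefficients of a finite-dimensional subcomodule containing [a], together with their
    antipodes, are finite in number and generate a Hopf subalgebra; [a] is a linear combination of
    coefficients. *)
Lemma algebraic_quotient_containing (k : fieldType) (U : affineGroup k)
    (a : coord_alg U) :
  exists (Q : affineGroup k) (f : schemeHom U Q) (b : coord_alg Q),
    [/\ quotient_map f, algebraic Q & comap f b = a].
Proof.
have [V [B [Vsub VB Va]]] := finite_subcomodule [:: a].
have [|n [e [lam [Ve _ lamV]]]] := @dual_basis k (coord_alg U)
  {scalar coord_alg U} (fun l a => l a) (fun l => linearP l) V B (proj1 Vsub) VB.
  by move=> v _ H; apply: functional_separation0 => l; apply: H.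
pose rho := coeff_mx e lam.
pose X : set (coord_alg U) :=
  fun x => exists i j, x = rho i j \/ x = antipode U (rho i j).
have rhoX i j : rho i j \in gen_alg X by apply: gen_alg_gen; exists i, j; left.
have SrhoX i j : antipode U (rho i j) \in gen_alg X.
  by apply: gen_alg_gen; exists i, j; right.
have rhoE i j : restricted_comult (rho i j)
    [seq (GenSubalg (rhoX i h), GenSubalg (rhoX h j)) | h <- index_enum 'I_n].
  by move=> R x y; rewrite big_map; apply: (coeff_mx_mul Vsub Ve lamV).
have comultX x : X x -> exists s : seq (gen_subalg X * gen_subalg X),
    restricted_comult x s.
  move=> [i [j [->|->]]]; first by eexists; exact: rhoE.
  exists [seq (GenSubalg (SrhoX h j), GenSubalg (SrhoX i h)) | h <- index_enum 'I_n].
  move=> R x' y'.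
  rewrite (@antipode_coeff _ U _ R x' y' [seq (rho i h, rho h j) | h <- index_enum 'I_n]).
    by rewrite !big_map.
  move=> R' x'' y''; rewrite big_map; exact: (coeff_mx_mul Vsub Ve lamV).
have SX x : X x -> antipode U x \in gen_alg X.
  by move=> [i [j [->|->]]] //; rewrite antipodeK.
exists (sub_group comultX SX), (sub_group_hom comultX SX).
have aV : a = \sum_j lam j a *: e j by apply: lamV; apply: Va; left.
have aX : a \in gen_alg X.
  have [H1 HD HM] := gen_alg_closed X.
  rewrite aV rpred_sum // => j _; rewrite rpredZ // (coeff_mx_basis Vsub Ve lamV).
  by rewrite rpred_sum // => i _; rewrite rpredZ.
exists (GenSubalg aX : coord_alg (sub_group comultX SX)); split => //.
  exact: sub_group_quotient.
pose T := ('I_n * 'I_n * bool)%type.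
pose F (t : T) : gen_subalg X :=
  if t.2 then GenSubalg (rhoX t.1.1 t.1.2) else GenSubalg (SrhoX t.1.1 t.1.2).
exists #|{: T}|, (fun h => F (enum_val h)) => S SA SX'.
apply: (@sub_group_generates _ _ X comultX SX S SA) => b [i [j Xb]].
case: Xb => Xb.
  have -> : b = F (i, j, true) by apply: val_inj.
  by apply: SX'; exists (enum_rank (i, j, true)); rewrite // enum_rankK.
have -> : b = F (i, j, false) by apply: val_inj.
by apply: SX'; exists (enum_rank (i, j, false)); rewrite // enum_rankK.
Qed.

(** * Exponential and logarithm in unipotent groups *)

Section CharZeroPolynomials.
Variables (k : fieldType).
Hypothesis char0 : forall n, n.+1%:R != 0 :> k.

Lemma natr_inj_char0 : injective (fun n : nat => n%:R : k).
Proof.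
have aux m n : (m <= n)%N -> m%:R = n%:R :> k -> m = n.
  move=> /subnKC <-; rewrite natrD => /eqP.
  rewrite -subr_eq0 opprD addrA subrr sub0r oppr_eq0.
  by case: (n - m)%N => [|d]; rewrite ?addn0 // (negbTE (char0 d)).
move=> m n; case/orP: (leq_total m n) => mn E; first exact: aux.
by apply/esym/aux.
Qed.

Lemma poly_nat_eq0 (P : {poly k}) (N : nat) : (0 < N)%N ->
  (forall n, P.[(n * N)%:R] = 0) -> P = 0.
Proof.
move=> N0 H; apply/eqP; apply: contraT => P0.
have := @max_poly_roots k P [seq (n * N)%:R | n <- iota 0 (size P)] P0.
rewrite size_map size_iota ltnn; apply.
  by apply/allP => _ /mapP[n _ ->]; apply/rootP.
rewrite map_inj_uniq ?iota_uniq // => m n /natr_inj_char0 /eqP.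
by rewrite eqn_mul2r eqn0Ngt N0 /= => /eqP.
Qed.

Lemma poly_nat_eq (P R : {poly k}) :
  (forall n, P.[n%:R] = R.[n%:R]) -> P = R.
Proof.
move=> H; apply/eqP; rewrite -subr_eq0; apply/eqP.
by apply: (@poly_nat_eq0 _ 1) => // n; rewrite muln1 hornerD hornerN H subrr.
Qed.

Fixpoint bin_poly (i : nat) : {poly k} :=
  if i is i'.+1 then i'.+1%:R^-1 *: (bin_poly i' * ('X - i'%:R%:P)) else 1.

Lemma bin_polyE i n : (bin_poly i).[n%:R] = 'C(n, i)%:R.
Proof.
elim: i => [|i IH] /=; first by rewrite hornerC bin0.
rewrite hornerZ hornerM hornerXsubC IH; apply: (mulfI (char0 i)).
rewrite mulVKf // -natrM mul_bin_left natrM mulrC.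
case: (leqP i n) => [/natrB -> //|ni].
by rewrite bin_small // !mulr0.
Qed.

Lemma bin_polyS_root0 i : (bin_poly i.+1).[0] = 0.
Proof. by have := bin_polyE i.+1 0; rewrite bin0n. Qed.
End CharZeroPolynomials.

Section StrictlyUpperTriangular.
Variables (R : comNzRingType) (m : nat) (X : 'M[R]_m).
Hypothesis Xup : forall i j : 'I_m, (j <= i)%N -> X i j = 0.

Lemma strictly_upper_pow n (i j : 'I_m) : (j < i + n)%N -> (X ^+ n) i j = 0.
Proof.
elim: n i j => [|n IH] i j ij.
  by rewrite addn0 in ij; rewrite expr0 mxE; case: eqP => // ijE; rewrite ijE ltnn in ij.
rewrite exprS mxE big1 // => h _.
case: (leqP h i) => hi; first by rewrite Xup // mul0r.
rewrite IH ?mulr0 //; apply: (leq_trans ij); rewrite addnS -addSn leq_add2r.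
exact: hi.
Qed.

Lemma strictly_upper_nilpotent n : (m <= n)%N -> X ^+ n = 0.
Proof.
move=> mn; apply/matrixP => i j; rewrite strictly_upper_pow ?mxE //.
by apply: leq_trans (ltn_ord j) _; apply: leq_trans mn _; rewrite leq_addl.
Qed.
End StrictlyUpperTriangular.

(** * The exponential of a point derivation *)

Section UnipotentGroup.
Variables (k : fieldType) (Q : affineGroup k) (m : nat) (rho : 'M[coord_alg Q]_m).
Hypothesis char0 : forall n, n.+1%:R != 0 :> k.
Hypothesis rhoE : unitriangular_embedding rho.
Local Notation A := (coord_alg Q).

Let rho1 i : rho i i = 1. Proof. by case: rhoE. Qed.
Let rho0 (i j : 'I_m) : (j < i)%N -> rho i j = 0.
Proof. by case: rhoE => _ H _ _; apply: H. Qed.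

Lemma embedding_mul (R : comAlgType k) (x y : {lrmorphism A -> R}) i j :
  pt_mul x y (rho i j) = \sum_h x (rho i h) * y (rho h j).
Proof.
case: rhoE => _ _ /(_ R x y) H _.
have := congr1 (fun M : 'M[R]_m => M i j) H; rewrite !mxE /= => ->.
by apply: eq_bigr => h _; rewrite !mxE.
Qed.

Lemma embedding_ind (P : A -> Prop) : P 1 ->
  (forall c u v, P u -> P v -> P (c *: u + v)) ->
  (forall u v, P u -> P v -> P (u * v)) ->
  (forall i j, P (rho i j)) -> forall a, P a.
Proof.
move=> P1 PD PM Prho a; apply/asboolP; case: rhoE => _ _ _ H.
apply: (H (fun a => `[< P a >])); last by move=> _ [i [j ->]]; apply/asboolP.
split; first exact/asboolP.
- by move=> c u v /asboolP Pu /asboolP Pv; apply/asboolP/PD.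
- by move=> u v /asboolP Pu /asboolP Pv; apply/asboolP/PM.
Qed.

Lemma embedding_inj (R : comAlgType k) (x y : {lrmorphism A -> R}) :
  (forall i j, x (rho i j) = y (rho i j)) -> x = y.
Proof.
move=> xy; apply: lrmorphism_eq; apply: embedding_ind => //.
- by rewrite !rmorph1.
- by move=> c u v Hu Hv; rewrite !linearP /= Hu Hv.
- by move=> u v Hu Hv; rewrite !rmorphM /= Hu Hv.
Qed.

(** The matrix of the unit point is idempotent, and invertible because it is unitriangular; hence it
    is the identity. *)
Lemma embedding_counit i j : counit Q (rho i j) = (i == j)%:R.
Proof.
pose M := \matrix_(i, j) (counit Q (rho i j) : k).
have MM : M *m M = M.
  apply/matrixP => a b; rewrite !mxE.
  rewrite -[in RHS](pt_1mul (counit Q)) -/(counit Q) embedding_mul.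
  by apply: eq_bigr => h _; rewrite !mxE.
have Mu : M \in unitmx.
  rewrite unitmxE -det_tr det_trig; last first.
    by apply/is_trig_mxP => a b ab; rewrite !mxE rho0 // linear0.
  by rewrite big1 ?unitr1 // => a _; rewrite !mxE rho1 rmorph1.
have /matrixP/(_ i j) : M = 1%:M by rewrite -(mulKmx Mu M) MM mulVmx.
by rewrite !mxE.
Qed.

Section Exponential.
Variables (D : A -> k).
Hypothesis DL : scalar D.
Hypothesis DM : forall a b,
  D (a * b) = (counit Q a : k) * D b + D a * (counit Q b : k).

Let X := map_mx D rho.

Let D1 : D 1 = 0.
Proof.
have := DM 1 1; rewrite mulr1 rmorph1 mul1r mulr1 => /eqP.
by rewrite -subr_eq0 opprD addrA subrr sub0r oppr_eq0 => /eqP.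
Qed.

Let Xup (i j : 'I_m) : (j <= i)%N -> X i j = 0.
Proof.
rewrite leq_eqVlt mxE => /orP[/eqP/val_inj ->|ji]; first by rewrite rho1 D1.
by have := DL (-1) 0 0; rewrite rho0 // scaler0 add0r mulN1r addNr.
Qed.

(** The left-invariant vector field whose value at the unit is [D]. *)
Let delta (a : A) : A := transl (mk_scalar DL) a.

Let delta_linear : linear delta. Proof. exact: transl_linear. Qed.

Lemma comult_elim (B : lmodType k) (beta : A -> A -> B) (s s' : seq (A * A)) :
  (forall b, linear (beta^~ b)) -> (forall a, linear (beta a)) ->
  (forall (R : comAlgType k) (x y : {lrmorphism A -> R}),
     \sum_(p <- s) x p.1 * y p.2 = \sum_(p <- s') x p.1 * y p.2) ->
  \sum_(p <- s) beta p.1 p.2 = \sum_(p <- s') beta p.1 p.2.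
Proof.
move=> bl br H.
exact: (@bilinear_eq k A A {scalar A} {scalar A} (fun l a => l a) (fun l a => l a)
  (fun l => linearP l) (fun l => linearP l) (@functional_separation0 _ _)
  (@functional_separation0 _ _) B beta s s' bl br (comult_tens H)).
Qed.

Lemma delta_mul a b : delta (a * b) = a * delta b + delta a * b.
Proof.
rewrite /delta /transl.
rewrite (comult_elim (beta := fun u v => D v *: u) (s' :=
  [seq (p.1 * q.1, p.2 * q.2) | p <- comult a, q <- comult b])); first last.
- move=> R x y; rewrite -comultE rmorphM /= !comultE big_allpairs_dep mulr_suml.
  apply: eq_bigr => p _; rewrite mulr_sumr; apply: eq_bigr => q _ /=.
  by rewrite !rmorphM mulrACA.
- by move=> u c v w /=; rewrite DL scalerDl scalerA.
- by move=> u c v w /=; rewrite scalerDr !scalerA mulrC.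
rewrite big_allpairs_dep /=.
transitivity ((\sum_(p <- comult a) (counit Q p.2 : k) *: p.1) *
    (\sum_(q <- comult b) D q.2 *: q.1) +
  (\sum_(p <- comult a) D p.2 *: p.1) *
    (\sum_(q <- comult b) (counit Q q.2 : k) *: q.1)); last by rewrite !comult_counitr.
rewrite !big_distrl -big_split /=; apply: eq_bigr => p _.
rewrite !big_distrr -big_split /=; apply: eq_bigr => q _.
rewrite DM scalerDl; congr (_ + _).
  by rewrite -scalerAl -scalerAr scalerA.
by rewrite -scalerAl -scalerAr scalerA.
Qed.

Lemma delta_iter_linear n : linear (iter n delta).
Proof.
elim: n => // n IH c u v; by rewrite !iterS IH delta_linear.
Qed.

Lemma delta_iter_mul n a b : iter n delta (a * b) =
  \sum_(i < n.+1) (iter i delta a * iter (n - i) delta b) *+ 'C(n, i).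
Proof.
pose F i j := iter i delta a * iter j delta b.
have dF i j : delta (F i j) = F i j.+1 + F i.+1 j by rewrite /F delta_mul.
rewrite -[LHS]/(iter n delta (F 0%N 0%N)).
suff -> : iter n delta (F 0%N 0%N) = \sum_(i < n.+1) F i (n - i)%N *+ 'C(n, i) by [].
elim: n => [|n IH]; first by rewrite big_ord_recl big_ord0 addr0.
rewrite iterS IH (linear_unb_sum delta_linear).
under eq_bigr => i _.
  rewrite -scaler_nat (linear_unbZ delta_linear) scaler_nat dF mulrnDl.
  rewrite -subSn; last by rewrite -ltnS.
  over.
rewrite big_split /= [RHS]big_ord_recl bin0 mulr1n.
rewrite [X in X + _]big_ord_recl bin0 mulr1n -addrA; congr (_ + _).
under [RHS]eq_bigr => i _ do rewrite lift0 binS mulrnDr subSS.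
rewrite big_split /=; congr (_ + _).
rewrite [RHS]big_ord_recr /= bin_small // mulr0n addr0.
by apply: eq_bigr => i _; rewrite /bump add1n subSS.
Qed.

Lemma delta_rho n i j :
  iter n delta (rho i j) = \sum_h (X ^+ n) h j *: rho i h.
Proof.
elim: n i j => [|n IH] i j.
  rewrite /= expr0 (bigD1 j) //= big1 ?addr0 ?mxE ?eqxx ?scale1r // => h hj.
  by rewrite mxE (negbTE hj) scale0r.
rewrite iterS IH (linear_unb_sum delta_linear).
under eq_bigr => h _.
  rewrite (linear_unbZ delta_linear).
  rewrite /delta /transl (comult_elim (beta := fun u v => D v *: u) (s' :=
    [seq (rho i l, rho l h) | l <- index_enum 'I_m])); first last.
  + by move=> R x y; rewrite -comultE embedding_mul big_map.
  + by move=> u c v w /=; rewrite DL scalerDl scalerA.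
  + by move=> u c v w /=; rewrite scalerDr !scalerA mulrC.
  rewrite big_map scaler_sumr.
  over.
rewrite exchange_big; apply: eq_bigr => h _ /=.
rewrite exprS mxE scaler_suml; apply: eq_bigr => l _.
by rewrite scalerA mxE mulrC.
Qed.

(** On the entries of [rho], [delta] acts through the strictly upper triangular matrix [X];
    linearity and the Leibniz formula spread this to the algebra generated by the entries. The
    exponential series is therefore finite on each function. *)
Lemma delta_nilpotent a : exists N, iter N delta a = 0.
Proof.
have mono N M b : iter N delta b = 0 -> (N <= M)%N -> iter M delta b = 0.
  move=> H /subnK <-; rewrite iterD H.
  exact: (linear_unb0 (delta_iter_linear _)).
move: a; apply: embedding_ind.
- exists 1%N; have := delta_mul 1 1; rewrite /= mulr1 mul1r mulr1 => /eqP.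
  by rewrite -subr_eq0 opprD addrA subrr sub0r oppr_eq0 => /eqP.
- move=> c u v [N HN] [M HM]; exists (maxn N M); rewrite delta_iter_linear.
  by rewrite !(mono _ (maxn N M) _ HN, mono _ (maxn N M) _ HM)
    ?leq_maxl ?leq_maxr // scaler0 addr0.
- move=> u v [N HN] [M HM]; exists (N + M)%N; rewrite delta_iter_mul.
  apply: big1 => i _; case: (leqP N i) => iN.
    by rewrite (mono _ _ _ HN iN) mul0r mul0rn.
  rewrite (mono _ _ _ HM) ?mulr0 ?mul0rn //.
  by rewrite -addnBAC ?leq_addl // ltnW.
- move=> i j; exists m; rewrite delta_rho big1 // => h _.
  by rewrite (strictly_upper_nilpotent Xup) // mxE scale0r.
Qed.

Definition exp_order a := projT1 (cid (delta_nilpotent a)).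
Definition exp_coeff a n : k := n`!%:R^-1 * (counit Q (iter n delta a) : k).
(** The counit composed with the automorphism exp([delta]), that is, the flow of the vector field
    from the unit at time 1. *)
Definition exp_fun (a : A) : k^o := \sum_(n < exp_order a) exp_coeff a n.

Lemma exp_coeff0 a N n : iter N delta a = 0 -> (N <= n)%N -> exp_coeff a n = 0.
Proof.
move=> H /subnK <-; rewrite /exp_coeff iterD H.
by rewrite (linear_unb0 (delta_iter_linear _)) linear0 mulr0.
Qed.

Lemma exp_funE a N : iter N delta a = 0 -> exp_fun a = \sum_(n < N) exp_coeff a n.
Proof.
rewrite /exp_fun /exp_order; case: cid => M /= HM HN.
rewrite -!(big_mkord xpredT (exp_coeff a)).
wlog MN : M N HM HN / (M <= N)%N => [H|].
  by case/orP: (leq_total M N) => ?; [apply: H | apply/esym/H].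
rewrite [RHS](big_cat_nat (n := M)) //=.
have -> : \sum_(M <= i < N) exp_coeff a i = 0; last by rewrite addr0.
by rewrite big_nat big1 // => n /andP[Mn _]; apply: exp_coeff0 HM Mn.
Qed.

Lemma exp_coeffM a b n : exp_coeff (a * b) n =
  \sum_(i < n.+1) exp_coeff a i * exp_coeff b (n - i).
Proof.
rewrite /exp_coeff delta_iter_mul linear_sum mulr_sumr; apply: eq_bigr => i _.
rewrite linearMn /= rmorphM /= -[_ *+ 'C(_, _)]mulr_natl [LHS]mulrA [RHS]mulrACA; congr (_ * _).
have f0 j : j`!%:R != 0 :> k.
  by have := fact_gt0 j; case: (j`!) => // d _; apply: char0.
apply: (mulfI (f0 n)); rewrite mulVKf //.
have /(congr1 (fun h => h%:R : k)) := bin_fact (ltnSE (ltn_ord i)).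
rewrite !natrM => <-.
by field; rewrite !f0.
Qed.

Lemma exp_fun_linear : linear exp_fun.
Proof.
move=> c u v.
have [N HN] := delta_nilpotent u; have [M HM] := delta_nilpotent v.
have mono K b n : iter K delta b = 0 -> iter (K + n) delta b = 0.
  by move=> H; rewrite addnC iterD H; exact: (linear_unb0 (delta_iter_linear _)).
have Hu := mono _ _ M HN; have := mono _ _ N HM; rewrite addnC => Hv.
have Huv : iter (N + M) delta (c *: u + v) = 0.
  by rewrite delta_iter_linear Hu Hv scaler0 addr0.
rewrite (exp_funE Hu) (exp_funE Hv) (exp_funE Huv) scaler_sumr -big_split.
apply: eq_bigr => n _; rewrite /exp_coeff delta_iter_linear linearP /= mulrDr.
by rewrite mulrCA.
Qed.

(** The coefficients of [u] and [v] form polynomials [P] and [R]. By [exp_coeffM] those of [u * v]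
    form [P * R], and [exp_fun] is evaluation at 1. *)
Lemma exp_fun_monoid : monoid_morphism exp_fun.
Proof.
split=> [|u v].
  have H : iter 1 delta 1 = 0.
    have := delta_mul 1 1; rewrite /= mulr1 mul1r mulr1 => /eqP.
    by rewrite -subr_eq0 opprD addrA subrr sub0r oppr_eq0 => /eqP.
  by rewrite (exp_funE H) big_ord1 /exp_coeff /= fact0 invr1 mul1r rmorph1.
have [N HN] := delta_nilpotent u; have [M HM] := delta_nilpotent v.
pose P := \poly_(n < N) exp_coeff u n; pose R := \poly_(n < M) exp_coeff v n.
have PE n : P`_n = exp_coeff u n.
  by rewrite coef_poly; case: ltnP => // Nn; rewrite (exp_coeff0 HN Nn).
have RE n : R`_n = exp_coeff v n.
  by rewrite coef_poly; case: ltnP => // Nn; rewrite (exp_coeff0 HM Nn).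
have Huv : iter (N + M) delta (u * v) = 0.
  rewrite delta_iter_mul big1 // => i _; case: (leqP N i) => iN.
    rewrite -(subnK iN) iterD HN (linear_unb0 (delta_iter_linear _)).
    by rewrite mul0r mul0rn.
  have iM : (M <= N + M - i)%N by rewrite -addnBAC ?leq_addl // ltnW.
  rewrite -(subnK iM) [iter (_ + M) _ _]iterD HM (linear_unb0 (delta_iter_linear _)).
  by rewrite mulr0 mul0rn.
have -> : exp_fun u = P.[1].
  rewrite (exp_funE HN) (horner_coef_wide _ (size_poly _ _)).
  by apply: eq_bigr => n _; rewrite PE expr1n mulr1.
have -> : exp_fun v = R.[1].
  rewrite (exp_funE HM) (horner_coef_wide _ (size_poly _ _)).
  by apply: eq_bigr => n _; rewrite RE expr1n mulr1.
rewrite [LHS](exp_funE Huv) -[RHS]hornerM.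
rewrite (@horner_coef_wide _ (N + M)); last first.
  apply: leq_trans (size_polyMleq _ _) _; apply: leq_trans (leq_pred _) _.
  by rewrite leq_add ?size_poly.
apply: eq_bigr => n _; rewrite expr1n mulr1 coefM exp_coeffM.
by apply: eq_bigr => i _; rewrite PE RE.
Qed.

Definition exp_point : kpoints Q := mk_lrmorphism exp_fun_linear exp_fun_monoid.

Lemma exp_pointE : is_exp rho D exp_point.
Proof.
apply/matrixP => i j; rewrite mxE /= -/X.
have H : iter m delta (rho i j) = 0.
  rewrite delta_rho big1 // => h _.
  by rewrite (strictly_upper_nilpotent Xup) // mxE scale0r.
rewrite [LHS](exp_funE H) /mx_exp summxE; apply: eq_bigr => n _.
rewrite mxE /exp_coeff; congr (_ * _).
rewrite delta_rho linear_sum (bigD1 i) //= big1 ?addr0 => [|h hi].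
  by rewrite linearZ /= embedding_counit eqxx; exact: mulr1.
by rewrite linearZ /= embedding_counit eq_sym (negbTE hi) scaler0.
Qed.
End Exponential.
End UnipotentGroup.

(** * The logarithm of a point, as a derivative of its powers *)

Section Logarithm.
Variables (k : fieldType) (Q : affineGroup k) (m : nat) (rho : 'M[coord_alg Q]_m).
Hypothesis char0 : forall n, n.+1%:R != 0 :> k.
Hypothesis rhoE : unitriangular_embedding rho.
Variable u : {lrmorphism coord_alg Q -> k^o}.
Local Notation A := (coord_alg Q).

Definition pt_pow n : {lrmorphism A -> k^o} := iter n (pt_mul u) (pt_one Q k^o).

Lemma pt_powD s t : pt_pow (s + t) = pt_mul (pt_pow s) (pt_pow t).
Proof.
elim: s => [|s IH]; first by rewrite add0n pt_1mul.
by rewrite addSn /pt_pow !iterS -/(pt_pow _) IH pt_mulA.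
Qed.

Definition log_nu : 'M[k]_m := map_mx (u : A -> k) rho - 1%:M.

Lemma log_nu_upper (i j : 'I_m) : (j <= i)%N -> log_nu i j = 0.
Proof.
case: rhoE => r1 r0 _ _; rewrite leq_eqVlt !mxE => /orP[/eqP/val_inj ->|ji].
  by rewrite r1 rmorph1 eqxx subrr.
rewrite r0 // linear0 -(inj_eq val_inj) /=; case: eqP => [E|_]; last by rewrite subrr.
by rewrite E ltnn in ji.
Qed.

Lemma pt_pow_rho n :
  map_mx (pt_pow n : A -> k) rho = \sum_(l < m) log_nu ^+ l *+ 'C(n, l).
Proof.
have -> : map_mx (pt_pow n : A -> k) rho = (log_nu + 1) ^+ n.
  elim: n => [|n IH].
    by apply/matrixP => i j; rewrite expr0 !mxE (embedding_counit rhoE).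
  rewrite exprS -IH subrK; apply/matrixP => i j; rewrite !mxE /=.
  by rewrite (embedding_mul rhoE); apply: eq_bigr => h _; rewrite !mxE.
rewrite exprD1n.
transitivity (\sum_(l < n.+1 + m) log_nu ^+ l *+ 'C(n, l)).
  rewrite big_split_ord /= [X in _ + X]big1 ?addr0 // => l _.
  by rewrite bin_small ?mulr0n // ltn_addr.
rewrite addnC big_split_ord /= [X in _ + X]big1 ?addr0 // => l _.
by rewrite (strictly_upper_nilpotent log_nu_upper) ?mul0rn // leq_addr.
Qed.

(** On matrix entries the binomial expansion of (1 + [log_nu])^n stops before [m], and its
    coefficients are polynomial in n; the entries generate the coordinate ring. *)
Lemma pt_pow_poly a : exists P : {poly k}, forall n, P.[n%:R] = pt_pow n a.
Proof.
move: a; apply: (embedding_ind rhoE).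
- by exists 1 => n; rewrite hornerC rmorph1.
- move=> c a b [P HP] [R HR]; exists (c *: P + R) => n.
  by rewrite hornerD hornerZ HP HR linearP.
- by move=> a b [P HP] [R HR]; exists (P * R) => n; rewrite hornerM HP HR rmorphM.
- move=> i j; exists (\sum_(l < m) (log_nu ^+ l) i j *: bin_poly k l) => n.
  rewrite horner_sum -[RHS]/((pt_pow n : A -> k) (rho i j)).
  have -> : (pt_pow n : A -> k) (rho i j) = map_mx (pt_pow n : A -> k) rho i j.
    by rewrite mxE.
  rewrite pt_pow_rho summxE; apply: eq_bigr => l _.
  by rewrite hornerZ (bin_polyE char0) mulmxnE mulr_natr.
Qed.

Definition pow_poly a := projT1 (cid (pt_pow_poly a)).

Lemma pow_polyE a n : (pow_poly a).[n%:R] = pt_pow n a.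
Proof. by rewrite /pow_poly; case: cid. Qed.

Lemma pow_poly_linear c a b : pow_poly (c *: a + b) = c *: pow_poly a + pow_poly b.
Proof.
apply: (poly_nat_eq char0) => n.
by rewrite hornerD hornerZ !pow_polyE linearP.
Qed.

Lemma pow_polyM a b : pow_poly (a * b) = pow_poly a * pow_poly b.
Proof.
by apply: (poly_nat_eq char0) => n; rewrite hornerM !pow_polyE rmorphM.
Qed.

Lemma pow_poly0 a : (pow_poly a).[0] = counit Q a.
Proof. exact: (pow_polyE a 0). Qed.

Lemma pow_poly_rho i j :
  pow_poly (rho i j) = \sum_(l < m) (log_nu ^+ l) i j *: bin_poly k l.
Proof.
apply: (poly_nat_eq char0) => n; rewrite pow_polyE horner_sum.
have -> : pt_pow n (rho i j) = map_mx (pt_pow n : A -> k) rho i j by rewrite mxE.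
rewrite pt_pow_rho summxE; apply: eq_bigr => l _.
by rewrite hornerZ (bin_polyE char0) mulmxnE mulr_natr.
Qed.

(** The derivative of n -> u^n at n = 0. In this form the product rule shows at once that it is a
    point derivation. *)
Definition log_point (a : A) : k := (pow_poly a)^`().[0].

Lemma log_point_lie : lie log_point.
Proof.
split.
  by move=> c a b; rewrite /log_point pow_poly_linear derivD derivZ hornerD hornerZ.
move=> a b; rewrite /log_point pow_polyM derivM hornerD !hornerM !pow_poly0.
by rewrite addrC.
Qed.

(** The coefficient for l > 0 is (-1)^(l-1)/l, so this is the logarithm series of 1 + [log_nu]. It
    is polynomial in the entries of the matrix of [u], which later yields continuity. *)
Lemma log_point_rho i j : log_point (rho i j) =
  \sum_(l < m) (bin_poly k l)^`().[0] * (log_nu ^+ l) i j.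
Proof.
rewrite /log_point pow_poly_rho linear_sum horner_sum.
by apply: eq_bigr => l _; rewrite /= derivZ hornerZ mulrC.
Qed.

Let X := map_mx log_point rho.

(** Differentiate u^(s+t) = u^s u^t in t at t = 0. Natural s and t suffice, as polynomials in
    characteristic zero are determined by their values there. *)
Lemma pow_poly_ode i j : (pow_poly (rho i j))^`() =
  \sum_h X h j *: pow_poly (rho i h).
Proof.
apply: (poly_nat_eq char0) => s.
have sh : pow_poly (rho i j) \Po ('X + s%:R%:P) =
    \sum_h (pow_poly (rho i h)).[s%:R] *: pow_poly (rho h j).
  apply: (poly_nat_eq char0) => t.
  rewrite horner_comp hornerD hornerX hornerC -natrD pow_polyE addnC pt_powD.
  rewrite (embedding_mul rhoE) horner_sum; apply: eq_bigr => h _.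
  by rewrite hornerZ !pow_polyE.
have := congr1 (fun P => P^`().[0]) sh.
rewrite deriv_comp derivD derivX derivC addr0 mulr1 horner_comp.
rewrite hornerD hornerX hornerC add0r => ->.
rewrite linear_sum !horner_sum; apply: eq_bigr => h _.
by rewrite /= derivZ !hornerZ mulrC mxE.
Qed.

Let Xup (i j : 'I_m) : (j <= i)%N -> X i j = 0.
Proof.
move=> ij; rewrite mxE log_point_rho big1 // => -[[|l] lm] _ /=.
  by rewrite derivC hornerC mul0r.
by rewrite (strictly_upper_pow log_nu_upper) ?mulr0 // addnS ltnS (leq_trans ij) ?leq_addr.
Qed.

(** The linear equation [pow_poly_ode], with the identity matrix as initial value, forces the
    coefficients of the exponential series of [X]. *)
Lemma pow_poly_coef n i j :
  (pow_poly (rho i j))`_n = n`!%:R^-1 * (X ^+ n) i j.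
Proof.
elim: n i j => [|n IH] i j.
  rewrite -horner_coef0 pow_poly0 fact0 invr1 mul1r expr0 mxE.
  exact: embedding_counit.
have := congr1 (fun P : {poly k} => P`_n) (pow_poly_ode i j).
rewrite coef_deriv coef_sum => E; apply: (mulIf (char0 n)).
rewrite [LHS]mulr_natr E factS natrM invfM mulrAC [_^-1 * _]mulrC mulfVK //.
rewrite exprSr mxE mulr_sumr; apply: eq_bigr => h _.
by rewrite coefZ IH mulrC mulrA.
Qed.

Lemma log_pointE : is_exp rho log_point (u : kpoints Q).
Proof.
apply/matrixP => i j; rewrite mxE /mx_exp summxE.
have -> : eval_pt (u : kpoints Q) (rho i j) = (pow_poly (rho i j)).[1].
  by rewrite -[1]/(1%:R) pow_polyE /pt_pow /= pt_mul1.
rewrite (@horner_coef_wide _ m).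
  by apply: eq_bigr => n _; rewrite expr1n mulr1 pow_poly_coef mxE.
apply/leq_sizeP => n mn.
by rewrite pow_poly_coef (strictly_upper_nilpotent Xup) // mxE mulr0.
Qed.
End Logarithm.

Section LieAlgebra.
Variables (k : fieldType) (Q : affineGroup k) (m : nat) (rho : 'M[coord_alg Q]_m).
Hypothesis char0 : forall n, n.+1%:R != 0 :> k.
Hypothesis rhoE : unitriangular_embedding rho.
Local Notation A := (coord_alg Q).

Lemma lie_closed : lin_closed (@lie k Q : set (A -> k^o)).
Proof.
split=> [|c D D' [DL DM] [DL' DM']].
  split=> [c a b|a b].
    by have E : 0 = c * 0 + 0 :> k by rewrite mulr0 addr0.
  have E x y : 0 = x * 0 + 0 * y :> k by rewrite mulr0 mul0r addr0.
  exact: E.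
have DE x : (c *: D + D') x = c * D x + D' x :> k by [].
split=> [d a b|a b]; rewrite !DE; first by rewrite DL DL'; ring.
by rewrite DM DM'; ring.
Qed.

Definition rho_entries : seq A := [seq rho p.1 p.2 | p <- index_enum ('I_m * 'I_m)%type].

Let ev (a : A) (D : A -> k^o) : k := D a.
Let evL a : scalar (ev a). Proof. by move=> c D D'. Qed.

(** A point derivation that kills the entries of [rho] is zero, so finitely many entries separate
    the Lie algebra and some of them are coordinates on it. *)
Lemma lie_dual_basis : exists (r : nat) (b : 'I_r -> A -> k) (t : 'I_r -> A),
  [/\ forall i, lie (b i), forall i, exists h l, t i = rho h l,
      forall i j, b i (t j) = (i == j)%:R &
      forall D, lie D -> D = lie_comb b (\row_i D (t i))].
Proof.
have [|r [b [t [bL tE bt Db]]]] :=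
    @dual_basis_points k (A -> k^o) A ev evL (@lie k Q) rho_entries lie_closed.
  move=> D [DL DM] DE; apply/funext => a.
  have D1 : D 1 = 0.
    have := DM 1 1; rewrite mulr1 rmorph1 mul1r mulr1 => /eqP.
    by rewrite -subr_eq0 opprD addrA subrr sub0r oppr_eq0 => /eqP.
  move: a; apply: (embedding_ind rhoE) => //.
  - by move=> c a b; rewrite DL => -> ->; rewrite mulr0 addr0.
  - by move=> a b; rewrite DM => -> ->; rewrite mulr0 mul0r addr0.
  - move=> i j; apply: DE; apply: mem_In; apply/mapP; exists (i, j) => //.
    exact: mem_index_enum.
exists r, b, t; split => //.
  by move=> i; have /In_mem/mapP[[h l] _ ->] := tE i; exists h, l.
move=> D /Db {1}->; apply/funext => a; rewrite fct_sumE.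
by apply: eq_bigr => i _; rewrite mxE.
Qed.

(** [unipotent_open] admits any basis of the Lie algebra. The matrix [K] changes basis, so the
    coordinates remain linear in values at matrix entries. *)
Lemma lie_basis_coordinates r (b : 'I_r -> A -> k) : lie_basis b ->
  exists (n : nat) (t : 'I_n -> A) (K : 'M[k]_(n, r)),
    (forall i, exists h l, t i = rho h l) /\
    forall D, lie D -> D = lie_comb b ((\row_i D (t i)) *m K).
Proof.
move=> [bL bB]; have [n [e [t [eL tE et De]]]] := lie_dual_basis.
have ex i : exists c : 'rV[k]_r, e i = lie_comb b c.
  by have [c [ce _]] := bB _ (eL i); exists c.
have [c ce] := choice ex.
exists n, t, (\matrix_(i, j) c i 0 j); split=> // D /De {1}->.
apply/funext => a; rewrite /lie_comb.
under eq_bigr => i _ do rewrite ce /lie_comb mulr_sumr.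
rewrite exchange_big; apply: eq_bigr => j _ /=.
rewrite !mxE mulr_suml; apply: eq_bigr => i _.
by rewrite !mxE mulrA.
Qed.

Lemma lie_basis_ex : exists (r : nat) (b : 'I_r -> A -> k), lie_basis b.
Proof.
have [r [b [t [bL _ bt Db]]]] := lie_dual_basis; exists r, b; split=> // D LD.
exists (\row_i D (t i)); split; first exact: Db.
move=> c Dc; apply/rowP => i; rewrite mxE Dc /lie_comb (bigD1 i) //= bt eqxx mulr1.
by rewrite big1 ?addr0 // => j ji; rewrite bt (negbTE ji) mulr0.
Qed.
End LieAlgebra.

(** * The topology on points *)

Section FieldLimits.
Variables (k : topologicalFieldType) (T : Type) (F : set_system T).
Context {FF : Filter F}.
Implicit Types (f g : T -> k) (a b : k).

Lemma cvg_fieldD f g a b :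
  f @ F --> a -> g @ F --> b -> (fun x => f x + g x) @ F --> a + b.
Proof. by move=> fa gb; apply: continuous2_cvg => //; apply: (add_continuous (a, b)). Qed.

Lemma cvg_fieldM f g a b :
  f @ F --> a -> g @ F --> b -> (fun x => f x * g x) @ F --> a * b.
Proof. by move=> fa gb; apply: continuous2_cvg => //; apply: (fmul_continuous (a, b)). Qed.

Lemma cvg_field_sum (I : Type) (r : seq I) (f : I -> T -> k) (a : I -> k) :
  (forall i, f i @ F --> a i) ->
  (fun x => \sum_(i <- r) f i x) @ F --> \sum_(i <- r) a i.
Proof.
move=> fa; elim: r => [|i r IH].
  rewrite big_nil; under eq_fun do rewrite big_nil; exact: cvg_cst.
rewrite big_cons; under eq_fun do rewrite big_cons.
exact: cvg_fieldD.
Qed.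
End FieldLimits.

Section ContinuousFunctions.
Variables (k : topologicalFieldType) (T : topologicalType).
Implicit Types f g : T -> k.

Lemma continuous_ext_const (a : k) f : (forall x, f x = a) -> continuous f.
Proof. by move=> fa x; rewrite (_ : f = fun=> a); [exact: cvg_cst | exact/funext]. Qed.

Lemma eq_continuous_field f g : f =1 g -> continuous g -> continuous f.
Proof. by move=> /funext ->. Qed.

Lemma continuous_fieldD f g : continuous f -> continuous g ->
  continuous (fun x => f x + g x).
Proof. by move=> fc gc x; apply: cvg_fieldD; [apply: fc | apply: gc]. Qed.

Lemma continuous_fieldM f g : continuous f -> continuous g ->
  continuous (fun x => f x * g x).
Proof. by move=> fc gc x; apply: cvg_fieldM; [apply: fc | apply: gc]. Qed.

Lemma continuous_field_sum (I : Type) (r : seq I) (f : I -> T -> k) :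
  (forall i, continuous (f i)) -> continuous (fun x => \sum_(i <- r) f i x).
Proof. by move=> fc x; apply: cvg_field_sum => i; apply: fc. Qed.

Lemma continuous_mx_pow m (M : T -> 'M[k]_m) n :
  (forall i j, continuous (fun x => M x i j)) ->
  forall i j, continuous (fun x => (M x ^+ n) i j).
Proof.
move=> Mc; elim: n => [|n IH] i j.
  under eq_fun do rewrite expr0 mxE; move=> x; exact: cvg_cst.
under eq_fun do rewrite exprS mxE.
by apply: continuous_field_sum => h; apply: continuous_fieldM.
Qed.

Lemma continuous_to_row r (c : T -> 'rV[k]_r) :
  (forall i, continuous (fun x => c x 0 i)) -> continuous c.
Proof.
move=> cc x A [P cP PA].
have H : \forall y \near x, forall i, P 0 i (c y 0 i).
  by apply: filter_forall => i; apply: cc; apply: cP.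
by apply: filterS H => y Py; apply: PA => i j; rewrite ord1; apply: Py.
Qed.
End ContinuousFunctions.

Lemma continuous_row_coord (k : topologicalFieldType) r (i : 'I_r) :
  continuous (fun c : 'rV[k]_r => c 0 i).
Proof.
move=> c A cA; exists (fun a b => if b == i then A else setT).
  by move=> a b; rewrite ord1; case: eqP => [->|_] //; apply: filterT.
by move=> d /(_ 0 i); rewrite eqxx.
Qed.

Section EvaluationTopology.
Variables (k : topologicalFieldType).
Hypothesis char0 : forall n, n.+1%:R != 0 :> k.

Lemma is_exp_inj (Q : affineGroup k) m (rho : 'M[coord_alg Q]_m) D
    (u v : kpoints Q) : unitriangular_embedding rho ->
  is_exp rho D u -> is_exp rho D v -> u = v.
Proof.
move=> rhoE Hu Hv; apply: (embedding_inj rhoE) => i j.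
have /matrixP/(_ i j) : map_mx (eval_pt u : coord_alg Q -> k) rho =
  map_mx (eval_pt v : coord_alg Q -> k) rho by rewrite Hu Hv.
by rewrite !mxE.
Qed.

(** In exponential coordinates the entries of [rho] are given by finite exponential series, hence
    are continuous; sums and products then reach every regular function. *)
Lemma unipotent_eval_open (Q : affineGroup k) (a : coord_alg Q) (O : set k) :
  unipotent Q -> open O -> unipotent_open [set u : kpoints Q | O (eval_pt u a)].
Proof.
move=> [_ [m [rho rhoE]]] oO; have [r [b bB]] := lie_basis_ex rhoE.
exists m, rho, r, b; split=> //.
have bL c : lie (lie_comb b c).
  have -> : lie_comb b c = \sum_i c 0 i *: (b i : coord_alg Q -> k^o).
    by apply/funext => x; rewrite fct_sumE.
  apply: lin_closed_sum (lie_closed Q) _ => i _.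
  by apply: lin_closedZ (lie_closed Q) _; case: bB.
pose E c : kpoints Q := exp_point char0 rhoE (proj1 (bL c)) (proj2 (bL c)).
have EE c : is_exp rho (lie_comb b c) (E c) by exact: exp_pointE.
have Ec : continuous (fun c => eval_pt (E c) a : k).
  move: a; apply: (embedding_ind rhoE).
  - by apply: (@continuous_ext_const _ _ 1) => c; rewrite rmorph1.
  - move=> x u v Hu Hv.
    rewrite (_ : (fun c => _) = fun c => x * eval_pt (E c) u + eval_pt (E c) v); last first.
      by apply/funext => c; rewrite linearP.
    apply: continuous_fieldD => //; apply: continuous_fieldM => //.
    exact: (@continuous_ext_const _ _ x).
  - move=> u v Hu Hv.
    rewrite (_ : (fun c => _) = fun c => eval_pt (E c) u * eval_pt (E c) v).
      exact: continuous_fieldM.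
    by apply/funext => c; rewrite rmorphM.
  - move=> i j.
    have Eij c : eval_pt (E c) (rho i j) =
        \sum_(n < m) n`!%:R^-1 * ((map_mx (lie_comb b c) rho) ^+ n) i j.
      have /matrixP/(_ i j) := EE c; rewrite mxE => ->.
      by rewrite /mx_exp summxE; apply: eq_bigr => n _; rewrite mxE.
    under eq_fun do rewrite Eij; apply: continuous_field_sum => n.
    apply: continuous_fieldM; first by apply: continuous_ext_const.
    apply: continuous_mx_pow => h l.
    under eq_fun do rewrite mxE /lie_comb; apply: continuous_field_sum => s.
    apply: continuous_fieldM; first exact: continuous_row_coord.
    by apply: continuous_ext_const.
rewrite (_ : [set c | _] = (fun c => eval_pt (E c) a : k) @^-1` O).
  by apply: open_comp => // c _; apply: Ec.
apply/seteqP; split=> c /=; last by move=> Oc; exists (E c).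
by move=> [u uE Ou]; move: Ou; rewrite -(is_exp_inj rhoE (EE c) uE).
Qed.

(** The function [a] comes from an algebraic quotient, which is unipotent, so its preimages of open
    sets lie in the subbase. *)
Lemma continuous_eval (G : topologicalType) (U : affineGroup k)
    (h : G -> top_kpoints U) (a : coord_alg U) : prounipotent U ->
  continuous h -> continuous (fun x => eval_pt (h x : kpoints U) a : k).
Proof.
move=> Uu hc; have [Q [f [b [fq Qa ba]]]] := algebraic_quotient_containing a.
apply/continuousP => O oO.
pose W : set (top_kpoints U) :=
  [set u | O (eval_pt (on_points f (u : kpoints U) : kpoints Q) b)].
have oW : open W.
  have sb : kpoints_subbase W.
    exists Q, f, [set u : kpoints Q | O (eval_pt u b)]; split => //.
      exact: Uu fq Qa.
    by apply: unipotent_eval_open oO; apply: Uu fq Qa.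
  exists [set W]; last by rewrite predeqE => ?; split=> [[_ ->]|] //; exists W.
  move=> _ ->; exists [fset W]%fset.
    by move=> Z; rewrite inE => /eqP ->; apply/mem_set; exact: sb.
  rewrite predeqE => z; split=> [H|Wz i]; first exact: (H W (fset11 W)).
  by rewrite /= inE => /eqP ->.
have /continuousP/(_ _ oW) := hc.
by rewrite -ba.
Qed.

(** Converse to [continuous_eval]: by [log_point_rho], the exponential coordinates of a point of a
    unipotent quotient are polynomial in its matrix entries, and these are regular functions. *)
Lemma eval_continuous (G : topologicalType) (U : affineGroup k)
    (h : G -> top_kpoints U) :
  (forall a, continuous (fun x => eval_pt (h x : kpoints U) a : k)) ->
  continuous h.
Proof.
move=> hc x A /=; rewrite (@nbhsE (top_kpoints U)).
move=> [_ [[B sB <-] [C BC Ct] sUBA]].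
rewrite nbhs_filterE; apply: filterS sUBA _.
apply: (@filterS _ _ _ (h @^-1` C)); first by move=> ? ?; exists C.
have /sB [D sD IDeC] := BC; rewrite -IDeC.
rewrite preimage_bigcap; apply: filter_bigI => E DE.
have : E (h x) by move: Ct; rewrite -IDeC => /(_ _ DE).
have /set_mem [Q [f [V [fq Qu [m [rho [r [b [rhoE bB oV]]]]] EV]]]] := sD _ DE.
subst E => /= Vx; clear DE.
have [n [t [K [tE De]]]] := lie_basis_coordinates rhoE bB.
pose u y : kpoints Q := on_points f (h y : kpoints U).
pose D' y := log_point char0 rhoE (u y).
pose c y := (\row_i D' y (t i)) *m K.
have uE y : is_exp rho (lie_comb b (c y)) (u y).
  by rewrite -De; [exact: log_pointE | exact: log_point_lie].
have cc : continuous c.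
  apply: continuous_to_row => j; under eq_fun do rewrite mxE.
  apply: continuous_field_sum => i; apply: continuous_fieldM; last first.
    by apply: continuous_ext_const.
  under eq_fun do rewrite mxE; have [h1 [l1 ->]] := tE i.
  apply: eq_continuous_field => [y|]; first exact: log_point_rho.
  apply: continuous_field_sum => l.
  apply: continuous_fieldM; first by apply: continuous_ext_const.
  apply: continuous_mx_pow => i' j'.
  apply: eq_continuous_field => [y|]; first by rewrite !mxE.
  apply: continuous_fieldD; last by apply: continuous_ext_const.
  exact: hc.
have O y : V (u y) <-> [set c0 | exists2 u0, is_exp rho (lie_comb b c0) u0 & V u0] (c y).
  split=> [Vy|[u0 u0E Vu0]]; first by exists (u y).
  by move: Vu0; rewrite -(is_exp_inj rhoE (uE y) u0E).
apply: (@filterS _ _ _ (c @^-1` [set c0 | exists2 u0, is_exp rho (lie_comb b c0) u0 & V u0])).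
  by move=> y /O.
by apply: cc; apply: open_nbhs_nbhs; split=> //; apply/O.
Qed.
End EvaluationTopology.

(** * Polynomial functions on groups *)

Section PolynomialFunctions.
Variables (G : groupType) (k : fieldType).
Implicit Types (phi psi : G -> k) (N : set G).

Definition ldiff (g : G) phi : G -> k := fun x => phi (g * x)%g - phi x.

(* [polyf N d phi]: the restriction of [phi] to [N] is killed by the d-th power
   of the augmentation ideal of the group ring, i.e. is polynomial of degree < d. *)
Fixpoint polyf N (d : nat) phi : Prop :=
  if d is d'.+1 then forall g, N g -> polyf N d' (ldiff g phi)
  else forall x, N x -> phi x = 0.

Section Subgroup.
Variables (N : set G) (subN : is_subgroup N).

Lemma subgroup1 : N 1%g. Proof. by case: subN. Qed.
Lemma subgroupV x : N x -> N (x^-1)%g.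
Proof. by case: subN => N1 H Nx; rewrite -[_^-1%g]mul1g; apply: H. Qed.
Lemma subgroupM x y : N x -> N y -> N (x * y)%g.
Proof.
by case: (subN) => N1 H Nx Ny; rewrite -[y]invgK; apply: H => //; apply: subgroupV.
Qed.
Lemma subgroupX x n : N x -> N (x ^+ n)%g.
Proof.
move=> Nx; elim: n => [|n IH]; first by rewrite expg0; exact: subgroup1.
by rewrite expgS; apply: subgroupM.
Qed.

Lemma polyf_ext d phi psi : (forall x, N x -> phi x = psi x) ->
  polyf N d phi -> polyf N d psi.
Proof.
elim: d phi psi => [|d IH] phi psi E /= H; first by move=> x Nx; rewrite -E ?H.
move=> g Ng; apply: IH (H g Ng) => x Nx; rewrite /ldiff !E //.
exact: subgroupM.
Qed.

Lemma polyf_zero d : polyf N d (fun=> 0).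
Proof.
elim: d => //= d IH g Ng; apply: polyf_ext IH => x _.
by rewrite /ldiff subrr.
Qed.

Lemma polyfS d phi : polyf N d phi -> polyf N d.+1 phi.
Proof.
elim: d phi => [|d IH] phi /= H g Ng.
  by move=> x Nx; rewrite /ldiff !H ?subrr //; apply: subgroupM.
by apply: IH; apply: H.
Qed.

Lemma polyfW d e phi : (d <= e)%N -> polyf N d phi -> polyf N e phi.
Proof.
move=> /subnK <-; elim: (e - d)%N => //= n IH H.
by apply: polyfS; apply: IH.
Qed.

Lemma polyf_lin d (a : k) phi psi : polyf N d phi -> polyf N d psi ->
  polyf N d (fun x => a * phi x + psi x).
Proof.
elim: d phi psi => [|d IH] phi psi /= Hp Hq.
  by move=> x Nx; rewrite Hp // Hq // mulr0 addr0.
move=> g Ng; apply: polyf_ext (IH _ _ (Hp g Ng) (Hq g Ng)) => x _.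
by rewrite /ldiff; ring.
Qed.

Lemma polyf_add d phi psi : polyf N d phi -> polyf N d psi ->
  polyf N d (fun x => phi x + psi x).
Proof.
by move=> Hp Hq; apply: polyf_ext (polyf_lin 1 Hp Hq) => x _; rewrite mul1r.
Qed.

Lemma polyf_scale d (a : k) phi : polyf N d phi -> polyf N d (fun x => a * phi x).
Proof.
move=> Hp; apply: polyf_ext (polyf_lin a Hp (polyf_zero d)) => x _.
by rewrite addr0.
Qed.

Lemma polyf_sub d phi psi : polyf N d phi -> polyf N d psi ->
  polyf N d (fun x => phi x - psi x).
Proof.
move=> Hp Hq; apply: polyf_ext (polyf_lin (-1) Hq Hp) => x _.
by rewrite mulN1r addrC.
Qed.

Lemma polyf_sum d (I : Type) (r : seq I) (P : pred I) (F : I -> G -> k) :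
  (forall i, P i -> polyf N d (F i)) ->
  polyf N d (fun x => \sum_(i <- r | P i) F i x).
Proof.
move=> H; elim: r => [|i r IH].
  by apply: polyf_ext (polyf_zero d) => x _; rewrite big_nil.
case Pi: (P i); last first.
  by apply: polyf_ext IH => x _; rewrite big_cons Pi.
by apply: polyf_ext (polyf_add (H i Pi) IH) => x _; rewrite big_cons Pi.
Qed.

Lemma polyf_const (a : k) : polyf N 1 (fun=> a).
Proof. by move=> g Ng x Nx; rewrite /ldiff subrr. Qed.

Lemma polyf_ltransl d h phi : N h -> polyf N d phi -> polyf N d (fun x => phi (h * x)%g).
Proof.
move=> Nh Hp; case: d Hp => [|d] Hp.
  by move=> x Nx; apply: Hp; apply: subgroupM.
apply: polyf_ext (polyf_add Hp (polyfS (Hp h Nh))) => x _.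
by rewrite /ldiff addrC subrK.
Qed.

Lemma polyf_rtransl d h phi : N h -> polyf N d phi -> polyf N d (fun x => phi (x * h)%g).
Proof.
move=> Nh; elim: d phi => [|d IH] phi Hp.
  by move=> x Nx; apply: Hp; apply: subgroupM.
move=> g Ng; apply: polyf_ext (IH _ (Hp g Ng)) => x _.
by rewrite /ldiff mulgA.
Qed.

(** Induction on the total degree by the twisted Leibniz rule: the difference of the product is
    [ldiff g phi] times [psi] plus a left translate of [phi] times [ldiff g psi]. *)
Lemma polyf_mul d e phi psi : polyf N d phi -> polyf N e psi ->
  polyf N (d + e) (fun x => phi x * psi x).
Proof.
move: {2}(d + e)%N (leqnn (d + e)) => n; elim: n d e phi psi => [|n IH] d e phi psi.
  rewrite leqn0 addn_eq0 => /andP[/eqP -> /eqP ->] H _ x Nx.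
  by rewrite H // mul0r.
move=> de Hp Hq; case: d => [|d] in de Hp *.
  by apply: polyf_ext (polyf_zero _) => x Nx; rewrite Hp // mul0r.
case: e => [|e] in de Hq *.
  by apply: polyf_ext (polyf_zero _) => x Nx; rewrite Hq // mulr0.
rewrite addSn => g Ng.
have H1 : polyf N (d + e.+1) (fun x => ldiff g phi x * psi x).
  by apply: IH => //; apply: Hp.
have H2 : polyf N (d + e.+1) (fun x => phi (g * x)%g * ldiff g psi x).
  rewrite addnS -addSn; apply: IH; last by apply: Hq.
    by move: de; rewrite addnS.
  exact: polyf_ltransl.
apply: polyf_ext (polyf_add H1 H2) => x _.
by rewrite /ldiff; ring.
Qed.

Definition rdiff (h : G) phi : G -> k := fun x => phi (x * h)%g - phi x.

(** Right differences commute with left ones, so the case [d = 0] decides; there [x * h] is the left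
    translate of [x] by [x * h * x^-1]. *)
Lemma polyf_rdiff d h phi : N h -> polyf N d.+1 phi -> polyf N d (rdiff h phi).
Proof.
move=> Nh; elim: d phi => [|d IH] phi Hp.
  move=> x Nx; rewrite /rdiff.
  have Nxh : N (x * h * x^-1)%g.
    by apply: subgroupM (subgroupV Nx); apply: subgroupM.
  by have := Hp _ Nxh x Nx; rewrite /ldiff mulgVK.
move=> g Ng; apply: polyf_ext (IH _ (Hp g Ng)) => x _.
by rewrite /ldiff /rdiff !mulgA; ring.
Qed.

Lemma polyf_inv d phi : polyf N d phi -> polyf N d (fun x => phi (x^-1)%g).
Proof.
elim: d phi => [|d IH] phi Hp.
  by move=> x Nx; apply: Hp; apply: subgroupV.
move=> g Ng; have Ngi := subgroupV Ng.
apply: polyf_ext (IH _ (polyf_rdiff Ngi Hp)) => x _.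
by rewrite /ldiff /rdiff invgM.
Qed.
End Subgroup.

Lemma polyf_sub_group N N' d phi : N `<=` N' -> polyf N' d phi -> polyf N d phi.
Proof.
move=> NN'; elim: d phi => [|d IH] phi H.
  by move=> x Nx; apply: H; apply: NN'.
by move=> g Ng; apply: IH; apply: H; apply: NN'.
Qed.
End PolynomialFunctions.

Lemma continuous_lmul (G : topologicalGroupType) (g : G) :
  continuous (fun x : G => (g * x)%g).
Proof.
move=> x; apply: (@continuous_comp _ (G * G)%type G (fun x : G => (g, x))
  (fun z => (z.1 * z.2)%g)); last exact: gmul_continuous.
by apply: cvg_pair => /=; [exact: cvg_cst | exact: cvg_id].
Qed.

Lemma continuous_rmul (G : topologicalGroupType) (g : G) :
  continuous (fun x : G => (x * g)%g).
Proof.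
move=> x; apply: (@continuous_comp _ (G * G)%type G (fun x : G => (x, g))
  (fun z => (z.1 * z.2)%g)); last exact: gmul_continuous.
by apply: cvg_pair => /=; [exact: cvg_id | exact: cvg_cst].
Qed.

Lemma is_subgroup_setT (G : groupType) : is_subgroup [set: G].
Proof. by []. Qed.

(** * The algebra of continuous polynomial functions *)

Section PolynomialAlgebra.
Variables (G : topologicalGroupType) (k : topologicalFieldType).

Record polyalg := Polyalg {
  poly_fun :> G -> k;
  poly_funP : (exists d, polyf setT d poly_fun) /\ continuous poly_fun
}.

Lemma polyalg_inj (f g : polyalg) : (forall x, f x = g x) -> f = g.
Proof.
case: f g => [f Pf] [g Pg] /= /funext fg; move: Pf; rewrite fg => Pf.
by rewrite (Prop_irrelevance Pf Pg).
Qed.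

Let subT := is_subgroup_setT G.

HB.instance Definition _ := gen_eqMixin polyalg.
HB.instance Definition _ := gen_choiceMixin polyalg.

Lemma polyalg_constP (a : k) :
  (exists d, polyf [set: G] d (fun=> a)) /\ continuous (fun _ : G => a).
Proof.
by split; [exists 1%N; apply: polyf_const | move=> x; exact: cvg_cst].
Qed.
Definition polyalg_const a := Polyalg (polyalg_constP a).

Lemma polyalg_addP (f g : polyalg) : (exists d, polyf setT d (fun x => f x + g x)) /\
  continuous (fun x => f x + g x).
Proof.
case: f g => [f [[d fd] fc]] [g [[e ge] gc]] /=; split; last exact: continuous_fieldD.
exists (maxn d e); apply: polyf_add => //.
  by apply: polyfW fd; rewrite ?leq_maxl.
by apply: polyfW ge; rewrite ?leq_maxr.
Qed.
Definition polyalg_add f g := Polyalg (polyalg_addP f g).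

Lemma polyalg_mulP (f g : polyalg) : (exists d, polyf setT d (fun x => f x * g x)) /\
  continuous (fun x => f x * g x).
Proof.
case: f g => [f [[d fd] fc]] [g [[e ge] gc]] /=; split; last exact: continuous_fieldM.
by exists (d + e)%N; apply: polyf_mul.
Qed.
Definition polyalg_mul f g := Polyalg (polyalg_mulP f g).
Definition polyalg_scale a f := polyalg_mul (polyalg_const a) f.
Definition polyalg_opp f := polyalg_scale (-1) f.

Let addA : associative polyalg_add.
Proof. by move=> f g h; apply: polyalg_inj => x; apply: addrA. Qed.
Let addC : commutative polyalg_add.
Proof. by move=> f g; apply: polyalg_inj => x; apply: addrC. Qed.
Let add0 : left_id (polyalg_const 0) polyalg_add.
Proof. by move=> f; apply: polyalg_inj => x; apply: add0r. Qed.
Let addN : left_inverse (polyalg_const 0) polyalg_opp polyalg_add.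
Proof. by move=> f; apply: polyalg_inj => x; rewrite /= mulN1r addNr. Qed.
HB.instance Definition _ := GRing.isZmodule.Build polyalg addA addC add0 addN.

Let mulA : associative polyalg_mul.
Proof. by move=> f g h; apply: polyalg_inj => x; apply: mulrA. Qed.
Let mulC : commutative polyalg_mul.
Proof. by move=> f g; apply: polyalg_inj => x; apply: mulrC. Qed.
Let mul1 : left_id (polyalg_const 1) polyalg_mul.
Proof. by move=> f; apply: polyalg_inj => x; apply: mul1r. Qed.
Let mulDl : left_distributive polyalg_mul +%R.
Proof. by move=> f g h; apply: polyalg_inj => x; apply: mulrDl. Qed.
Let one0 : polyalg_const 1 != 0.
Proof.
apply/eqP => /(congr1 (fun f : polyalg => f 1%g)) /= /eqP.
by rewrite (negbTE (oner_neq0 _)).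
Qed.
HB.instance Definition _ := GRing.Zmodule_isComNzRing.Build polyalg mulA mulC mul1 mulDl one0.

Let scaleA a b (f : polyalg) : polyalg_scale a (polyalg_scale b f) = polyalg_scale (a * b) f.
Proof. by apply: polyalg_inj => x; apply: mulrA. Qed.
Let scale1 : left_id 1 polyalg_scale.
Proof. by move=> f; apply: polyalg_inj => x; apply: mul1r. Qed.
Let scaleDr : right_distributive polyalg_scale +%R.
Proof. by move=> a f g; apply: polyalg_inj => x; apply: mulrDr. Qed.
Let scaleDl f : {morph polyalg_scale^~ f : a b / a + b}.
Proof. by move=> a b; apply: polyalg_inj => x; apply: mulrDl. Qed.
HB.instance Definition _ := GRing.Zmodule_isLmodule.Build k polyalg
  scaleA scale1 scaleDr scaleDl.
Let scaleAl (a : k) (f g : polyalg) : a *: (f * g) = (a *: f) * g.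
Proof. by apply: polyalg_inj => x; apply: mulrA. Qed.
HB.instance Definition _ := GRing.Lmodule_isLalgebra.Build k polyalg scaleAl.
HB.instance Definition _ := GRing.Lalgebra_isComAlgebra.Build k polyalg.

Definition poly_ev (g : G) (f : polyalg) : k := f g.

Lemma poly_ev_scalar g : scalar (poly_ev g).
Proof. by []. Qed.

Lemma poly_ev_sep (f : polyalg) : (forall g, poly_ev g f = 0) -> f = 0.
Proof. by move=> H; apply: polyalg_inj. Qed.

Lemma poly_ev_linear g : linear (fun f => poly_ev g f : k^o).
Proof. by []. Qed.
Lemma poly_ev_monoid g : monoid_morphism (fun f => poly_ev g f : k^o).
Proof. by []. Qed.
Definition poly_pt g : {lrmorphism polyalg -> k^o} :=
  mk_lrmorphism (poly_ev_linear g) (poly_ev_monoid g).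

Lemma polyalg_rtranslP (f : polyalg) (h : G) :
  (exists d, polyf setT d (fun x => f (x * h)%g)) /\ continuous (fun x => f (x * h)%g).
Proof.
case: f => f [[d fd] fc] /=; split; first by exists d; apply: polyf_rtransl.
move=> x; apply: (@continuous_comp _ _ _ (fun x : G => (x * h)%g) f) => //.
  exact: continuous_rmul.
exact: fc.
Qed.

Lemma polyalg_ltranslP (f : polyalg) (h : G) :
  (exists d, polyf setT d (fun x => f (h * x)%g)) /\ continuous (fun x => f (h * x)%g).
Proof.
case: f => f [[d fd] fc] /=; split; first by exists d; apply: polyf_ltransl.
move=> x; apply: (@continuous_comp _ _ _ (fun x : G => (h * x)%g) f) => //.
  exact: continuous_lmul.
exact: fc.
Qed.

Lemma polyalg_invP (f : polyalg) :
  (exists d, polyf setT d (fun x => f (x^-1)%g)) /\ continuous (fun x => f (x^-1)%g).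
Proof.
case: f => f [[d fd] fc] /=; split; first by exists d; apply: polyf_inv.
move=> x; apply: (@continuous_comp _ _ _ (fun x : G => (x^-1)%g) f) => //.
  exact: ginv_continuous.
exact: fc.
Qed.
Definition polyalg_ltransl f h := Polyalg (polyalg_ltranslP f h).
Definition polyalg_inv_fun f := Polyalg (polyalg_invP f).

Lemma polyalg_inv_linear : linear polyalg_inv_fun.
Proof. by move=> c f g; apply: polyalg_inj. Qed.
Lemma polyalg_inv_monoid : monoid_morphism polyalg_inv_fun.
Proof. by split=> [|f g]; apply: polyalg_inj. Qed.
Definition polyalg_inv := mk_lrmorphism polyalg_inv_linear polyalg_inv_monoid.

Lemma polyalg_sumE (I : Type) (r : seq I) (F : I -> polyalg) x :
  (\sum_(i <- r) F i) x = \sum_(i <- r) F i x.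
Proof. exact: (linear_unb_sum (poly_ev_linear x)). Qed.

Hypothesis k_hausdorff : hausdorff_space k.
Hypothesis Gfg : topologically_fg G.

Definition degree_lt d : set polyalg := [set f | polyf setT d f].

Lemma degree_lt_closed d : lin_closed (degree_lt d).
Proof.
split; first exact: polyf_zero.
by move=> a f g; apply: polyf_lin.
Qed.

Fixpoint words n (s : 'I_n -> G) (d : nat) : seq G :=
  if d is d'.+1 then 1%g :: words s d' ++
    [seq (s i * w)%g | i <- enum 'I_n, w <- words s d']
  else [::].

Lemma dense_eq0 (D : set G) (f : G -> k) : dense D -> continuous f ->
  (forall x, D x -> f x = 0) -> forall x, f x = 0.
Proof.
move=> dD fc fD x; apply/eqP; apply: contraT => fx.
have k1 : open (~` [set (0 : k)]).
  apply: closed_openC; apply: accessible_closed_set1.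
  exact: hausdorff_accessible.
have [] := dD (f @^-1` (~` [set (0 : k)])).
- by exists x => /=; apply/eqP.
- by move/continuousP: fc; apply.
- by move=> y [/= fy /fD].
Qed.

(** If [f] vanishes on the words, its differences along the generators vanish by induction. Then [f]
    is invariant under the subgroup they generate, since invariance passes to inverses, so it equals
    f(1) = 0 on a dense set. *)
Lemma words_separated n (s : 'I_n -> G) d :
  dense (subgroup_generated (range s)) ->
  separated poly_ev (degree_lt d) (fun w => List.In w (words s d)).
Proof.
move=> ds; elim: d => [|d IH] f fd fw.
  by apply: polyalg_inj => x; apply: fd.
have cf : continuous f by case: f {fd fw} => f [].
have fs i x : f (s i * x)%g = f x.
  have dfP : (exists e, polyf setT e (ldiff (s i) f)) /\ continuous (ldiff (s i) f).
    split; first by exists d; apply: fd.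
    case: (polyalg_addP (polyalg_ltransl f (s i)) (polyalg_opp f)) => _.
    by rewrite (_ : (fun x => _) = ldiff (s i) f) //; apply/funext => y; rewrite /= mulN1r.
  have : Polyalg dfP = 0.
    apply: IH; first by apply: fd.
    move=> w Ww; rewrite /poly_ev /= /ldiff -!/(poly_ev _ f) !fw ?subrr //=.
      by right; apply: List.in_or_app; left.
    right; apply: List.in_or_app; right; apply: mem_In; apply/allpairsP.
    by exists (i, w); rewrite mem_enum; split=> //; apply: In_mem.
  by move=> /(congr1 (fun f : polyalg => f x)) /= /eqP; rewrite /ldiff subr_eq0 => /eqP.
have Sf : subgroup_generated (range s) `<=` [set g | forall x, f (g * x)%g = f x].
  apply: smallest_sub; last by move=> _ [i _ <-] x; apply: fs.
  split=> [x|a b Ha Hb x]; first by rewrite mul1g.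
  by rewrite -mulgA Ha -Hb mulVKg.
apply: polyalg_inj; apply: (dense_eq0 ds cf) => x /Sf/(_ 1%g); rewrite mulg1 => ->.
by apply: fw; left.
Qed.

Lemma degree_lt_basis d : exists n (e : 'I_n -> polyalg) (t : 'I_n -> G),
  [/\ forall i, degree_lt d (e i), forall i j, e i (t j) = (i == j)%:R &
    forall f, degree_lt d f -> forall x, f x = \sum_i f (t i) * e i x].
Proof.
have [m [s ds]] := Gfg.
have [n [e [t [eV _ et Ve]]]] :=
  dual_basis_points poly_ev_scalar (degree_lt_closed d) (words_separated (d := d) ds).
exists n, e, t; split=> // f /Ve fE x.
by rewrite {1}fE polyalg_sumE.
Qed.

(** For fixed h, g -> f(g h) obeys the same degree bound. It expands in the finite dual basis with
    coefficients f([t i] h), and these are left translates of [f] evaluated at h. *)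
Lemma poly_comult_ex (f : polyalg) : exists s : seq (polyalg * polyalg),
  forall g h, f (g * h)%g = \sum_(p <- s) p.1 g * p.2 h.
Proof.
case: (poly_funP f) => -[d fd] _; have [n [e [t [_ _ Ve]]]] := degree_lt_basis d.
exists [seq (e i, polyalg_ltransl f (t i)) | i <- index_enum 'I_n] => g h.
rewrite big_map.
have fhd : degree_lt d (Polyalg (polyalg_rtranslP f h)).
  by apply: polyf_rtransl.
have /= -> := Ve _ fhd g.
by apply: eq_bigr => i _; rewrite mulrC.
Qed.

Definition poly_comult f := projT1 (cid (poly_comult_ex f)).

Lemma poly_comultE g h f :
  poly_ev (g * h)%g f = \sum_(p <- poly_comult f) poly_ev g p.1 * poly_ev h p.2.
Proof. by rewrite /poly_comult; case: cid => s H; apply: H. Qed.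

Lemma poly_comultA g h l f : poly_ev (g * h * l)%g f = poly_ev (g * (h * l))%g f.
Proof. by rewrite mulgA. Qed.

Lemma poly_comult1 g h :
  \sum_(p <- poly_comult 1) poly_ev g p.1 * poly_ev h p.2 = poly_ev g 1 * poly_ev h 1.
Proof. by rewrite -poly_comultE /poly_ev /= mulr1. Qed.

Lemma poly_comultM g h a b :
  \sum_(p <- poly_comult (a * b)) poly_ev g p.1 * poly_ev h p.2 =
  \sum_(p <- poly_comult a) \sum_(q <- poly_comult b)
    poly_ev g (p.1 * q.1) * poly_ev h (p.2 * q.2).
Proof.
rewrite -poly_comultE; transitivity (poly_ev (g * h)%g a * poly_ev (g * h)%g b) => //.
rewrite !poly_comultE mulr_suml; apply: eq_bigr => p _.
by rewrite mulr_sumr; apply: eq_bigr => q _; rewrite mulrACA.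
Qed.

Lemma poly_counitl f : \sum_(p <- poly_comult f) (poly_pt 1%g p.1 : k) *: p.2 = f.
Proof.
apply: polyalg_inj => x; rewrite polyalg_sumE -[in RHS](mul1g x).
by rewrite -[RHS]/(poly_ev _ f) poly_comultE.
Qed.
Lemma poly_counitr f : \sum_(p <- poly_comult f) (poly_pt 1%g p.2 : k) *: p.1 = f.
Proof.
apply: polyalg_inj => x; rewrite polyalg_sumE -[in RHS](mulg1 x).
rewrite -[RHS]/(poly_ev _ f) poly_comultE; apply: eq_bigr => p _.
by rewrite mulrC.
Qed.
Lemma poly_antipodel f :
  \sum_(p <- poly_comult f) polyalg_inv p.1 * p.2 = (poly_pt 1%g f : k)%:A.
Proof.
apply: polyalg_inj => x; rewrite polyalg_sumE.
transitivity (poly_ev (x^-1 * x)%g f); first by rewrite poly_comultE.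
by rewrite mulVg /= mulr1.
Qed.
Lemma poly_antipoder f :
  \sum_(p <- poly_comult f) p.1 * polyalg_inv p.2 = (poly_pt 1%g f : k)%:A.
Proof.
apply: polyalg_inj => x; rewrite polyalg_sumE.
transitivity (poly_ev (x * x^-1)%g f); first by rewrite poly_comultE.
by rewrite mulgV /= mulr1.
Qed.

Definition poly_group : affineGroup k :=
  hopf_group poly_ev_scalar poly_ev_sep poly_comultE poly_comultA poly_comult1
    poly_comultM poly_counitl poly_counitr poly_antipodel poly_antipoder.

Definition poly_eta_fun (g : G) : top_kpoints poly_group := poly_pt g.

Lemma poly_eta_mul : {morph poly_eta_fun : g h / (g * h)%g}.
Proof. by move=> g h; apply: lrmorphism_eq => f; apply: poly_comultE. Qed.

Definition poly_eta : {multiplicative G -> top_kpoints poly_group} :=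
  HB.pack poly_eta_fun (isMultiplicative.Build G (top_kpoints poly_group)
    poly_eta_fun poly_eta_mul).

Hypothesis char0 : forall n, n.+1%:R != 0 :> k.

Lemma poly_eta_continuous : continuous poly_eta.
Proof.
by apply: (eval_continuous char0) => f; case: (poly_funP (f : polyalg)).
Qed.
End PolynomialAlgebra.

(** Vectors of degree D + 1 are first corrected by the projection [pi] onto degree D, so that the
    earlier functionals vanish on them. The order by degree makes unipotent, filtration-compatible
    operators unitriangular. *)
Lemma filtered_dual_basis (k : fieldType) (L : lmodType k) (T : Type)
    (ev : T -> L -> k) (evL : forall t, scalar (ev t))
    (V : set L) (B : seq L) (F : nat -> set L) :
  lin_closed V -> V `<=` lspan B -> separated ev (lspan B) setT ->
  (forall d, lin_closed (F d)) -> (forall d, F d `<=` F d.+1) ->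
  (forall v, F 0%N v -> v = 0) ->
  forall D, exists (n : nat) (e : 'I_n -> L) (lam : 'I_n -> {scalar L}) (deg : 'I_n -> nat),
  [/\ forall i, [/\ V (e i), F (deg i) (e i) & (0 < deg i <= D)%N],
      forall i j : 'I_n, (i <= j)%N -> (deg i <= deg j)%N,
      forall i j, lam i (e j) = (i == j)%:R,
      forall v, V v -> F D v -> v = \sum_i lam i v *: e i &
      forall d v i, V v -> F d v -> (d < deg i)%N -> lam i v = 0].
Proof.
move=> VL VB sepB FL Fmono F0; have Fle d d' : (d <= d')%N -> F d `<=` F d'.
  by move=> /subnK <-; elim: (d' - d)%N => // m IH v /IH; apply: Fmono.
elim=> [|D [n [e [lam [deg [eV degM dual basis lam0]]]]]].
  exists 0%N, (fun=> 0), (fun=> mk_scalar (f := fun _ : L => 0 : k)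
    (fun c u v => esym (etrans (addr0 _) (mulr0 c)))), (fun=> 0%N).
  by split=> [[]//|[]//|[]//|v _ /F0 ->|d v []//]; rewrite big_ord0.
pose pi v := \sum_i lam i v *: e i.
have piL c u v : pi (c *: u + v) = c *: pi u + pi v.
  rewrite /pi scaler_sumr -big_split; apply: eq_bigr => i _.
  by rewrite linearP /= scalerDl scalerA.
have VFL d : lin_closed (fun v => V v /\ F d v).
  split=> [|c u v [Vu Fu] [Vv Fv]].
    by split; [case: VL | case: (FL d)].
  by split; [case: VL => _; apply | case: (FL d) => _; apply].
have piV v : V (pi v) /\ F D (pi v).
  rewrite -[_ /\ _]/((fun v => V v /\ F D v) (pi v)).
  apply: lin_closed_sum (VFL D) _ => i _; apply: lin_closedZ (VFL D) _.
  by have [Ve Fe /andP[_ dD]] := eV i; split=> //; apply: Fle Fe.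
have pi_id v : V v -> F D v -> pi v = v by move=> Vv Fv; apply/esym/basis.
have lam_pi i v : lam i (pi v) = lam i v.
  rewrite /pi linear_sum (bigD1 i) //= linearZ /= dual eqxx mulr1 big1 ?addr0 //.
  by move=> j ji; rewrite linearZ /= dual eq_sym (negbTE ji) mulr0.
pose V' : set L := [set w | exists v, [/\ V v, F D.+1 v & w = v - pi v]].
have V'L : lin_closed V'.
  split.
    exists 0; split; [by case: VL | by case: (FL D.+1)|].
    by rewrite pi_id ?subrr //; [case: VL | case: (FL D)].
  move=> c _ _ [u [Vu Fu ->]] [v [Vv Fv ->]]; exists (c *: u + v); split.
  - by case: VL => _; apply.
  - by case: (FL D.+1) => _; apply.
  - by rewrite piL scalerBr opprD addrACA.
have V'sub w : V' w -> [/\ V w, F D.+1 w & pi w = 0].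
  move=> [v [Vv Fv ->]]; have [Vp Fp] := piV v; split.
  - exact: lin_closedB.
  - by apply: lin_closedB => //; apply: Fmono.
  - rewrite addrC -scaleN1r piL scaleN1r.
    by rewrite (pi_id (pi v)) // addNr.
have [|n' [e' [t' [eV' et' V'e]]]] := dual_basis evL V'L _ sepB.
  by move=> w /V'sub[/VB].
have lamL' t : scalar (fun v => ev t (v - pi v)).
  move=> c u v; rewrite piL -evL; congr (ev t _).
  by rewrite scalerBr opprD addrACA.
pose e2 (i : 'I_(n + n')) := match fintype.split i with inl a => e a | inr b => e' b end.
pose lam2 (i : 'I_(n + n')) := match fintype.split i with inl a => lam a
  | inr b => mk_scalar (lamL' (t' b)) end.
pose deg2 (i : 'I_(n + n')) := match fintype.split i with inl a => deg a | inr b => D.+1 end.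
exists (n + n')%N, e2, lam2, deg2; split.
- move=> i; rewrite /e2 /deg2; case: (fintype.split i) => [a|b].
    by have [Ve Fe /andP[d0 dD]] := eV a; rewrite d0 leqW.
  by have [Ve Fe _] := V'sub _ (eV' b); rewrite ltnSn.
- move=> i j ij; rewrite /deg2; case: fintype.splitP => [a ia|b ib]; case: fintype.splitP => [c jc|d jd].
  + by apply: degM; rewrite -ia -jc.
  + by have [_ _ /andP[_ /leqW]] := eV a.
  + by move: ij; rewrite ib jc leqNgt (leq_trans (ltn_ord c)) ?leq_addr.
  + by [].
- move=> i j; rewrite -[i]fintype.splitK -[j]fintype.splitK /lam2 /e2 !fintype.unsplitK.
  rewrite (inj_eq (can_inj (@fintype.unsplitK n n'))).
  case: (fintype.split i) (fintype.split j) => [a|b] [c|d] /=.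
  + by rewrite dual; congr (nat_of_bool _)%:R; apply/eqP/eqP => [->|[->]].
  + have [_ _ p0] := V'sub _ (eV' d).
    by rewrite -lam_pi p0 linear0.
  + have [Ve Fe /andP[_ dD]] := eV c.
    by rewrite pi_id ?subrr ?(ev0 evL) //; apply: Fle Fe.
  + have [_ _ p0] := V'sub _ (eV' d).
    by rewrite p0 subr0 et' eq_sym; congr (nat_of_bool _)%:R; apply/eqP/eqP => [->|[->]].
- move=> v Vv Fv; rewrite big_split_ord /= /lam2 /e2.
  rewrite (eq_bigr (fun i => lam i v *: e i)); last first.
    by move=> i _; rewrite (fintype.unsplitK (inl i)).
  rewrite [X in _ + X](eq_bigr (fun j => ev (t' j) (v - pi v) *: e' j)); last first.
    by move=> i _; rewrite (fintype.unsplitK (inr i)).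
  by rewrite -V'e ?subrKC //; exists v.
- move=> d v i Vv Fv; rewrite /deg2 /lam2; case: (fintype.split i) => [a|b] di /=.
    exact: lam0 di.
  by rewrite pi_id ?subrr ?(ev0 evL) //; apply: Fle Fv.
Qed.

(** * Pro-unipotence of the group with coordinate ring R(G) *)

Section Prounipotent.
Variables (G : topologicalGroupType) (k : topologicalFieldType).
Hypothesis k_hausdorff : hausdorff_space k.
Hypothesis Gfg : topologically_fg G.
Local Notation P := (poly_group k_hausdorff Gfg).
Local Notation R := (polyalg G k).

(** Right translation by a group element, minus the identity, lowers polynomial degree. On a
    subcomodule containing algebra generators, an adapted basis makes the matrix coefficients
    unitriangular at the points of [G]; injectivity of [comap f] lifts this to [coord_alg Q]. *)
Lemma poly_group_quotient_unipotent (Q : affineGroup k) (f : schemeHom P Q) :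
  quotient_map f -> algebraic Q -> unipotent Q.
Proof.
have subT := is_subgroup_setT G.
move=> fq Qa; split=> //; case: Qa => nx [x xgen].
pose A := coord_alg Q; pose iota : {lrmorphism A -> R} := comap f.
have [V [B [Vsub VB Vx]]] := finite_subcomodule [seq x i | i <- index_enum 'I_nx].
pose F d : set A := [set a | polyf setT d (iota a)].
have FL d : lin_closed (F d).
  split=> [|c u v Fu Fv]; rewrite /F /=.
    by apply: (polyf_ext subT _ (polyf_zero _ subT d)) => y _; rewrite linear0.
  by apply: (polyf_ext subT _ (polyf_lin subT c Fu Fv)) => y _; rewrite linearP.
have [D BD] : exists D, lspan B `<=` F D.
  elim: (B) => [|b B' [D BD]].
    by exists 0%N => v /= ->; case: (FL 0%N).
  have [[d bd] _] := poly_funP (iota b).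
  exists (maxn d D) => _ [c [v [Bv ->]]]; case: (FL (maxn d D)) => _; apply.
    by apply: (polyfW subT _ bd); rewrite ?leq_maxl.
  by apply: (polyfW subT _ (BD _ Bv)); rewrite ?leq_maxr.
have [|||n [e [lam [deg [eV degM dual basis lam0]]]]] := @filtered_dual_basis k A
  {scalar A} (fun l a => l a) (fun l => linearP l) V B F (proj1 Vsub) VB _ FL _ _ D.
- by move=> v _ H; apply: functional_separation0 => l; apply: H.
- by move=> d v; apply: (polyfS subT).
- move=> v Fv; apply: fq; rewrite linear0.
  by apply: polyalg_inj => y; apply: Fv.
have eV' i : V (e i) by case: (eV i).
have lamV v : V v -> v = \sum_i lam i v *: e i.
  by move=> Vv; apply: basis => //; apply/BD/VB.
pose rho := coeff_mx e lam.
exists n, rho.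
pose m g : {lrmorphism A -> k^o} := alg_comp (poly_pt k g) iota.
pose ms g : {scalar A} := mk_scalar (f := m g) (linearP (m g)).
have mE g a : ms g a = iota a g by [].
have transl_iota g a h : iota (transl (ms g) a) h = iota a (h * g)%g.
  rewrite -mE transl_form convolE.
  have -> : \sum_(p <- comult a) ms h p.1 * ms g p.2 = pt_mul (m h) (m g) a.
    by rewrite comultE.
  have := comap_mul f (poly_pt k h : points P k^o) (poly_pt k g : points P k^o).
  move=> /(congr1 (fun z : {lrmorphism A -> k^o} => z a)) /= <-.
  by rewrite -[RHS]/(poly_ev (h * g)%g (iota a)) (poly_comultE k_hausdorff Gfg).
have rhoE g (i j : 'I_n) : (j <= i)%N -> iota (rho i j) g = (i == j)%:R.
  move=> ji; rewrite -mE coeff_mx_form -dual.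
  apply/eqP; rewrite -subr_eq0 -linearB /=; apply/eqP.
  have [Ve Fe /andP[d0 dD]] := eV j.
  apply: (lam0 (deg j).-1); last by rewrite prednK // degM.
    by apply: lin_closedB (proj1 Vsub) _ _ => //; apply: (proj2 Vsub).
  rewrite -(prednK d0) in Fe.
  have H := polyf_rdiff subT (h := g) I Fe.
  apply: (polyf_ext subT _ H) => y _.
  by rewrite linearB /= /rdiff -transl_iota mulN1r.
split.
- move=> i; have E : iota (rho i i) = iota 1; last exact: fq _ _ E.
  have -> : iota 1 = 1 by exact: rmorph1.
  by apply: polyalg_inj => g; rewrite rhoE // eqxx.
- move=> i j ji; have E : iota (rho i j) = iota 0; last exact: fq _ _ E.
  have ij : (i == j) = false by apply/eqP => E; rewrite E ltnn in ji.
  have -> : iota 0 = 0 by exact: linear0.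
  by apply: polyalg_inj => g; rewrite rhoE ?ij // ltnW.
- move=> S y z; apply/matrixP => i j; rewrite [LHS]mxE [RHS]mxE.
  rewrite -[LHS]/(pt_mul y z (rho i j)) (coeff_mx_mul Vsub eV' lamV).
  by apply: eq_bigr => h _; congr (_ * _); rewrite [RHS]mxE.
- move=> S SA SX; apply: xgen => // _ [i _ <-].
  have [S1 SD SM] := SA; have SL : lin_closed [set a | a \in S].
    split=> [|c u v Su Sv]; last exact: SD.
    by have := SD (-1) 1 1 S1 S1; rewrite scaleN1r addNr.
  have -> : x i = \sum_j lam j (x i) *: e j.
    by apply: lamV; apply: Vx; apply: mem_In; apply: map_f; exact: mem_index_enum.
  have Ssum (c : 'I_n -> k) (F' : 'I_n -> A) : (forall h, F' h \in S) ->
      \sum_h c h *: F' h \in S.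
    move=> SF; exact: (@lin_closed_sum k A [set a | a \in S] _ _ xpredT
      (fun h => c h *: F' h) SL (fun h _ => lin_closedZ (c h) SL (SF h))).
  apply: (Ssum) => j; rewrite (coeff_mx_basis Vsub eV' lamV).
  by apply: Ssum => h; apply: SX; exists h, j.
Qed.
End Prounipotent.

(** * Universality, and evaluation on a Mal'cev completion *)

Section EvaluationPolynomial.
Variables (k : topologicalFieldType) (G : groupType) (U : affineGroup k).
Variable h : {multiplicative G -> top_kpoints U}.
Let subT := is_subgroup_setT G.

Lemma eval_mul x y a :
  eval_pt (h (x * y)%g : kpoints U) a = pt_mul (h x : kpoints U) (h y : kpoints U) a.
Proof. by rewrite gmulfM. Qed.

(** A left difference of the entry (i, j) of a unitriangular representation involves only entries
    (l, j) with l > i, so the entry has degree less than [m - i]; the entries generate the functions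
    on the unipotent quotient. *)
Lemma prounipotent_eval_polyf (a : coord_alg U) : prounipotent U ->
  exists d, polyf setT d (fun x => eval_pt (h x : kpoints U) a : k).
Proof.
move=> Uu; have [Q [f [b [fq Qa <-]]]] := algebraic_quotient_containing a.
have [_ [m [rho rhoE]]] := Uu Q f fq Qa.
pose ev b x : k := eval_pt (h x : kpoints U) (comap f b).
rewrite -/(ev b); move: b; apply: (embedding_ind rhoE).
- exists 1%N; apply: (polyf_ext subT _ (polyf_const (N := setT) (1 : k))) => x _.
  by rewrite /ev !rmorph1.
- move=> c u v [d Hd] [e He]; exists (maxn d e).
  have Hd' := polyfW subT (leq_maxl d e) Hd; have He' := polyfW subT (leq_maxr d e) He.
  apply: (polyf_ext subT _ (polyf_lin subT c Hd' He')) => x _.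
  by rewrite /ev !linearP.
- move=> u v [d Hd] [e He]; exists (d + e)%N.
  apply: (polyf_ext subT _ (polyf_mul subT Hd He)) => x _.
  by rewrite /ev !rmorphM.
have evM x y i j : ev (rho i j) (x * y)%g = \sum_l ev (rho i l) x * ev (rho l j) y.
  rewrite /ev eval_mul.
  pose hx : {lrmorphism coord_alg U -> k^o} := (h x : kpoints U).
  pose hy : {lrmorphism coord_alg U -> k^o} := (h y : kpoints U).
  transitivity (pt_mul (alg_comp hx (comap f)) (alg_comp hy (comap f)) (rho i j)).
    exact: (congr1 (fun z : {lrmorphism coord_alg Q -> k^o} => z (rho i j))
      (comap_mul f (hx : points U k^o) (hy : points U k^o))).
  by rewrite (embedding_mul rhoE).
have [r1 r0 _ _] := rhoE.
have ev1 (i : 'I_m) x : ev (rho i i) x = 1 by rewrite /ev r1 !rmorph1.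
have ev0 (i l : 'I_m) x : (l < i)%N -> ev (rho i l) x = 0.
  by move=> li; rewrite /ev r0 // !linear0.
suff H n (i j : 'I_m) : (m - i <= n)%N -> polyf setT n (ev (rho i j)).
  by move=> i j; exists (m - i)%N; apply: H.
elim: n i j => [|n IH] i j.
  by rewrite leqn0 subn_eq0 leqNgt ltn_ord.
move=> min g _.
have E x : setT x -> \sum_(l : 'I_m | (i < l)%N) ev (rho i l) g * ev (rho l j) x
    = ldiff g (ev (rho i j)) x.
  move=> _; rewrite /ldiff evM [in RHS](bigID (fun l : 'I_m => (i < l)%N)) /=.
  rewrite [X in _ = _ + X - _](bigD1 i) ?ltnn //=.
  rewrite [X in _ = _ + (_ + X) - _]big1 => [|l /andP[]].
    by rewrite ev1 mul1r addr0 addrK.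
  rewrite -leqNgt leq_eqVlt => /orP[/eqP/val_inj -> |li _]; first by rewrite eqxx.
  by rewrite ev0 // mul0r.
apply: (polyf_ext subT E).
apply: polyf_sum => // l il; apply: polyf_scale => //; apply: IH.
move: min; rewrite !leq_subLR => /leq_trans; apply.
by rewrite addnS -addSn leq_add2r.
Qed.
End EvaluationPolynomial.

Section MalcevCompletion.
Variables (k : topologicalFieldType) (G : topologicalGroupType).
Hypothesis k_hausdorff : hausdorff_space k.
Hypothesis char0 : forall n, n.+1%:R != 0 :> k.
Hypothesis Gfg : topologically_fg G.
Local Notation P := (poly_group k_hausdorff Gfg).
Local Notation R := (polyalg G k).

Section Classifying.
Variables (U : affineGroup k) (h : {multiplicative G -> top_kpoints U}).
Hypothesis Uu : prounipotent U.
Hypothesis hc : continuous h.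

Definition eval_poly (a : coord_alg U) : R :=
  Polyalg (conj (prounipotent_eval_polyf h a Uu) (continuous_eval char0 (a := a) Uu hc)).

Lemma eval_poly_linear : linear eval_poly.
Proof. by move=> c u v; apply: polyalg_inj => x /=; rewrite linearP. Qed.

Lemma eval_poly_monoid : monoid_morphism eval_poly.
Proof.
by split=> [|u v]; apply: polyalg_inj => x /=; rewrite ?rmorph1 ?rmorphM.
Qed.

Definition eval_poly_hom : {lrmorphism coord_alg U -> coord_alg P} :=
  mk_lrmorphism eval_poly_linear eval_poly_monoid.

Lemma eval_poly_comap_mul (S : comAlgType k) (x y : points P S) :
  (alg_comp (x * y)%g eval_poly_hom : points U S) =
  ((alg_comp x eval_poly_hom : points U S) * (alg_comp y eval_poly_hom : points U S))%g.
Proof.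
apply: lrmorphism_eq => a.
rewrite -[RHS]/(pt_mul (alg_comp x eval_poly_hom) (alg_comp y eval_poly_hom) a) comultE.
pose s := [seq (eval_poly p.1, eval_poly p.2) | p <- comult a].
transitivity (\sum_(p <- s) x p.1 * y p.2); last by rewrite big_map.
apply: (@bilinear_eq k R R G G (@poly_ev G k) (@poly_ev G k) (@poly_ev_scalar G k)
  (@poly_ev_scalar G k) (@poly_ev_sep G k) (@poly_ev_sep G k) S (fun a b => x a * y b)).
- by move=> b c u v; rewrite linearP mulrDl scalerAl.
- by move=> b c u v; rewrite linearP mulrDr scalerAr.
- move=> t t'; rewrite -poly_comultE big_map /poly_ev /=.
  by rewrite eval_mul comultE.
Qed.

Definition classifying_hom : schemeHom P U := SchemeHom eval_poly_comap_mul.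
End Classifying.

Variables (M : affineGroup k) (eta : {multiplicative G -> top_kpoints M}).
Hypothesis eta_malcev : is_malcev_completion eta.

Let Mu : prounipotent M. Proof. by case: eta_malcev. Qed.
Let etac : continuous eta. Proof. by case: eta_malcev. Qed.

Lemma malcev_eval_poly a :
  (exists d, polyf setT d (fun x => eval_pt (eta x : kpoints M) a : k)) /\
  continuous (fun x => eval_pt (eta x : kpoints M) a : k).
Proof. exact: poly_funP (eval_poly Mu etac a). Qed.

Let classify : exists f : schemeHom M P, forall x (a : R),
  eval_pt (eta x : kpoints M) (comap f a) = a x.
Proof.
case: eta_malcev => _ _ /(_ P (poly_eta k_hausdorff Gfg)) [].
- exact: poly_group_quotient_unipotent.
- exact: poly_eta_continuous.
move=> f [fE _]; exists f => x a.
exact: (congr1 (fun z : {lrmorphism coord_alg P -> k^o} => z a) (fE x)).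
Qed.

(** The universal property of [M], applied to [poly_eta], gives a homomorphism along which [phi]
    pulls back to the required function. *)
Lemma malcev_eval_surj (phi : R) :
  exists a, forall x, eval_pt (eta x : kpoints M) a = phi x.
Proof. by have [f fE] := classify; exists (comap f phi) => x; apply: fE. Qed.

(** The composite of [f] from [M] to [P] with the classifying homomorphism back to [M] fixes [eta],
    so by uniqueness it is the identity; [comap f] then recovers a function from its values on
    [G]. *)
Lemma malcev_eval_inj a b :
  (forall x, eval_pt (eta x : kpoints M) a = eval_pt (eta x : kpoints M) b) -> a = b.
Proof.
have [f fE] := classify; pose g := classifying_hom Mu etac.
have gfM (S : comAlgType k) (x y : points M S) :
    (alg_comp (x * y)%g (alg_comp (comap f) (comap g)) : points M S) =
    ((alg_comp x (alg_comp (comap f) (comap g)) : points M S) *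
     (alg_comp y (alg_comp (comap f) (comap g)) : points M S))%g.
  have E z : (alg_comp z (alg_comp (comap f) (comap g)) : points M S) =
    alg_comp (alg_comp z (comap f) : points P S) (comap g) by apply: lrmorphism_eq.
  by rewrite !E (comap_mul f) (comap_mul g).
have idM (S : comAlgType k) (x y : points M S) :
    (alg_comp (x * y)%g (alg_id M) : points M S) =
    ((alg_comp x (alg_id M) : points M S) * (alg_comp y (alg_id M) : points M S))%g.
  by rewrite !alg_comp_id.
have [_ _ /(_ M eta Mu etac)[f0 [_ uniq]]] := eta_malcev.
have gf1 : comap (SchemeHom gfM) =1 comap f0.
  by apply: uniq => x; apply: lrmorphism_eq => c /=; apply: fE.
have id1 : comap (SchemeHom idM) =1 comap f0.
  by apply: uniq => x; apply: lrmorphism_eq.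
have ret c : comap f (eval_poly Mu etac c) = c.
  by have := gf1 c; rewrite -id1.
move=> ab; rewrite -[a]ret -[b]ret; congr (comap f _).
exact: polyalg_inj.
Qed.
End MalcevCompletion.

(** * Extending polynomial functions *)

Section LowerCentral.
Variable G : groupType.
Local Notation gam := (@lower_central G).

Lemma gen_subgroup (A : set G) : is_subgroup (subgroup_generated A).
Proof.
split; first by move=> N [[N1 _] _].
move=> x y Nx Ny N [sN AN]; case: (sN) => _; apply.
  by apply: Nx.
by apply: Ny.
Qed.

Lemma gen_subset (A : set G) : A `<=` subgroup_generated A.
Proof. by move=> x Ax N [_]; apply. Qed.

Lemma gen_smallest (A N : set G) : is_subgroup N -> A `<=` N ->
  subgroup_generated A `<=` N.
Proof. by move=> sN AN x; apply. Qed.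

Lemma lower_central_subgroup n : is_subgroup (gam n).
Proof. by case: n => [|n] //; apply: gen_subgroup. Qed.

Lemma lower_central_commg n x y : gam n x -> gam n.+1 (commg x y).
Proof. by move=> nx; apply: gen_subset; exists x, y. Qed.

Lemma lower_central_S n : gam n.+1 `<=` gam n.
Proof.
elim: n => [|n IH] //; apply: gen_smallest; first exact: gen_subgroup.
by move=> _ [x [y [nx ->]]]; apply: lower_central_commg; apply: IH.
Qed.

Lemma lower_central_le m n : (m <= n)%N -> gam n `<=` gam m.
Proof.
by move=> /subnK <-; elim: (n - m)%N => // d IH x /lower_central_S; apply: IH.
Qed.

Lemma lower_central_conj n s x : gam n x -> gam n (s * x * s^-1)%g.
Proof.
move=> nx; have sn := lower_central_subgroup n.
have -> : (s * x * s^-1 = x * commg x (s^-1))%g.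
  by rewrite commgEl mulVKg conjgE invgK mulgA.
apply: (subgroupM sn) => //; apply: lower_central_S; exact: lower_central_commg.
Qed.

Lemma lower_central_conj_diff n s x : gam n x -> gam n.+1 (s * x * s^-1 * x^-1)%g.
Proof.
move=> nx; have sn := lower_central_subgroup n.
have -> : (s * x * s^-1 * x^-1 = (commg (x^-1) (s^-1))^-1)%g.
  by rewrite invgR commgEl conjgE !invgK !mulgA.
apply: (subgroupV (lower_central_subgroup _)).
by apply: lower_central_commg; apply: (subgroupV sn).
Qed.
End LowerCentral.

(** * Weighted degree and conjugation *)

Section WeightedDegree.
Variables (G : groupType) (k : fieldType) (L : set G) (c : nat).
Hypotheses (subL : is_subgroup L) (normL : forall s x, L x -> L (s * x * s^-1)%g).
Hypothesis c_gt0 : (0 < c)%N.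
Hypothesis gam_c : forall g, @lower_central G c g -> g = 1%g.
Local Notation gam := (@lower_central G).
Implicit Types phi psi : G -> k.

(* Polynomials on [L] of degree < D, where differences along elements of the
   (e+1)-st term of the lower central series of [G] count as e+1 derivatives;
   conjugation by [G] is unipotent for this filtration. *)
Inductive wpoly : nat -> (G -> k) -> Prop :=
| wpoly0 phi : (forall x, L x -> phi x = 0) -> wpoly 0 phi
| wpolyS D phi : (forall e g, L g -> gam e g -> wpoly (D - e) (ldiff g phi)) ->
    wpoly D.+1 phi.

Lemma wpoly0E phi : wpoly 0 phi -> forall x, L x -> phi x = 0.
Proof. by move=> H; inversion H. Qed.

Lemma wpolySE D phi : wpoly D.+1 phi ->
  forall e g, L g -> gam e g -> wpoly (D - e) (ldiff g phi).
Proof. by move=> H; inversion H. Qed.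

Lemma wpoly_ext D phi psi : (forall x, L x -> phi x = psi x) ->
  wpoly D phi -> wpoly D psi.
Proof.
move=> E H; elim: H psi E => {D phi} [phi H|D phi _ IH] psi E.
  by apply: wpoly0 => x Lx; rewrite -E ?H.
apply: wpolyS => e g Lg eg; apply: (IH e g Lg eg) => x Lx.
by rewrite /ldiff !E //; apply: subgroupM.
Qed.

Lemma wpoly_zero D phi : (forall x, L x -> phi x = 0) -> wpoly D phi.
Proof.
elim/ltn_ind: D phi => -[|D] IH phi H; first exact: wpoly0.
apply: wpolyS => e g Lg _; apply: IH; first by rewrite ltnS leq_subr.
by move=> x Lx; rewrite /ldiff !H ?subrr //; apply: subgroupM.
Qed.

Lemma wpolyW D D' phi : (D <= D')%N -> wpoly D phi -> wpoly D' phi.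
Proof.
move=> DD' H; elim: H D' DD' => {D phi} [phi H|D phi _ IH] D' DD'.
  exact: wpoly_zero.
case: D' DD' => // D' DD'; apply: wpolyS => e g Lg eg.
by apply: (IH e g Lg eg); rewrite leq_sub2r.
Qed.

Lemma wpoly_add D phi psi : wpoly D phi -> wpoly D psi ->
  wpoly D (fun x => phi x + psi x).
Proof.
move=> H; elim: H psi => {D phi} [phi H|D phi _ IH] psi Hq.
  by apply: wpoly0 => x Lx; rewrite H // (wpoly0E Hq) // addr0.
apply: wpolyS => e g Lg eg.
apply: wpoly_ext (IH e g Lg eg _ (wpolySE Hq Lg eg)) => x _.
by rewrite /ldiff; ring.
Qed.

Lemma wpoly_ltransl D h phi : L h -> wpoly D phi -> wpoly D (fun x => phi (h * x)%g).
Proof.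
move=> Lh; case: D => [|D] H.
  by apply: wpoly0 => x Lx; apply: (wpoly0E H); apply: subgroupM.
have gh : gam 0 h by [].
apply: wpoly_ext (wpoly_add H (wpolyW _ (wpolySE H Lh gh))) => [x _|].
  by rewrite /ldiff addrC subrK.
by rewrite subn0 leqW.
Qed.

Definition conjf (s : G) phi : G -> k := fun x => phi (s * x * s^-1)%g.

(** Differencing the conjugate of [phi] along [g] amounts to differencing [phi] along
    [s * g * s^-1]. This is [h * g] with [h] one step deeper in the lower central series, and that
    step is the gain in weighted degree. *)
Lemma wpoly_conj D s phi : wpoly D phi ->
  wpoly D (conjf s phi) /\ wpoly D.-1 (fun x => conjf s phi x - phi x).
Proof.
elim/ltn_ind: D phi => -[|D] IH phi H.
  split; apply: wpoly_zero => x Lx; rewrite /conjf !(wpoly0E H) ?subrr //.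
  by apply: normL. by apply: normL.
have key e g : L g -> gam e g ->
    wpoly (D - e) (conjf s (ldiff (s * g * s^-1)%g phi)) /\
    wpoly (D - e.+1) (fun x => ldiff g (conjf s phi) x - ldiff g phi x).
  move=> Lg eg; have Dlt : (D - e < D.+1)%N by rewrite ltnS leq_subr.
  have Lsg := normL s Lg; have esg := lower_central_conj s eg.
  have [H1 _] := IH _ Dlt _ (wpolySE H Lsg esg); split=> //.
  pose h := (s * g * s^-1 * g^-1)%g.
  have Lh : L h by apply: subgroupM => //; apply: subgroupV.
  have eh : gam e.+1 h by apply: lower_central_conj_diff.
  have [_ H2] := IH _ Dlt _ (wpolySE H Lg eg).
  have H3 := wpoly_ltransl Lg (wpolySE H Lh eh).
  have Dlt' : (D - e.+1 < D.+1)%N by rewrite ltnS leq_subr.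
  have [H4 _] := IH _ Dlt' _ H3.
  rewrite -subnS in H2; apply: wpoly_ext (wpoly_add H2 H4) => x _.
  rewrite /conjf /ldiff /h !mulgA !mulgVK; ring.
have conjE g x : ldiff g (conjf s phi) x = conjf s (ldiff (s * g * s^-1)%g phi) x.
  by rewrite /ldiff /conjf !mulgA mulgVK.
split.
  apply: wpolyS => e g Lg eg; have [H1 _] := key e g Lg eg.
  by apply: wpoly_ext H1 => x _; rewrite conjE.
have {}key e g : L g -> gam e g ->
    wpoly (D - e.+1) (ldiff g (fun x => conjf s phi x - phi x)).
  move=> Lg eg; have [_ H2] := key e g Lg eg.
  by apply: wpoly_ext H2 => x _; rewrite /ldiff; ring.
(* For [D = 0] the bound in [key] is truncated and only makes the difference constant; vanishing
   comes from writing conjugation as left multiplication by an element of [L]. *)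
case: D H key {IH} => [|D] H key; last first.
  by apply: wpolyS => e g Lg eg; rewrite -subSS; apply: key.
apply: wpoly0 => x Lx.
have Lh : L (s * x * s^-1 * x^-1)%g.
  by apply: (subgroupM subL); [apply: normL | apply: (subgroupV subL)].
have gh : gam 0 (s * x * s^-1 * x^-1)%g by [].
by have := wpoly0E (wpolySE H Lh gh) Lx; rewrite /ldiff mulgVK.
Qed.

(** Elements of [lower_central e] with [e >= c] are trivial, so one ordinary difference never costs
    more than [c] units of weight. *)
Lemma polyf_wpoly d phi : polyf L d phi -> wpoly (c * d) phi.
Proof.
elim: d phi => [|d IH] phi H; first by rewrite muln0; apply: wpoly0.
rewrite mulnS -(prednK c_gt0) addSn; apply: wpolyS => e g Lg eg.
case: (leqP c e) => [ce|ec].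
  have -> : g = 1%g by apply: gam_c; apply: lower_central_le ce _ eg.
  by apply: wpoly_zero => x _; rewrite /ldiff mul1g subrr.
apply: wpolyW (IH _ (H g Lg)); rewrite prednK // addnC -addnBA ?leq_addr //.
by rewrite -ltnS prednK.
Qed.

(** Conjugation thus acts unipotently on polynomial functions, which makes phi(y^n x y^(-n))
    polynomial in n by Newton interpolation. *)
Lemma polyf_iter_conj d s phi : polyf L d phi ->
  forall x, L x -> iter (c * d) (fun psi y => conjf s psi y - psi y) phi x = 0.
Proof.
move=> /polyf_wpoly; move: (c * d)%N => D H; apply: wpoly0E.
suff : forall m, wpoly (D - m) (iter m (fun psi y => conjf s psi y - psi y) phi).
  by move=> /(_ D); rewrite subnn.
elim=> [|m IH]; first by rewrite subn0.
by rewrite iterS subnS; have [] := wpoly_conj s IH.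
Qed.
End WeightedDegree.

(** * Polynomial dependence on exponents *)

Section PolynomialSequences.
Variable k : fieldType.
Hypothesis char0 : forall n, n.+1%:R != 0 :> k.

Definition pseq (a : nat -> k) := exists P : {poly k}, forall n, a n = P.[n%:R].

(** This drives the finite case: an identity polynomial in an exponent is checked only at multiples
    of [r], where the powers of y lie in L. *)
Lemma pseq_eq (a b : nat -> k) r : (0 < r)%N -> pseq a -> pseq b ->
  (forall n, a (n * r)%N = b (n * r)%N) -> forall n, a n = b n.
Proof.
move=> r0 [P aP] [Q bQ] ab n; rewrite aP bQ.
have : P - Q = 0.
  apply: (poly_nat_eq0 char0 r0) => m.
  by rewrite hornerD hornerN -aP -bQ ab subrr.
by move=> /eqP; rewrite subr_eq0 => /eqP ->.
Qed.

Lemma pseq_ext (a b : nat -> k) : a =1 b -> pseq a -> pseq b.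
Proof. by move=> ab [P aP]; exists P => n; rewrite -ab. Qed.

Lemma pseq_mul (a b : nat -> k) : pseq a -> pseq b -> pseq (fun n => a n * b n).
Proof. by move=> [P aP] [Q bQ]; exists (P * Q) => n; rewrite hornerM aP bQ. Qed.

Lemma pseq_sum d (a : 'I_d -> nat -> k) : (forall i, pseq (a i)) ->
  pseq (fun n => \sum_i a i n).
Proof.
move=> /choice[P aP]; exists (\sum_i P i) => n.
by rewrite horner_sum; apply: eq_bigr => i _.
Qed.

Lemma pseq_const (c : k) : pseq (fun=> c).
Proof. by exists c%:P => n; rewrite hornerC. Qed.

Lemma pseq_affine (P : {poly k}) (a b : k) : pseq (fun n => P.[a * n%:R + b]).
Proof.
exists (P \Po (a *: 'X + b%:P)) => n.
by rewrite horner_comp hornerD hornerZ hornerX hornerC.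
Qed.
End PolynomialSequences.

Section Newton.
Variables (k : fieldType) (T : Type) (sigma : T -> T).
Hypothesis char0 : forall n, n.+1%:R != 0 :> k.
Implicit Type phi : T -> k.

Definition diffop phi : T -> k := fun x => phi (sigma x) - phi x.

Lemma newton_full n phi x : phi (iter n sigma x) =
  \sum_(j < n.+1) 'C(n, j)%:R * iter j diffop phi x.
Proof.
elim: n phi => [|n IH] phi; first by rewrite big_ord1 mul1r.
have -> : phi (iter n.+1 sigma x) = phi (iter n sigma x) + diffop phi (iter n sigma x).
  by rewrite /diffop iterS addrC subrK.
rewrite !IH [RHS]big_ord_recl bin0.
under [in RHS]eq_bigr => j _ do rewrite lift0 binS natrD mulrDl.
rewrite big_split addrA /=; congr (_ + _).
  rewrite big_ord_recl bin0; congr (_ + _).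
  rewrite [RHS]big_ord_recr /= bin_small // mul0r addr0.
  by apply: eq_bigr.
by apply: eq_bigr => j _; rewrite -iterSr.
Qed.

Lemma newton d n phi x : (forall j, (d <= j)%N -> iter j diffop phi x = 0) ->
  phi (iter n sigma x) = \sum_(j < d) (bin_poly k j).[n%:R] * iter j diffop phi x.
Proof.
move=> H; rewrite newton_full.
transitivity (\sum_(j < n.+1 + d) 'C(n, j)%:R * iter j diffop phi x).
  rewrite big_split_ord /= [X in _ = _ + X]big1 ?addr0 // => j _.
  by rewrite bin_small ?mul0r // ltn_addr.
rewrite addnC big_split_ord /= [X in _ + X]big1 ?addr0 => [|j _].
  by apply: eq_bigr => j _; rewrite (bin_polyE char0).
by rewrite H ?mulr0 // leq_addr.
Qed.

Lemma newton_pseq d phi x : (forall j, (d <= j)%N -> iter j diffop phi x = 0) ->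
  pseq (fun n => phi (iter n sigma x)).
Proof.
move=> H; apply: (pseq_ext (fun n => esym (newton n H))).
apply: pseq_sum => j; apply: pseq_mul; last exact: pseq_const.
by exists (bin_poly k j).
Qed.
End Newton.

Section PolyfPowers.
Variables (G : groupType) (k : fieldType) (N : set G).
Hypothesis char0 : forall n, n.+1%:R != 0 :> k.
Hypothesis subN : is_subgroup N.
Implicit Type phi : G -> k.

Lemma iter_rmul n (u x : G) : iter n (fun x => x * u)%g x = (x * u ^+ n)%g.
Proof. by elim: n => [|n IH]; rewrite ?mulg1 // iterS IH expgSr mulgA. Qed.

Lemma iter_lmul n (u x : G) : iter n (fun x => u * x)%g x = (u ^+ n * x)%g.
Proof. by rewrite iter_mulg. Qed.

Lemma iter_rdiff_polyf d u phi j : N u -> polyf N d phi ->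
  polyf N (d - j) (iter j (rdiff u) phi).
Proof.
move=> Nu H; elim: j => [|j IH]; first by rewrite subn0.
rewrite iterS subnS; case: (d - j)%N IH => [|n] IH /=; last exact: polyf_rdiff.
by move=> x Nx; rewrite /rdiff !IH ?subrr //; apply: (subgroupM subN).
Qed.

Lemma iter_ldiff_polyf d u phi j : N u -> polyf N d phi ->
  polyf N (d - j) (iter j (ldiff u) phi).
Proof.
move=> Nu H; elim: j => [|j IH]; first by rewrite subn0.
rewrite iterS subnS; case: (d - j)%N IH => [|n] IH /=; last exact: IH.
by move=> x Nx; rewrite /ldiff !IH ?subrr //; apply: (subgroupM subN).
Qed.

Lemma iter_rdiff0 d u phi j x : N u -> N x -> polyf N d phi -> (d <= j)%N ->
  iter j (rdiff u) phi x = 0.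
Proof.
move=> Nu Nx H dj; have := iter_rdiff_polyf j Nu H.
by move: dj; rewrite -subn_eq0 => /eqP -> /(_ x Nx).
Qed.

Lemma iter_ldiff0 d u phi j x : N u -> N x -> polyf N d phi -> (d <= j)%N ->
  iter j (ldiff u) phi x = 0.
Proof.
move=> Nu Nx H dj; have := iter_ldiff_polyf j Nu H.
by move: dj; rewrite -subn_eq0 => /eqP -> /(_ x Nx).
Qed.

(** Newton's formula for phi(x u^t) with an exponent t in k; [lpow] is the same for phi(u^t x). The
    exponents that occur are fractions with denominator r. *)
Definition rpow d u (t : k) phi : G -> k :=
  fun x => \sum_(j < d) (bin_poly k j).[t] * iter j (rdiff u) phi x.
Definition lpow d u (t : k) phi : G -> k :=
  fun x => \sum_(j < d) (bin_poly k j).[t] * iter j (ldiff u) phi x.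

Lemma rpowE d u n phi x : N u -> N x -> polyf N d phi ->
  rpow d u n%:R phi x = phi (x * u ^+ n)%g.
Proof.
move=> Nu Nx H; rewrite -iter_rmul; symmetry.
by apply: (newton (sigma := fun x => (x * u)%g) char0) => j; apply: iter_rdiff0 H.
Qed.

Lemma lpowE d u n phi x : N u -> N x -> polyf N d phi ->
  lpow d u n%:R phi x = phi (u ^+ n * x)%g.
Proof.
move=> Nu Nx H; rewrite -iter_lmul; symmetry.
by apply: (newton (sigma := fun x => (u * x)%g) char0) => j; apply: iter_ldiff0 H.
Qed.

Lemma rmul_pseq d u phi x : N u -> N x -> polyf N d phi ->
  pseq (fun n => phi (x * u ^+ n)%g).
Proof.
move=> Nu Nx H; apply: pseq_ext (fun n => congr1 phi (iter_rmul n u x)) _.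
by apply: (@newton_pseq k G (fun x => (x * u)%g) char0 d) => j; apply: iter_rdiff0 H.
Qed.

Lemma rpow_pseq D u phi (z : nat -> G) (a b : k) :
  (forall d (psi : G -> k), polyf N d psi -> pseq (fun n => psi (z n))) -> N u ->
  (exists d, polyf N d phi) -> pseq (fun n => rpow D u (a * n%:R + b) phi (z n)).
Proof.
move=> zP Nu [d H]; apply: pseq_sum => j; apply: pseq_mul; first exact: pseq_affine.
exact: zP (iter_rdiff_polyf j Nu H).
Qed.

Lemma lpow_pseq D u phi x (a b : k) :
  pseq (fun n => lpow D u (a * n%:R + b) phi x).
Proof.
apply: pseq_sum => j; apply: pseq_mul; first exact: pseq_affine.
exact: pseq_const.
Qed.
End PolyfPowers.

(** * Extension when a power of y lies in L *)

Section FiniteExtension.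
Variables (G : groupType) (k : fieldType) (L : set G) (c r : nat) (y : G).
Hypothesis char0 : forall n, n.+1%:R != 0 :> k.
Hypotheses (subL : is_subgroup L) (normL : forall s x, L x -> L (s * x * s^-1)%g).
Hypothesis c_gt0 : (0 < c)%N.
Hypothesis gam_c : forall g, @lower_central G c g -> g = 1%g.
Hypotheses (r_gt0 : (0 < r)%N) (Lyr : L (y ^+ r)%g).
Implicit Type phi : G -> k.

Let u := (y ^+ r)%g.
Let rk0 : r%:R != 0 :> k. Proof. by rewrite -(prednK r_gt0) char0. Qed.

Definition fin_ext_set : set G := [set g | exists l n, L l /\ g = (l * y ^+ n)%g].
Local Notation L' := fin_ext_set.

Let normLX n x : L x -> L (y ^+ n * x * (y ^+ n)^-1)%g. Proof. exact: normL. Qed.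

Lemma fin_ext_subgroup : is_subgroup L'.
Proof.
have inv n : exists l m, L l /\ ((y ^+ n)^-1 = l * y ^+ m)%g.
  have le : (n <= r * n)%N by rewrite leq_pmull.
  exists ((y ^+ (r * n))^-1)%g, (r * n - n)%N; split.
    by apply: (subgroupV subL); rewrite expgnA; apply: subgroupX.
  apply: (mulgI (y ^+ (r * n))%g); rewrite mulgA mulgV mul1g.
  by rewrite -[in LHS](subnK le) expgnDr mulgK.
split; first by exists 1%g, 0%N; rewrite mulg1; split=> //; apply: subgroup1.
move=> _ _ [l [n [Ll ->]]] [l2 [m [Ll2 ->]]].
have [l3 [q [Ll3 E]]] := inv m.
exists (l * (y ^+ n * l3 * (y ^+ n)^-1) * (y ^+ (n + q) * l2^-1 * (y ^+ (n + q))^-1))%g, (n + q)%N.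
split.
  apply: (subgroupM subL); first by apply: (subgroupM subL) => //; apply: normL.
  by apply: normL; apply: (subgroupV subL).
by rewrite invgM E !mulgA mulgVK expgnDr !mulgA mulgVK.
Qed.

Variable D : nat.

(** At l y^n the value is phi(l u^(n/r)), y being treated as an r-th root of u. The truncation order
    [D] is fixed apart from the degree, so that one operator serves throughout the induction on
    degree. *)
Definition fin_ext phi : G -> k := fun g =>
  if pselect (exists ln : G * nat, L ln.1 /\ g = (ln.1 * y ^+ ln.2)%g) is left H
  then rpow D u ((projT1 (cid H)).2%:R / r%:R) phi (projT1 (cid H)).1 else 0.

Let pow_pseq d phi x v : (d <= D)%N -> L v -> L x -> polyf L d phi ->
  forall b : k, forall e, pseq (fun n => rpow D u (e * n%:R + b) phi (x * v ^+ n)%g).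
Proof.
move=> dD Lv Lx H b e; apply: (@rpow_pseq G k L subL D u phi (fun n => (x * v ^+ n)%g) e b) => //.
  by move=> d' psi; apply: (rmul_pseq char0 subL).
by exists d.
Qed.

Lemma fin_extE d phi l n : (d <= D)%N -> polyf L d phi -> L l ->
  fin_ext phi (l * y ^+ n)%g = rpow D u (n%:R / r%:R) phi l.
Proof.
move=> dD Hd Ll; have H : polyf L D phi := polyfW subL dD Hd.
(* Independence of the decomposition: with l1 = l2 v, both sides are values at e = 1 of polynomial
   sequences in e, and these agree at multiples of r because v^r = u^(n2 - n1). *)
have aux l1 l2 n1 n2 : (n1 <= n2)%N -> L l1 -> L l2 ->
    (l1 * y ^+ n1 = l2 * y ^+ n2)%g ->
    rpow D u (n1%:R / r%:R) phi l1 = rpow D u (n2%:R / r%:R) phi l2.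
  move=> n12 L1 L2 E; pose v := (y ^+ (n2 - n1))%g.
  have l1E : (l1 = l2 * v)%g.
    by apply: (mulIg (y ^+ n1)%g); rewrite E -mulgA -expgnDr subnK.
  have Lv : L v.
    have -> : (v = l2^-1 * l1)%g by rewrite l1E mulKg.
    by apply: (subgroupM subL) => //; apply: (subgroupV subL).
  have S1 := pow_pseq (leqnn D) Lv L2 H 0 (n1%:R / r%:R).
  have S2 := pow_pseq (leqnn D) (subgroup1 subL) L2 H 0 (n2%:R / r%:R).
  have := pseq_eq char0 r_gt0 S1 S2 _ 1%N.
  rewrite !addr0 !mulr1 !expg1 mulg1 l1E; apply => m.
  have E1 q : q%:R / r%:R * (m * r)%:R + 0 = (q * m)%:R :> k.
    by rewrite addr0 !natrM; field; exact: rk0.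
  rewrite !E1 expg1n mulg1 !(rpowE char0 subL) //; last first.
    by apply: (subgroupM subL) => //; apply: subgroupX.
  congr phi; rewrite -mulgA; congr (_ * _)%g.
  rewrite /v /u -!expgnA -expgnDr; congr (_ ^+ _)%g.
  rewrite -[in RHS](subnK n12) mulnDl mulnDr; congr (_ + _)%N.
  by rewrite mulnA mulnC.
rewrite /fin_ext; case: pselect => [H'|]; last by case; exists (l, n).
case: cid => -[l' n'] /= [Ll' E].
by case/orP: (leq_total n n') => nn'; [apply/esym/aux | apply: aux].
Qed.

Lemma fin_ext_id d phi l : (d <= D)%N -> polyf L d phi -> L l -> fin_ext phi l = phi l.
Proof.
move=> dD Hd Ll; rewrite -{1}[l]mulg1 -(expg0 y) (fin_extE 0 dD Hd Ll) mul0r.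
by rewrite -[0]/(0%:R) (rpowE char0 subL) ?expg0 ?mulg1 //; exact: (polyfW subL dD Hd).
Qed.

(* The two sides are polynomial in b, and agree when r divides b. *)
Lemma rpow_conj d phi x b : (d <= D)%N -> polyf L d phi -> L x ->
  rpow D u (b%:R / r%:R) phi (y ^+ b * x * (y ^+ b)^-1)%g = lpow D u (b%:R / r%:R) phi x.
Proof.
move=> dD Hd Lx; have H : polyf L D phi := polyfW subL dD Hd.
have S1 : pseq (fun n => rpow D u (r%:R^-1 * n%:R + 0) phi (y ^+ n * x * (y ^+ n)^-1)%g).
  apply: (@rpow_pseq G k L subL D u phi (fun n => (y ^+ n * x * (y ^+ n)^-1)%g)) => //.
    move=> d' psi Hpsi.
    have itE n : iter n (fun z => y * z * y^-1)%g x = (y ^+ n * x * (y ^+ n)^-1)%g.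
      elim: n => [|n IH]; first by rewrite !expg0 mul1g invg1 mulg1.
      by rewrite iterS IH expgS invgM !mulgA.
    apply: (pseq_ext (fun n => congr1 psi (itE n))).
    apply: (@newton_pseq k G (fun z => (y * z * y^-1)%g) char0 (c * d')) => j cj.
    have it0 q : forall z, L z ->
        iter (c * d' + q) (diffop (fun z => (y * z * y^-1)%g)) psi z = 0.
      elim: q => [|q IH] z Lz.
        by rewrite addn0; apply: (polyf_iter_conj subL normL c_gt0 gam_c y Hpsi).
      by rewrite addnS iterS /diffop !IH ?subrr //; apply: normL.
    by rewrite -(subnKC cj) it0.
  by exists d.
have S2 := @lpow_pseq G k D u phi x r%:R^-1 0.
have := pseq_eq char0 r_gt0 S1 S2 _ b.
rewrite !addr0 ![r%:R^-1 * _]mulrC; apply => m.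
have -> : r%:R^-1 * (m * r)%:R + 0 = m%:R :> k.
  by rewrite addr0 natrM mulrC mulfK.
have ym : (y ^+ (m * r) = u ^+ m)%g by rewrite mulnC expgnA.
have Lum : L (u ^+ m)%g by apply: subgroupX.
rewrite ym (rpowE char0 subL) ?(lpowE char0 subL) //; last first.
  apply: (subgroupM subL); last exact: (subgroupV subL).
  exact: (subgroupM subL).
by rewrite mulgVK.
Qed.

(** The term j = 0 of the Newton sum is [phi] and the others have lower degree; for [D = 0] the sum
    is empty, whence the case distinction. *)
Let lpow_polyf d t phi : polyf L d phi -> polyf L d (lpow D u t phi) /\
  polyf L d.-1 (fun x => lpow D u t phi x - (if D is 0 then 0 else phi x)).
Proof.
move=> H; split.
  apply: (polyf_sum subL) => j _; apply: (polyf_scale subL).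
  by apply: (polyfW subL _ (iter_ldiff_polyf subL j Lyr H)); rewrite leq_subr.
case: D => [|D'].
  apply: (polyf_ext subL (phi := fun=> 0)) => [x _|].
    by rewrite /lpow big_ord0 subr0.
  exact: polyf_zero.
apply: (polyf_ext subL (phi := fun x => \sum_(j < D')
    (bin_poly k j.+1).[t] * iter j.+1 (ldiff u) phi x)) => [x _|].
  rewrite /lpow big_ord_recl /= hornerC mul1r addrAC subrr add0r.
  by apply: eq_bigr.
apply: (polyf_sum subL) => j _; apply: (polyf_scale subL).
apply: (polyfW subL _ (iter_ldiff_polyf subL j.+1 Lyr H)).
by rewrite subnS -!subn1 leq_sub2r ?leq_subr.
Qed.

Let rpowB d t phi psi x : L x -> rpow d u t (fun x => phi x - psi x) x =
  rpow d u t phi x - rpow d u t psi x.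
Proof.
move=> Lx; rewrite /rpow -sumrB; apply: eq_bigr => j _; rewrite -mulrBr; congr (_ * _).
elim: (nat_of_ord j) x Lx => // {}j IH x Lx.
by rewrite !iterS /rdiff !IH //; [ring | apply: (subgroupM subL)].
Qed.

(** The difference along l0 y^b is the extension of [Tphi - phi], where [Tphi] stands for x ->
    phi(l0 y^b x) with y^b read as u^(b/r). It has lower degree on L, so the extension keeps the
    degree bound. *)
Lemma fin_ext_polyf d phi : (d <= D)%N -> polyf L d phi -> polyf L' d (fin_ext phi).
Proof.
elim: d phi => [|d IH] phi dD H.
  move=> _ [l [n [Ll ->]]]; rewrite (fin_extE _ dD H) // /rpow big1 // => j _.
  by rewrite (iter_rdiff0 subL Lyr Ll H) ?mulr0.
move=> g [l0 [b [Ll0 gE]]].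
pose phi0 x := phi (l0 * x)%g; have H0 : polyf L d.+1 phi0 by apply: (polyf_ltransl subL).
pose Tphi := lpow D u (b%:R / r%:R) phi0.
have [T1 T2] := lpow_polyf (b%:R / r%:R) H0.
have D0 : (0 < D)%N by apply: leq_trans dD.
have T3 : polyf L d (fun x => Tphi x - phi x).
  apply: (polyf_ext subL _ (polyf_add subL T2 (H l0 Ll0))) => x _.
  by rewrite /Tphi /ldiff; case: D D0 => // D' _; rewrite /phi0; ring.
have dD' : (d <= D)%N by apply: ltnW.
apply: (polyf_ext (fin_ext_subgroup) _ (IH _ dD' T3)) => _ [l [n [Ll ->]]].
rewrite (fin_extE _ dD' T3) // rpowB // /ldiff (fin_extE _ dD H) //; congr (_ - _).
have -> : (g * (l * y ^+ n) = l0 * (y ^+ b * l * (y ^+ b)^-1) * y ^+ (b + n))%g.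
  by rewrite gE expgnDr !mulgA mulgVK.
set z := (y ^+ b * l * (y ^+ b)^-1)%g; have Lz : L z by apply: normL.
have Ll0z : L (l0 * z)%g by apply: (subgroupM subL).
rewrite (fin_extE _ dD H) //.
have HD := polyfW subL dD H; have TD := polyfW subL dD T1.
have S1 : pseq (fun q => rpow D u (r%:R^-1 * q%:R + 0) Tphi l).
  apply: (@rpow_pseq G k L subL D u Tphi (fun=> l)) => //; last by exists d.+1.
  by move=> d' psi _; apply: pseq_const.
have S2 : pseq (fun q => rpow D u (r%:R^-1 * q%:R + b%:R / r%:R) phi (l0 * z)%g).
  apply: (@rpow_pseq G k L subL D u phi (fun=> (l0 * z)%g)) => //; last by exists d.+1.
  by move=> d' psi _; apply: pseq_const.
have := pseq_eq char0 r_gt0 S1 S2 _ n.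
have -> : r%:R^-1 * n%:R + b%:R / r%:R = (b + n)%:R / r%:R :> k.
  by rewrite natrD mulrDl addrC [r%:R^-1 * _]mulrC.
rewrite addr0 [r%:R^-1 * _]mulrC; apply => m.
have mr : r%:R^-1 * (m * r)%:R = m%:R :> k by rewrite natrM mulrC mulfK.
rewrite mr addr0 (rpowE char0 subL) //.
have Lum : L (u ^+ m)%g by apply: subgroupX.
rewrite /Tphi -(rpow_conj b dD H0); last exact: (subgroupM subL).
(* Both sides are polynomial in b, with value phi (l0 z u^(b/r + m)). *)
pose w := (y ^+ b * u ^+ m * (y ^+ b)^-1)%g.
have wE : w = (u ^+ m)%g.
  by rewrite /w /u -expgnA -expgnDr addnC expgnDr mulgK.
have -> : (y ^+ b * (l * u ^+ m) * (y ^+ b)^-1 = z * u ^+ m)%g.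
  by rewrite -[in RHS]wE /w /z !mulgA mulgVK.
have S3 : pseq (fun q => rpow D u (r%:R^-1 * q%:R + 0) phi0 (z * u ^+ m)%g).
  apply: (@rpow_pseq G k L subL D u phi0 (fun=> (z * u ^+ m)%g)) => //; last by exists d.+1.
  by move=> d' psi _; apply: pseq_const.
have S4 : pseq (fun q => rpow D u (r%:R^-1 * q%:R + m%:R) phi (l0 * z)%g).
  apply: (@rpow_pseq G k L subL D u phi (fun=> (l0 * z)%g)) => //; last by exists d.+1.
  by move=> d' psi _; apply: pseq_const.
have := pseq_eq char0 r_gt0 S3 S4 _ b.
rewrite addr0 [r%:R^-1 * _]mulrC [m%:R + _]addrC; apply => q.
have qr : r%:R^-1 * (q * r)%:R = q%:R :> k by rewrite natrM mulrC mulfK.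
rewrite qr addr0 -natrD !(rpowE char0 subL) //; last 2 first.
- exact: (subgroupM subL).
- exact: (polyfW subL dD H0).
by rewrite /phi0 addnC expgnDr !mulgA.
Qed.

Lemma fin_ext_pow g : L' g -> L (g ^+ r)%g.
Proof.
move=> [l [n [Ll ->]]].
have H m : exists l', L l' /\ ((l * y ^+ n) ^+ m = l' * y ^+ (n * m))%g.
  elim: m => [|m [l' [Ll' IH]]].
    by exists 1%g; rewrite muln0 !expg0 mulg1; split=> //; apply: subgroup1.
  exists (l * (y ^+ n * l' * (y ^+ n)^-1))%g; split.
    by apply: (subgroupM subL) => //; apply: normL.
  by rewrite expgS IH mulnS expgnDr !mulgA mulgVK.
have [l' [Ll' ->]] := H r; apply: (subgroupM subL) => //.
by rewrite mulnC expgnA; apply: subgroupX.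
Qed.

(** Along the powers of [g] the function is polynomial in the exponent, and it vanishes at multiples
    of [r]. *)
Lemma fin_ext_unique d phi : polyf L' d phi -> (forall x, L x -> phi x = 0) ->
  forall g, L' g -> phi g = 0.
Proof.
move=> Hd phi0 g L'g; have sL' := fin_ext_subgroup.
have S1 := rmul_pseq char0 sL' L'g (subgroup1 sL') Hd.
have := pseq_eq char0 r_gt0 S1 (pseq_const 0) _ 1%N.
rewrite mul1g expg1; apply => n.
by rewrite mul1g mulnC expgnA; apply: phi0; apply: subgroupX => //; apply: fin_ext_pow.
Qed.
End FiniteExtension.

(** * Extension along a complement of L *)

Section SplitExtension.
Variables (G : groupType) (k : fieldType) (L Y : set G) (c : nat).
Hypotheses (subL : is_subgroup L) (normL : forall s x, L x -> L (s * x * s^-1)%g).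
Hypothesis subY : is_subgroup Y.
Hypothesis LY1 : forall x, L x -> Y x -> x = 1%g.
Hypothesis c_gt0 : (0 < c)%N.
Hypothesis gam_c : forall g, @lower_central G c g -> g = 1%g.
Implicit Type phi : G -> k.

Definition mul_set : set G := [set g | exists l s, [/\ L l, Y s & g = (l * s)%g]].
Local Notation L' := mul_set.

Lemma mul_set_subgroup : is_subgroup L'.
Proof.
split.
  by exists 1%g, 1%g; rewrite mulg1; split=> //; [apply: (subgroup1 subL) | apply: (subgroup1 subY)].
move=> _ _ [l [s [Ll Ys ->]]] [l2 [s2 [Ll2 Ys2 ->]]].
exists (l * (s * s2^-1 * l2^-1 * (s * s2^-1)^-1))%g, (s * s2^-1)%g.
have Yss : Y (s * s2^-1)%g by case: subY => _; apply.
split=> //.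
  by apply: (subgroupM subL) => //; apply: normL; apply: (subgroupV subL).
have -> : (l * s * (l2 * s2)^-1 = l * (s * s2^-1) * l2^-1)%g.
  by rewrite invgM !mulgA.
by move: (s * s2^-1)%g => t; rewrite !mulgA mulgVK.
Qed.

Definition split_ext phi : G -> k := fun g =>
  if pselect (exists ls : G * G, [/\ L ls.1, Y ls.2 & g = (ls.1 * ls.2)%g]) is left H
  then phi (projT1 (cid H)).1 else 0.

Lemma split_extE phi l s : L l -> Y s -> split_ext phi (l * s)%g = phi l.
Proof.
move=> Ll Ys; rewrite /split_ext; case: pselect => [H|]; last by case; exists (l, s).
case: cid => -[l' s'] /= [Ll' Ys' E].
suff -> : l' = l by [].
have E2 : (l'^-1 * l = s' * s^-1)%g.
  by apply: (mulIg s); rewrite mulgVK -mulgA E mulKg.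
have H1 : (l'^-1 * l = 1)%g.
  apply: LY1.
    by apply: (subgroupM subL) => //; apply: (subgroupV subL).
  by rewrite E2; case: subY => _; apply.
by apply: (mulgI (l'^-1)%g); rewrite H1 mulVg.
Qed.

(** The difference along l0 s0 is the extension of the s0-conjugate of phi(l0 x), minus [phi]. Both
    the conjugation and the translation by l0 change [phi] only in lower weighted degree. *)
Lemma split_ext_wpoly D phi : wpoly L D phi -> polyf L' D (split_ext phi).
Proof.
elim: D phi => [|D IH] phi H.
  by move=> _ [l [s [Ll Ys ->]]]; rewrite split_extE //; apply: (wpoly0E H).
move=> _ [l0 [s0 [Ll0 Ys0 ->]]].
pose phi0 x := phi (l0 * x)%g.
have gl : lower_central 0 l0 by [].
have H0 : wpoly L D (fun x => phi0 x - phi x) by have := wpolySE H Ll0 gl; rewrite subn0.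
have Hphi0 : wpoly L D.+1 phi0 by apply: (wpoly_ltransl subL).
have [_ /= H1] := wpoly_conj subL normL s0 Hphi0.
have H2 := wpoly_add subL H1 H0.
apply: (polyf_ext mul_set_subgroup _ (IH _ H2)) => _ [l [s [Ll Ys ->]]].
rewrite split_extE // /ldiff.
have -> : (l0 * s0 * (l * s) = l0 * (s0 * l * s0^-1) * (s0 * s))%g.
  by rewrite !mulgA mulgVK.
rewrite !split_extE //.
- by rewrite /conjf /phi0; ring.
- by apply: (subgroupM subL) => //; apply: normL.
- exact: (subgroupM subY).
Qed.

Lemma split_ext_polyf d phi : polyf L d phi -> polyf L' (c * d) (split_ext phi).
Proof. by move=> H; apply: split_ext_wpoly; apply: polyf_wpoly gam_c _ _ _. Qed.
End SplitExtension.

(** * Profinite groups and p-adic exponents *)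

Section ZeroDimensional.
Variable T : topologicalType.
Hypotheses (T_hausdorff : hausdorff_space T) (T_compact : compact [set: T]).

Let clopen_at (x : T) : set (set T) := [set D | D x /\ clopen D].

(** If every clopen neighbourhood of [x] met [K], their traces would cluster at a point of [K],
    although some clopen neighbourhood of [x] excludes that point. *)
Lemma quasi_component_compact (x : T) (K : set T) : closed K ->
  (forall y, K y -> exists D, clopen_at x D /\ ~ D y) ->
  exists D, clopen_at x D /\ D `&` K = set0.
Proof.
move=> cK KD; apply: contrapT => nD.
have DK D : clopen_at x D -> (D `&` K) !=set0.
  by move=> xD; apply/set0P/eqP => DK0; apply: nD; exists D.
pose F := filter_from (clopen_at x) (fun D => D `&` K).
have FF : ProperFilter F.
  apply: filter_from_proper => [|D /DK//].
  apply: filter_from_filter; first by exists setT; split => //; exact: clopenT.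
  move=> A B [Ax cA] [Bx cB]; exists (A `&` B); first by split=> //; exact: clopenI.
  by rewrite setIACA setIid.
have Kc : compact K by apply: (subclosed_compact cK T_compact).
have FK : F K by exists setT; [split=> //; exact: clopenT | move=> y []].
have [y [Ky cly]] := Kc F FF FK.
have [D [[Dx cD] nDy]] := KD y Ky; apply: nDy.
have FD : F D by exists D => // z [].
have : closure D y by move=> B yB; exact: cly.
by have [_ /closure_id <-] := cD.
Qed.

(** The quasi-component [Q] of [x] is connected: normality thickens a splitting of [Q] to disjoint
    open sets, compactness puts a clopen [D] inside their union, and the half of [D] around [x] is
    clopen and must contain [Q]. Total disconnectedness makes [Q] a point. *)
Lemma compact_totally_disconnected_zero_dimensional :
  totally_disconnected [set: T] -> zero_dimensional T.
Proof.
move=> tdT x y xy; apply: contrapT => nsep.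
pose Q : set T := [set z | forall D, clopen_at x D -> D z].
have Qx : Q x by move=> D [].
have Qy : Q y.
  move=> D [Dx cD]; apply: contrapT => nDy; apply: nsep; exists D; by split.
have Qcl : closed Q.
  have -> : Q = \bigcap_(D in clopen_at x) D by [].
  by apply: closed_bigI => D [_ []].
suff Qc : connected Q.
  have : connected_component setT x y by exists Q.
  by rewrite tdT //= => yx; move/eqP: xy; apply.
move=> B B0 [C oC BE] [C' cC' BE'].
have clB : closed B by rewrite BE'; apply: closedI.
have clQB : closed (Q `\` B).
  rewrite (_ : Q `\` B = Q `&` ~` C); first by apply: closedI => //; exact: open_closedC.
  by rewrite BE setDE setCI setIUr setICr set0U.
have sep : exists U V : set T, [/\ open U, open V, B `<=` U, Q `\` B `<=` V & U `&` V = set0].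
  have := compact_normal T_hausdorff T_compact clB.
  move=> /(_ (~` (Q `\` B))) [].
    apply/set_nbhsP; exists (~` (Q `\` B)); split=> //.
      exact: closed_openC.
    by move=> z Bz [_]; apply.
  move=> W /set_nbhsP [U [oU BU UW]] clW.
  exists U, (~` closure W); split=> //.
  - exact: closed_openC (@closed_closure _ _).
  - by move=> z QBz clz; apply: (clW _ clz).
  - rewrite -subset0 => z [Uz]; apply; apply: subset_closure; exact: UW.
have [U [V [oU oV BU QBV UV0]]] := sep.
have [D [[Dx [oD cD]] DK]] : exists D, clopen_at x D /\ D `&` ~` (U `|` V) = set0.
  apply: quasi_component_compact; first by apply: open_closedC; apply: openU.
  move=> z nUV; apply: contrapT => nD; apply: nUV.
  have Qz : Q z.
    by move=> D xD; apply: contrapT => nDz; apply: nD; exists D.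
  by have [Bz|nBz] := pselect (B z); [left; apply: BU | right; apply: QBV].
have DUV z : D z -> U z \/ V z.
  move=> Dz; apply: contrapT => nUV.
  have : (D `&` ~` (U `|` V)) z by split.
  by rewrite DK.
have nUV z : U z -> V z -> False.
  move=> Uz Vz; have : (U `&` V) z by split.
  by rewrite UV0.
have clDU : clopen (D `&` U).
  split; first exact: openI.
  rewrite (_ : D `&` U = D `&` ~` V); first by apply: closedI => //; exact: open_closedC.
  apply/seteqP; split=> z [Dz Hz]; split=> //; first by move=> Vz; exact: nUV Hz Vz.
  by case: (DUV z Dz).
have clDV : clopen (D `&` V).
  split; first exact: openI.
  rewrite (_ : D `&` V = D `&` ~` U); first by apply: closedI => //; exact: open_closedC.
  apply/seteqP; split=> z [Dz Hz]; split=> //; first by move=> Uz; exact: nUV Uz Hz.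
  by case: (DUV z Dz).
apply/seteqP; split=> z; first by rewrite BE => -[].
move=> Qz; have [Ux|Vx] := DUV x Dx.
  apply: contrapT => nBz; have [_ Uz] := Qz _ (conj (conj Dx Ux) clDU).
  by apply: nUV Uz _; apply: QBV.
have [b Bb] := B0; have Qb : Q b by move: Bb; rewrite BE => -[].
have [_ Vb] := Qb _ (conj (conj Dx Vx) clDV).
by case: (nUV b (BU _ Bb) Vb).
Qed.
End ZeroDimensional.

(** * Open normal subgroups of a profinite group *)

Section VanDantzig.
Variable G : topologicalGroupType.
Hypotheses (G_hausdorff : hausdorff_space G) (G_compact : compact [set: G]).
Hypothesis G_td : totally_disconnected [set: G].

Definition open_normal : set (set G) := [set W | open W /\ is_normal W].

(** [W] consists of the elements whose insertion into any product x y does not affect membership in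
    a clopen [U]. It is a normal subgroup inside [U], and compactness of the space of pairs (x, y)
    makes it a neighbourhood of 1. *)
Lemma open_normal_base (A : set G) : nbhs 1%g A -> exists2 W, open_normal W & W `<=` A.
Proof.
have zd := compact_totally_disconnected_zero_dimensional G_hausdorff G_compact G_td.
move=> /(zero_dimensional_cvg G_hausdorff zd G_compact) [U [U1 [oU cU]] UA].
pose W : set G := [set g | forall x y, U (x * g * y)%g <-> U (x * y)%g].
exists W; last first.
  by move=> g /(_ 1%g 1%g); rewrite !mul1g !mulg1 => -[_ H]; apply: UA; apply: H.
have nW : is_normal W.
  split.
    split; first by move=> x y; rewrite mulg1.
    move=> g h Wg Wh x y.
    have -> : (x * (g * h^-1) * y = x * g * (h^-1 * y))%g by rewrite !mulgA.
    apply: iff_trans (Wg _ _) _; apply: iff_sym.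
    by have := Wh x (h^-1 * y)%g; rewrite -[(x * h * _)%g]mulgA mulVKg.
  move=> g h Wg x y.
  have -> : (x * (h^-1 * g * h) * y = x * h^-1 * g * (h * y))%g by rewrite !mulgA.
  by apply: iff_trans (Wg _ _) _; rewrite -mulgA mulKg.
have WN : nbhs 1%g W.
  have covG : near_covering [set: G * G].
    by apply/compact_near_coveringP; rewrite -setXTT; exact: compact_setX.
  pose P (g : G) (z : G * G) := U (z.1 * g * z.2)%g <-> U (z.1 * z.2)%g.
  have := covG G (nbhs 1%g) P _ _.
  move=> H; apply: filterS (H _ _) => [g gP x y|z _]; first exact: (gP (x, y)).
  pose f (w : (G * G) * G) := (w.1.1 * w.2 * w.1.2)%g.
  have fc : continuous f.
    move=> w; apply: (@continuous_comp _ (G * G)%type G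
      (fun w : (G * G) * G => ((w.1.1 * w.2)%g, w.1.2)) (fun z => (z.1 * z.2)%g)); last first.
      exact: gmul_continuous.
    apply: cvg_pair => /=.
      apply: (@continuous_comp _ (G * G)%type G
        (fun w : (G * G) * G => (w.1.1, w.2)) (fun z => (z.1 * z.2)%g)); last first.
        exact: gmul_continuous.
      apply: cvg_pair => /=; last exact: cvg_snd.
      apply: (@continuous_comp _ (G * G)%type G fst fst); exact: cvg_fst.
    apply: (@continuous_comp _ (G * G)%type G fst snd); [exact: cvg_fst | exact: cvg_snd].
  have mc : continuous (fun w : (G * G) * G => (w.1.1 * w.1.2)%g).
    move=> w; apply: (@continuous_comp _ (G * G)%type G fst (fun z => (z.1 * z.2)%g)).
      exact: cvg_fst.
    exact: gmul_continuous.
  have fz : f (z, 1%g) = (z.1 * z.2)%g by rewrite /f /= mulg1.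
  have main (V : set G) : open V -> V (z.1 * z.2)%g ->
      \forall w \near (z, 1%g), V (f w) /\ V (w.1.1 * w.1.2)%g.
    move=> oV Vz; apply: filterI.
      by apply: fc; rewrite fz; apply: open_nbhs_nbhs.
    by apply: mc; apply: open_nbhs_nbhs.
  have [Uz|nUz] := pselect (U (z.1 * z.2)%g).
    by apply: filterS (main U oU Uz) => w [H1 H2].
  by apply: filterS (main (~` U) (closed_openC cU) nUz) => w [H1 H2].
split=> //; rewrite openE => g Wg.
have H : \forall h \near g, W (g^-1 * h)%g.
  by apply: (@continuous_lmul G (g^-1)%g g W); rewrite mulVg.
apply: filterS H => h Wh.
by have := subgroupM (proj1 nW) Wg Wh; rewrite mulVKg.
Qed.
End VanDantzig.

Section PrimePowers.
Variable G : groupType.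

(* Lagrange: left translation by x permutes the cosets of W, with all orbits of
   the same size, the order of x modulo W. *)
Lemma index_power (W : set G) (n : nat) (x : G) : is_normal W -> has_index W n ->
  W (x ^+ n)%g.
Proof.
move=> [subW normW] [t tP].
have /choice[idx idxP] : forall g, exists i : 'I_n, W ((t i)^-1 * g)%g /\
    forall j, W ((t j)^-1 * g)%g -> i = j.
  by move=> g; have [i [Wi iu]] := tP g; exists i.
pose f (i : 'I_n) := idx (x * t i)%g.
have fW i : W ((t (f i))^-1 * (x * t i))%g by have [] := idxP (x * t i)%g.
have fU i j : W ((t j)^-1 * (x * t i))%g -> f i = j.
  by have [_ H] := idxP (x * t i)%g; apply: H.
have tU i j : W ((t j)^-1 * t i)%g -> i = j.
  move=> Wj; have [l [_ lU]] := tP (t i).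
  by rewrite -(lU i) ?(lU j) // mulVg; apply: (subgroup1 subW).
have fm m i j : iter m f i = j <-> W ((t j)^-1 * (x ^+ m * t i))%g.
  elim: m j => [|m IH] j.
    rewrite expg0 mul1g; split=> [<-|/tU//].
    by rewrite mulVg; apply: (subgroup1 subW).
  rewrite iterS; set h := iter m f i; have /IH Wh : iter m f i = h by [].
  rewrite expgS -mulgA; split=> [<-|Wj].
    by have := subgroupM subW (fW h) Wh; rewrite -!mulgA mulVKg.
  apply: fU; have := subgroupM subW Wj (subgroupV subW Wh).
  by rewrite !invgM !invgK -!mulgA mulVKg mulVKg.
have fix_iter m i : iter m f i = i <-> W (x ^+ m)%g.
  rewrite fm; split=> [Wt|Wx]; last by rewrite mulgA; apply: normW.
  have := normW _ (t i)^-1%g Wt.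
  by rewrite invgK -!mulgA mulVKg mulgV mulg1.
have f_inj : injective f.
  move=> i i' fii'; apply/esym/tU.
  have := subgroupM subW (subgroupV subW (fW i)) (fW i').
  by rewrite fii' !invgM !invgK -!mulgA mulVKg mulKg.
have [i0 _] := tP 1%g.
have ord_le i i' : (order f i <= order f i')%N.
  rewrite leqNgt; apply/negP => lt; have := findex_iter lt.
  have -> : iter (order f i') f i = i.
    by apply/fix_iter/(fix_iter _ i'); exact: iter_order.
  by rewrite findex0 => /esym; have := order_gt0 f i'; case: (order f i').
have ord_eq i : order f i = order f i0 by apply/eqP; rewrite eqn_leq !ord_le.
have /dvdnP[m nE] : (order f i0 %| n)%N.
  have H := @fcard_order_set _ f f_inj (order f i0) predT.
  have cn : #|'I_n| = n by rewrite card_ord.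
  suff /dvdn_trans : (order f i0 %| #|'I_n|)%N by apply; rewrite {1}cn.
  rewrite -H ?dvdn_mull //.
  by apply/fintype.subsetP => i _; rewrite inE ord_eq.
have Wr : W (x ^+ order f i0)%g by apply/(fix_iter _ i0); exact: iter_order.
by rewrite nE mulnC expgnA; apply: (subgroupX subW).
Qed.
End PrimePowers.

Section NormalCongruence.
Variables (G : groupType) (W : set G).
Hypothesis normW : is_normal W.
Let subW : is_subgroup W. Proof. by case: normW. Qed.

Lemma is_normalJ s x : W x -> W (s * x * s^-1)%g.
Proof. by case: normW => _ H /(H _ s^-1%g); rewrite invgK. Qed.

Lemma congr_refl x : W (x^-1 * x)%g.
Proof. by rewrite mulVg; apply: (subgroup1 subW). Qed.

Lemma congr_sym x y : W (x^-1 * y)%g -> W (y^-1 * x)%g.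
Proof. by move=> /(subgroupV subW); rewrite invgM invgK. Qed.

Lemma congr_trans x y z : W (x^-1 * y)%g -> W (y^-1 * z)%g -> W (x^-1 * z)%g.
Proof. by move=> xy yz; have := subgroupM subW xy yz; rewrite -mulgA mulVKg. Qed.

Lemma congr_mul x y x' y' : W (x^-1 * y)%g -> W (x'^-1 * y')%g ->
  W ((x * x')^-1 * (y * y'))%g.
Proof.
move=> xy xy'; have H : W (x'^-1 * (x^-1 * y) * x')%g by case: normW => _; apply.
by have := subgroupM subW H xy'; rewrite invgM -!mulgA mulVKg.
Qed.

Lemma congr_inv x y : W (x^-1 * y)%g -> W (x^-1^-1 * y^-1)%g.
Proof.
by move=> /congr_sym /(is_normalJ y); rewrite -!mulgA mulVKg invgK.
Qed.
End NormalCongruence.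

Section Adjoin.
Variables (G : topologicalGroupType) (p : nat) (L : set G) (y : G).
Hypothesis base : forall A : set G, nbhs 1%g A -> exists2 W, open_normal W & W `<=` A.
Hypothesis prime_powers : forall (W : set G) x, open_normal W ->
  exists e, W (x ^+ (p ^ e))%g.
Hypothesis p_gt0 : (0 < p)%N.
Hypotheses (subL : is_subgroup L) (normL : forall s x, L x -> L (s * x * s^-1)%g).
Hypothesis y_central : forall s, L (s * y * s^-1 * y^-1)%g.

Lemma open_normalT : open_normal [set: G].
Proof. by split; [exact: openT | split]. Qed.

Lemma open_normalI (A B : set G) : open_normal A -> open_normal B -> open_normal (A `&` B).
Proof.
move=> [oA [[A1 AM] nA]] [oB [[B1 BM] nB]]; split; first exact: openI.
split; first by split=> // g h [Ag Bg] [Ah Bh]; split; [exact: AM | exact: BM].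
by move=> g h [Ag Bg]; split; [exact: nA | exact: nB].
Qed.

Lemma open_normal_nbhs (W : set G) x : open_normal W -> nbhs x [set z | W (x^-1 * z)%g].
Proof.
move=> [oW [[W1 _] _]]; apply: (@continuous_lmul G (x^-1)%g x W).
by rewrite mulVg; apply: open_nbhs_nbhs.
Qed.

Lemma closed_approx (A : set G) x : closed A ->
  (forall W, open_normal W -> exists2 a, A a & W (a^-1 * x)%g) -> A x.
Proof.
move=> cA H; apply: contrapT => nAx.
have oA : open (~` A) by exact: closed_openC.
have : nbhs 1%g [set w | (~` A) (x * w)%g].
  by apply: (@continuous_lmul G x 1%g (~` A)); rewrite mulg1; apply: open_nbhs_nbhs.
move=> /base [W Wn WA]; have [a Aa Wa] := H W Wn.
have nW : is_normal W by case: Wn.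
by have := WA _ (congr_sym nW Wa) ; rewrite /= mulVKg.
Qed.

(** The closure of L<y>, described modulo open normal subgroups. Natural exponents are enough, as
    [y] has p-power order modulo each of them. *)
Definition adjoin : set G := [set g | forall W, open_normal W ->
  exists l n, L l /\ W ((l * y ^+ n)^-1 * g)%g].

Lemma conj_pow s n : L (s * y ^+ n * s^-1 * (y ^+ n)^-1)%g.
Proof.
elim: n => [|n IH].
  by rewrite expg0 mulg1 mulgV mul1g invg1; apply: (subgroup1 subL).
have H := normL (s * y ^+ n * s^-1)%g (y_central s).
have := subgroupM subL H IH.
by rewrite expgSr !invgM !invgK -!mulgA !mulKg mulVKg.
Qed.

Lemma adjoin_pow l n : L l -> adjoin (l * y ^+ n)%g.
Proof. by move=> Ll W [_ nW]; exists l, n; split=> //; exact: congr_refl. Qed.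

Lemma adjoin_base l : L l -> adjoin l.
Proof. by move=> /(adjoin_pow 0); rewrite expg0 mulg1. Qed.

Lemma adjoin_elt : adjoin y.
Proof. by have := adjoin_pow 1 (subgroup1 subL); rewrite mul1g expg1. Qed.

Lemma adjoin_smallest (A : set G) : closed A ->
  (forall l n, L l -> A (l * y ^+ n)%g) -> adjoin `<=` A.
Proof.
move=> cA H g gL; apply: closed_approx => // W Wn.
by have [l [n [Ll Wg]]] := gL W Wn; exists (l * y ^+ n)%g => //; exact: H.
Qed.

Lemma adjoin_closed : closed adjoin.
Proof.
move=> g clg W Wn; have [h [hL Wh]] := clg _ (open_normal_nbhs g Wn).
have [_ nW] := Wn; have [l [n [Ll Wlh]]] := hL W Wn.
by exists l, n; split=> //; apply: (congr_trans nW Wlh); exact: congr_sym.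
Qed.

Lemma adjoin_subgroup : is_subgroup adjoin.
Proof.
split; first by apply: adjoin_base; apply: (subgroup1 subL).
move=> g h gL hL W Wn; have [_ nW] := Wn.
have [l [n [Ll Wg]]] := gL W Wn; have [l' [n' [Ll' Wh]]] := hL W Wn.
have [e We] := prime_powers y Wn.
(* Modulo [W] the power y^(p^e) is trivial, so y^(-n') is y^(n' (p^e - 1)). *)
pose m := (n + n' * (p ^ e).-1)%N.
exists (l * (y ^+ m * l'^-1 * (y ^+ m)^-1))%g, m; split.
  by apply: subgroupM => //; apply: normL; exact: subgroupV.
apply: (congr_trans nW _ (congr_mul nW Wg (congr_inv nW Wh))).
have -> : (l * (y ^+ m * l'^-1 * (y ^+ m)^-1) * y ^+ m = l * y ^+ m * l'^-1)%g.
  by rewrite !mulgA mulgVK.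
have -> : (l * y ^+ n * (l' * y ^+ n')^-1 = l * (y ^+ n * (y ^+ n')^-1) * l'^-1)%g.
  by rewrite invgM !mulgA.
apply: congr_mul => //; last exact: congr_refl.
apply: congr_mul => //; first exact: congr_refl.
rewrite expgnDr; apply: congr_mul => //; first exact: congr_refl.
apply: congr_sym => //; rewrite invgK -expgnDr -mulnS prednK ?expn_gt0 ?p_gt0 //.
by rewrite mulnC expgnA; apply: subgroupX; case: nW.
Qed.

Lemma adjoin_conj s g : adjoin g -> adjoin (s * g * s^-1)%g.
Proof.
move=> gL W Wn; have [_ nW] := Wn; have [l [n [Ll Wg]]] := gL W Wn.
exists (s * l * s^-1 * (s * y ^+ n * s^-1 * (y ^+ n)^-1))%g, n; split.
  by apply: subgroupM => //; [exact: normL | exact: conj_pow].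
have -> : (s * l * s^-1 * (s * y ^+ n * s^-1 * (y ^+ n)^-1) * y ^+ n =
    s * (l * y ^+ n) * s^-1)%g by rewrite !mulgA mulgVK mulgVK.
apply: congr_mul => //; last exact: congr_refl.
by apply: congr_mul => //; exact: congr_refl.
Qed.
End Adjoin.

(** * The p-adic exponent of y modulo L *)

Section PadicAbs.
Variables (p : nat) (F : topologicalFieldType) (abs : F -> rat).
Hypothesis p_prime : prime p.
Hypothesis abs_ge0 : forall x, 0 <= abs x /\ (abs x = 0 -> x = 0).
Hypothesis absM : forall x y, abs (x * y) = abs x * abs y.
Hypothesis absD : forall x y, abs (x + y) <= Num.max (abs x) (abs y).
Hypothesis abs_rat : forall q : rat, abs (ratr q) = padic_abs p q.
Local Notation eps e := ((p%:R^-1 : rat) ^+ e).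

Lemma eps_gt0 e : 0 < eps e.
Proof. by rewrite exprn_gt0 // invr_gt0 ltr0n prime_gt0. Qed.

Lemma eps_le m e : (m <= e)%N -> eps e <= eps m.
Proof.
move=> me; apply: ler_wiXn2l => //.
by rewrite invf_le1 ?ltr0n ?prime_gt0 // ler1n prime_gt0.
Qed.

Lemma eps_small (x : rat) : 0 < x -> exists e, eps e < x.
Proof.
move=> x0; pose i := Num.bound x^-1; exists i.
rewrite exprVn invf_plt ?posrE ?exprn_gt0 ?ltr0n ?prime_gt0 //.
apply: lt_le_trans (upper_nthrootP (leqnn i)) _.
by rewrite lerXn2r ?nnegrE ?ler0n // ler_nat prime_gt1.
Qed.

Lemma padic_abs_nat n : padic_abs p n.+1%:R = eps (logn p n.+1).
Proof.
rewrite /padic_abs pnatr_eq0 /=.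
have -> : (n.+1%:R : rat) = n.+1%:Z%:~R by [].
by rewrite denq_int numq_int /= logn1 sub0r -exprnN exprVn.
Qed.

Lemma abs_nat n : abs n.+1%:R = eps (logn p n.+1).
Proof. by rewrite -padic_abs_nat -abs_rat ratr_nat. Qed.

Lemma abs0 : abs 0 = 0.
Proof. by rewrite -[0 in LHS](ratr_nat F 0) abs_rat. Qed.

Lemma padic_char0 n : n.+1%:R != 0 :> F.
Proof.
apply/eqP => n0; have := abs_nat n; rewrite n0 abs0 => /eqP.
by rewrite lt_eqF // eps_gt0.
Qed.

Lemma abs_dvd n e : (p ^ e %| n)%N -> abs n%:R <= eps e.
Proof.
case: n => [|n] dvd; first by rewrite abs0 ltW ?eps_gt0.
by rewrite abs_nat; apply: eps_le; rewrite -pfactor_dvdn.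
Qed.

Lemma absN x : abs (- x) = abs x.
Proof.
have -> : abs (- x) = abs (-1) * abs x by rewrite -absM mulN1r.
suff -> : abs (-1) = 1 by rewrite mul1r.
have H : abs (-1) * abs (-1) = 1 by rewrite -absM mulrNN mulr1 (abs_nat 0) logn1.
have [h0 _] := abs_ge0 (-1).
have : abs (-1) ^+ 2 == 1 by rewrite expr2 H.
by rewrite sqrf_eq1 => /orP[/eqP//|/eqP E]; move: h0; rewrite E.
Qed.

Lemma absB x y e : abs x <= e -> abs y <= e -> abs (x - y) <= e.
Proof. by move=> hx hy; apply: le_trans (absD _ _) _; rewrite absN ge_max hx hy. Qed.

Lemma abs_sub_trans x y z e : abs (x - y) <= e -> abs (z - y) <= e -> abs (x - z) <= e.
Proof.
by move=> hx hy; have := absB hx hy; rewrite opprB addrA subrK.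
Qed.

Lemma abs_small_eq x y : (forall e, abs (x - y) <= eps e) -> x = y.
Proof.
move=> H; apply/eqP; rewrite -subr_eq0; apply/eqP; case: (abs_ge0 (x - y)) => h0; apply.
apply/eqP; rewrite eq_le h0 andbT leNgt; apply/negP => /eps_small [e].
by rewrite ltNge H.
Qed.

Lemma abs_sub_nat n m e : (p ^ e %| m - n)%N -> (p ^ e %| n - m)%N ->
  abs (n%:R - m%:R) <= eps e.
Proof.
case: (leqP m n) => [mn _|/ltnW nm] H; first by rewrite -natrB // abs_dvd.
by move=> _; rewrite -opprB absN -natrB // abs_dvd.
Qed.
End PadicAbs.

Section ZpCoordinate.
Variables (G : topologicalGroupType) (p : nat) (L : set G) (y : G).
Hypothesis G_hausdorff : hausdorff_space G.
Hypothesis base : forall A : set G, nbhs 1%g A -> exists2 W, open_normal W & W `<=` A.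
Hypothesis prime_powers : forall (W : set G) x, open_normal W ->
  exists e, W (x ^+ (p ^ e))%g.
Hypothesis p_prime : prime p.
Hypotheses (subL : is_subgroup L) (normL : forall s x, L x -> L (s * x * s^-1)%g).
Hypothesis closedL : closed L.
Hypothesis y_free : forall r, (0 < r)%N -> ~ L (y ^+ r)%g.

Lemma mod_normal_subgroup (W : set G) : is_normal W ->
  is_subgroup [set g | exists2 l, L l & W (l^-1 * g)%g].
Proof.
move=> nW; split; first by exists 1%g; [exact: subgroup1 | exact: congr_refl].
move=> g h [l Ll Wg] [l' Ll' Wh]; exists (l * l'^-1)%g.
  by apply: subgroupM => //; exact: subgroupV.
by apply: congr_mul => //; exact: congr_inv.
Qed.

(** For e > 0, closedness of [L] gives a [W] with y^(p^(e-1)) outside L W. If p^e did not divide n,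
    Bezout with a power of p that kills y modulo [W] would bring y^(p^b) into L W for some b < e,
    hence also y^(p^(e-1)). *)
Lemma exponent_mod e : exists2 W, open_normal W &
  forall n l, L l -> W (l^-1 * y ^+ n)%g -> (p ^ e %| n)%N.
Proof.
case: e => [|e]; first by exists setT => [|n l _ _]; [exact: open_normalT | rewrite dvd1n].
have nLe : ~ L (y ^+ (p ^ e))%g by apply: y_free; rewrite expn_gt0 prime_gt0.
have [W Wn WL] : exists2 W, open_normal W & forall l, L l -> ~ W (l^-1 * y ^+ (p ^ e))%g.
  apply: contrapT => H; apply: nLe; apply: (closed_approx base closedL) => W Wn.
  apply: contrapT => nl; apply: H; exists W => // l Ll Wl; apply: nl.
  by exists l.
exists W => // n l Ll Wl; apply: contrapT => ndvd.
have [_ nW] := Wn; have subK := mod_normal_subgroup nW.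
have [c Wc] := prime_powers y Wn.
have n0 : (0 < n)%N by case: n ndvd {Wl}.
have /(dvdn_pfactor _ _ p_prime) [b bc gE] : (gcdn n (p ^ c) %| p ^ c)%N by exact: dvdn_gcdr.
have be : (b <= e)%N.
  rewrite leqNgt; apply/negP => eb; apply: ndvd.
  by apply: dvdn_trans (dvdn_gcdl n (p ^ c)); rewrite gE dvdn_exp2l.
have Kb : [set g | exists2 l, L l & W (l^-1 * g)%g] (y ^+ (p ^ b))%g.
  have [km kn E _] := egcdnP (p ^ c) n0.
  have -> : (y ^+ (p ^ b) = (y ^+ (kn * p ^ c))^-1 * y ^+ (km * n))%g.
    by rewrite E gE expgnDr mulKg.
  apply: (subgroupM subK).
    apply: (subgroupV subK); rewrite mulnC expgnA; apply: (subgroupX subK).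
    by exists 1%g; [exact: subgroup1 | rewrite invg1 mul1g].
  by rewrite mulnC expgnA; apply: (subgroupX subK); exists l.
have := subgroupX subK (p ^ (e - b)) Kb.
by rewrite -expgnA -expnD subnKC // => -[l' /WL].
Qed.

(** If an element of [L] is close to y^n, then n is divisible by a high power of p, so y^n is close
    to 1. *)
Lemma base_meets_trivially s : L s -> adjoin [set 1%g] y s -> s = 1%g.
Proof.
move=> Ls Ys; have c1 : closed [set 1%g : G].
  by apply: accessible_closed_set1; exact: hausdorff_accessible.
apply/esym; suff : [set 1%g] s by [].
apply: (closed_approx base c1) => W Wn; exists 1%g => //; rewrite invg1 mul1g.
have [c Wc] := prime_powers y Wn; have [Wc' Wc'n H] := exponent_mod c.
have [_ [n [-> [Wy Wy']]]] := Ys _ (open_normalI Wn Wc'n).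
move: Wy Wy'; rewrite mul1g => Wy Wy'.
have [_ nW] := Wn; have [_ nW'] := Wc'n; have [subW _] := nW.
have /dvdnP [m nE] := H _ _ Ls (congr_sym nW' Wy').
have Wyn : W (y ^+ n)%g by rewrite nE mulnC expgnA; apply: subgroupX.
by have := subgroupM subW Wyn Wy; rewrite mulVKg.
Qed.

Lemma congr_exponents e (W : set G) : open_normal W ->
  (forall n l, L l -> W (l^-1 * y ^+ n)%g -> (p ^ e %| n)%N) ->
  forall g l l' n n', L l -> L l' -> W ((l * y ^+ n)^-1 * g)%g ->
    W ((l' * y ^+ n')^-1 * g)%g -> (p ^ e %| n' - n)%N.
Proof.
move=> [_ nW] WP g l l' n n' Ll Ll' W1 W2.
case: (leqP n' n) => [|/ltnW nn']; first by rewrite -subn_eq0 => /eqP ->.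
apply: (WP _ ((y ^+ n)^-1 * (l'^-1 * l) * ((y ^+ n)^-1)^-1)%g).
  by apply: normL; apply: subgroupM => //; exact: subgroupV.
have := congr_mul nW (congr_refl nW (l' * y ^+ n)^-1%g) (congr_trans nW W1 (congr_sym nW W2)).
by rewrite -[in (y ^+ n')%g](subnKC nn') expgnDr !invgM !invgK -!mulgA !mulKg.
Qed.

(** Intersecting the subgroups of [exponent_mod] makes them decreasing, so successive approximate
    exponents form a p-adic Cauchy sequence. *)
Lemma exponent_filtration : exists U : nat -> set G, forall e, [/\ open_normal (U e),
  (forall m, (m <= e)%N -> U e `<=` U m) &
  forall g l l' n n', L l -> L l' -> U e ((l * y ^+ n)^-1 * g)%g ->
    U e ((l' * y ^+ n')^-1 * g)%g -> (p ^ e %| n' - n)%N].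
Proof.
have /choice[W WP] e : exists W, open_normal W /\
    forall n l, L l -> W (l^-1 * y ^+ n)%g -> (p ^ e %| n)%N.
  by have [W ? ?] := exponent_mod e; exists W.
pose fix U e := if e is e'.+1 then U e' `&` W e'.+1 else W 0.
have UW e : open_normal (U e) /\ U e `<=` W e.
  elim: e => [|e [IH _]]; first by split=> //; case: (WP 0).
  by split=> [|g []//]; apply: open_normalI => //; case: (WP e.+1).
exists U => e; have [Un UWe] := UW e; split=> // [m|].
  elim: e {Un UWe} => [|e IH]; first by rewrite leqn0 => /eqP ->.
  rewrite leq_eqVlt => /orP[/eqP -> //|me] g [Ug _]; exact: IH Ug.
by apply: congr_exponents => // n l Ll /UWe; have [_] := WP e; apply.
Qed.

Variable F : topologicalFieldType.

(* On [adjoin L y] the exponent of y modulo [L] extends to a continuous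
   homomorphism to Q_p, by completeness of Q_p. *)
Lemma padic_coordinate : is_Qp p F -> exists a : G -> F,
  [/\ forall g h, adjoin L y g -> adjoin L y h -> a (g * h)%g = a g + a h,
      forall l n, L l -> a (l * y ^+ n)%g = n%:R &
      {within adjoin L y, continuous a}].
Proof.
move=> [abs [abs_ge0 absM absD abs_rat [nbhsF _ complete]]].
pose eps e : rat := p%:R^-1 ^+ e.
have [U UP] := exponent_filtration.
pose approx g e n := exists2 l, L l & U e ((l * y ^+ n)^-1 * g)%g.
have approx_eq g e n n' : approx g e n -> approx g e n' -> abs (n%:R - n'%:R) <= eps e.
  move=> [l Ll Ul] [l' Ll' Ul']; have [_ _ H] := UP e.
  by apply: (abs_sub_nat p_prime) => //; [exact: H Ll Ll' Ul Ul' | exact: H Ll' Ll Ul' Ul].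
have approx_le g e m n : (m <= e)%N -> approx g e n -> approx g m n.
  by move=> me [l Ll Ul]; exists l => //; have [_ H _] := UP e; exact: H Ul.
have /choice[u uP] g : exists u : nat -> nat, adjoin L y g -> forall e, approx g e (u e).
  have [gL|ngL] := pselect (adjoin L y g); last by exists (fun=> 0%N).
  have /choice[u uP] e : exists n, approx g e n.
    by have [Un _ _] := UP e; have [l [n [Ll Ug]]] := gL _ Un; exists n, l.
  by exists u.
have /choice[a aP] g : exists x : F, adjoin L y g -> (fun n => (u g n)%:R : F) @ \oo --> x.
  have [gL|ngL] := pselect (adjoin L y g); last by exists 0.
  suff [x ux] : exists x : F, (fun n => (u g n)%:R : F) @ \oo --> x by exists x.
  apply: complete => e0 /(eps_small p_prime) [e ee0]; exists e => m n em en.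
  apply: le_lt_trans ee0; apply: (@approx_eq g); last exact: approx_le en (uP _ gL n).
  exact: approx_le em (uP _ gL m).
have aE g e n : adjoin L y g -> approx g e n -> abs (a g - n%:R) <= eps e.
  move=> gL gn; have : nbhs (a g) [set z | abs (z - a g) < eps e].
    by apply/nbhsF; exists (eps e) => //; exact: eps_gt0.
  move=> /(aP g gL) [N _ HN]; have /= := HN (maxn N e) (leq_maxl _ _).
  set m := maxn N e => Hm.
  apply: (abs_sub_trans abs_ge0 absM absD abs_rat (y := (u g m)%:R)).
    by rewrite -opprB (absN abs_ge0 absM abs_rat) ltW.
  apply: (approx_eq g) => //; apply: approx_le (uP _ gL m); exact: leq_maxr.
have subL' := adjoin_subgroup y prime_powers (prime_gt0 p_prime) subL normL.
exists a; split.
- move=> g h gL hL; apply: (abs_small_eq p_prime abs_ge0) => e.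
  have [l Ll Ug] := uP g gL e; have [l' Ll' Uh] := uP h hL e.
  have [[_ nU] _ _] := UP e.
  have gh : approx (g * h)%g e (u g e + u h e).
    exists (l * (y ^+ u g e * l' * (y ^+ u g e)^-1))%g.
      by apply: subgroupM => //; exact: normL.
    by have := congr_mul nU Ug Uh; rewrite expgnDr !mulgA mulgVK -!mulgA.
  apply: (abs_sub_trans abs_ge0 absM absD abs_rat (y := (u g e + u h e)%:R)).
    by apply: aE gh; apply: (subgroupM subL').
  rewrite natrD opprD addrACA; apply: le_trans (absD _ _) _.
  by rewrite ge_max !aE //; apply: uP.
- move=> l n Ll; apply: (abs_small_eq p_prime abs_ge0) => e.
  apply: aE; first exact: adjoin_pow.
  by exists l => //; apply: congr_refl; have [[_ nU] _ _] := UP e.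
- apply/subspace_continuousP => g gL A /nbhsF [e0 /(eps_small p_prime) [e ee0] eA].
  have [Un _ _] := UP e; have [_ nU] := Un.
  have H := open_normal_nbhs g Un.
  change (\forall h \near g, adjoin L y h -> A (a h)).
  apply: filterS H => h Uh hL; apply: eA => /=; apply: le_lt_trans ee0.
  have [l Ll Ug] := uP g gL e.
  apply: (abs_sub_trans abs_ge0 absM absD abs_rat (y := (u g e)%:R)).
    by apply: aE => //; exists l => //; exact: (congr_trans nU Ug).
  by apply: aE => //; exists l.
Qed.
End ZpCoordinate.

(** * Adjoining one element to a closed normal subgroup *)

(** Continuity is phrased with closed sets because maps from compact to Hausdorff spaces are closed,
    which lets it be transported without continuous inverses. *)
Lemma within_closedP (S T : topologicalType) (A : set S) (f : S -> T) : closed A ->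
  {within A, continuous f} <-> (forall Z, closed Z -> closed (A `&` f @^-1` Z)).
Proof.
move=> cA; split.
  move=> /continuous_closedP H Z /H /closed_subspaceP [V cV VA].
  by rewrite setIC -VA; apply: closedI.
move=> H; apply/continuous_closedP => Z cZ; apply/closed_subspaceP.
by exists (A `&` f @^-1` Z); [exact: H | rewrite setIAC setIid setIC].
Qed.

Section RegularFunctions.
Variables (G : topologicalGroupType) (k : topologicalFieldType).
Implicit Types (N : set G) (phi psi : G -> k).

Definition regular N phi := (exists d, polyf N d phi) /\ {within N, continuous phi}.

Lemma within_eq N phi psi : closed N -> (forall x, N x -> phi x = psi x) ->
  {within N, continuous phi} -> {within N, continuous psi}.
Proof.
move=> cN E /(within_closedP _ cN) H; apply/within_closedP => // Z cZ.
rewrite (_ : _ `&` _ = N `&` phi @^-1` Z); first exact: H.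
by apply/seteqP; split=> x [Nx]; rewrite /= E.
Qed.

Section Subgroup.
Variables (N : set G) (subN : is_subgroup N).

Lemma regular_const (a : k) : regular N (fun=> a).
Proof.
split; first by exists 1%N; apply: polyf_const.
exact: (@continuous_ext_const k (subspace N) a).
Qed.

Lemma regular_add phi psi : regular N phi -> regular N psi ->
  regular N (fun x => phi x + psi x).
Proof.
move=> [[d Hd] cp] [[e He] cq]; split; last exact: continuous_fieldD cp cq.
exists (maxn d e); apply: polyf_add => //.
  by apply: polyfW Hd => //; exact: leq_maxl.
by apply: polyfW He => //; exact: leq_maxr.
Qed.

Lemma regular_mul phi psi : regular N phi -> regular N psi ->
  regular N (fun x => phi x * psi x).
Proof.
move=> [[d Hd] cp] [[e He] cq]; split; last exact: continuous_fieldM cp cq.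
by exists (d + e)%N; apply: polyf_mul.
Qed.

Lemma regular_sum (I : finType) (phi : I -> G -> k) : (forall i, regular N (phi i)) ->
  regular N (fun x => \sum_i phi i x).
Proof.
move=> R; elim: (index_enum I) => [|i s IH].
  rewrite (_ : (fun _ => _) = fun=> 0); first exact: regular_const.
  by apply/funext => x; rewrite big_nil.
rewrite (_ : (fun _ => _) = fun x => phi i x + \sum_(i <- s) phi i x).
  exact: regular_add.
by apply/funext => x; rewrite big_cons.
Qed.

Lemma regular_horner (P : {poly k}) phi : regular N phi -> regular N (fun x => P.[phi x]).
Proof.
move=> Rphi; elim/poly_ind: P => [|P c IH].
  rewrite (_ : (fun _ => _) = fun=> 0); first exact: regular_const.
  by apply/funext => x; rewrite horner0.
rewrite (_ : (fun _ => _) = fun x => P.[phi x] * phi x + c).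
  by apply: regular_add (regular_const c); apply: regular_mul.
by apply/funext => x; rewrite hornerMXaddC.
Qed.

Lemma within_rtransl h phi : closed N -> N h -> {within N, continuous phi} ->
  {within N, continuous (fun x => phi (x * h)%g)}.
Proof.
move=> cN Nh /(within_closedP _ cN) H; apply/within_closedP => // Z cZ.
rewrite (_ : _ `&` _ = (fun x => x * h)%g @^-1` (N `&` phi @^-1` Z)).
  by apply: preimage_closed (H _ cZ) => x _; exact: continuous_rmul.
apply/seteqP; split=> x [Nx Zx]; split=> //; first exact: subgroupM.
by have := subgroupM subN Nx (subgroupV subN Nh); rewrite mulgK.
Qed.

Lemma within_rdiff j h phi : closed N -> N h -> {within N, continuous phi} ->
  {within N, continuous (iter j (rdiff h) phi)}.
Proof.
move=> cN Nh cphi; elim: j => //= j IH.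
have H := continuous_fieldM (continuous_ext_const (a := -1) (fun=> erefl)) IH.
have := continuous_fieldD (within_rtransl cN Nh IH) H; apply: within_eq => // x Nx.
by rewrite mulN1r.
Qed.
End Subgroup.

Lemma regular_sub N N' phi : N `<=` N' -> regular N' phi -> regular N phi.
Proof.
move=> NN' [[d Hd] cp]; split; last exact: continuous_subspaceW cp.
by exists d; apply: polyf_sub_group Hd.
Qed.

Definition extendable (H L : set G) := forall phi, regular H phi ->
  exists psi, regular L psi /\ forall x, H x -> psi x = phi x.

(* The functions on L vanishing on H form the ideal generated by the functions
   on L/H vanishing at the base point. *)
Definition generated_ideal (H L : set G) := forall F, regular L F ->
  (forall x, H x -> F x = 0) -> exists (I : finType) (B C : I -> G -> k),
  (forall i, [/\ regular L (B i), regular L (C i), C i 1%g = 0 &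
     forall x h, L x -> H h -> C i (x * h)%g = C i x]) /\
  forall x, L x -> F x = \sum_i B i x * C i x.
End RegularFunctions.

Section Step.
Variables (G : topologicalGroupType) (p c : nat).
Hypothesis G_hausdorff : hausdorff_space G.
Hypothesis G_compact : compact [set: G].
Hypothesis base : forall A : set G, nbhs 1%g A -> exists2 W, open_normal W & W `<=` A.
Hypothesis prime_powers : forall (W : set G) x, open_normal W ->
  exists e, W (x ^+ (p ^ e))%g.
Hypothesis p_prime : prime p.
Hypothesis c_gt0 : (0 < c)%N.
Hypothesis gam_c : forall g : G, lower_central c g -> g = 1%g.
Variables (Qp k : topologicalFieldType) (HQp : is_Qp p Qp).
Hypothesis k_hausdorff : hausdorff_space k.
Variable j : {rmorphism Qp -> k}.
Hypothesis j_continuous : continuous j.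
Hypothesis char0 : forall n, n.+1%:R != 0 :> k.
Variables (L : set G) (y : G).
Hypotheses (subL : is_subgroup L) (normL : forall s x, L x -> L (s * x * s^-1)%g).
Hypothesis closedL : closed L.
Variable H : set G.
Hypothesis HL : H `<=` L.
Hypothesis normH : forall s x, H x -> H (s * x * s^-1)%g.
Local Notation L' := (adjoin L y).
Implicit Type phi : G -> k.

Let p_gt0 : (0 < p)%N. Proof. exact: prime_gt0. Qed.
Let subL' : is_subgroup L'.
Proof. exact: (adjoin_subgroup y prime_powers p_gt0 subL normL). Qed.
Let closedL' : closed L'. Proof. exact: adjoin_closed. Qed.
Let LL' : L `<=` L'. Proof. by move=> x; exact: adjoin_base. Qed.
Let L'y : L' y. Proof. exact: adjoin_elt. Qed.

Lemma adjoin_eq phi psi : {within L', continuous phi} -> {within L', continuous psi} ->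
  (forall l n, L l -> phi (l * y ^+ n)%g = psi (l * y ^+ n)%g) ->
  forall x, L' x -> phi x = psi x.
Proof.
move=> cp cq E x L'x; apply/eqP; rewrite -subr_eq0; apply/eqP.
have cm : {within L', continuous (fun x => -1 * psi x)}.
  by apply: continuous_fieldM cq; apply: continuous_ext_const.
have /(within_closedP _ closedL') cl := continuous_fieldD cp cm.
have {}cl : closed (L' `&` (fun x => phi x + -1 * psi x) @^-1` [set 0]).
  by apply: cl; apply: accessible_closed_set1; exact: hausdorff_accessible.
suff /(_ x L'x) [_ /=] : L' `<=` L' `&` (fun x => phi x + -1 * psi x) @^-1` [set 0].
  by rewrite mulN1r.
apply: (adjoin_smallest base) => // l n Ll.
by split; [exact: adjoin_pow | rewrite /= E // mulN1r subrr].
Qed.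

Section InfiniteOrder.
Hypothesis y_free : forall r, (0 < r)%N -> ~ L (y ^+ r)%g.
Local Notation Y := (adjoin [set 1%g] y).

Let normL1 s x : [set 1%g : G] x -> [set 1%g : G] (s * x * s^-1)%g.
Proof. by move=> ->; rewrite mulg1 mulgV. Qed.
Let subL1 : is_subgroup [set 1%g : G].
Proof. by split=> // _ _ -> ->; rewrite mulgV. Qed.
Let subY : is_subgroup Y.
Proof. exact: (adjoin_subgroup y prime_powers p_gt0 subL1 normL1). Qed.
Let closedY : closed Y. Proof. exact: adjoin_closed. Qed.
Let LY1 x : L x -> Y x -> x = 1%g.
Proof. exact: (base_meets_trivially G_hausdorff base prime_powers p_prime subL closedL y_free). Qed.
Let YX n : Y (y ^+ n)%g. Proof. by rewrite -[(y ^+ n)%g]mul1g; exact: adjoin_pow. Qed.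

Lemma mul_set_closed (K K' : set G) : closed K -> closed K' -> closed (mul_set K K').
Proof.
move=> cK cK'; apply: compact_closed => //.
rewrite (_ : mul_set K K' = (fun z : G * G => (z.1 * z.2)%g) @` (K `*` K')).
  apply: continuous_compact.
    by apply: continuous_subspaceT; exact: gmul_continuous.
  by apply: compact_setX; apply: (subclosed_compact _ G_compact).
apply/seteqP; split=> x; first by move=> [l [s [Kl Ks ->]]]; exists (l, s).
by move=> [[l s] [Kl Ks] <-]; exists l, s.
Qed.

Let L'E : L' = mul_set L Y.
Proof.
apply/seteqP; split.
  apply: (adjoin_smallest base) (mul_set_closed closedL closedY) _ => l n Ll.
  by exists l, (y ^+ n)%g.
move=> _ [l [s [Ll Ys ->]]]; apply: (subgroupM subL'); first exact: LL'.
apply: (adjoin_smallest base) closedL' _ s Ys => _ n ->.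
by apply: adjoin_pow; exact: subgroup1.
Qed.

Local Notation ext := (split_ext L Y).

Let extE phi l s : L l -> Y s -> ext phi (l * s)%g = phi l.
Proof. exact: split_extE. Qed.

(** For continuity: the preimage of a closed set is the product of a closed subset of [L] with [Y],
    closed by compactness. *)
Lemma split_ext_regular phi : regular L phi -> regular L' (ext phi).
Proof.
move=> [[d Hd] /(within_closedP _ closedL) cp]; split.
  by exists (c * d)%N; rewrite L'E; apply: split_ext_polyf.
apply/within_closedP => // Z cZ.
rewrite (_ : _ `&` _ = mul_set (L `&` phi @^-1` Z) Y).
  by apply: mul_set_closed => //; exact: cp.
apply/seteqP; split=> x.
  rewrite {1}L'E => -[[l [s [Ll Ys ->]]]]; rewrite /= extE // => Zl.
  by exists l, s.
move=> [l [s [[Ll Zl] Ys ->]]]; split; first by rewrite L'E; exists l, s.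
by rewrite /= extE.
Qed.

Lemma split_ext_base phi x : L x -> ext phi x = phi x.
Proof. by move=> Lx; have := extE phi Lx (subgroup1 subY); rewrite mulg1. Qed.

Lemma infinite_extendable : extendable k H L -> extendable k H L'.
Proof.
move=> EL phi /EL [psi [Rpsi psiE]]; exists (ext psi); split.
  exact: split_ext_regular.
by move=> x Hx; rewrite split_ext_base ?psiE //; apply: HL.
Qed.

(** In the expansion along y, the binomial factors with i > 0 vanish at 1 and are constant on cosets
    of [H], because [a] is additive and zero on [L]. The term i = 0 extends the restriction of F to
    [L], where the hypothesis applies. *)
Lemma infinite_generated_ideal : generated_ideal k H L -> generated_ideal k H L'.
Proof.
move=> IL F [[d Hd] cF] F0.
have [a [aD aX ac]] := padic_coordinate base prime_powers p_prime subL normL closedL y_free HQp.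
have LF : regular L F by apply: (regular_sub LL'); split=> //; exists d.
have [I [B [C [BCP FE]]]] := IL F LF F0.
pose a' x := j (a x).
have Ra : regular L' a'.
  split; last by move=> x; apply: (continuous_comp (ac x)); exact: j_continuous.
  exists 2%N => g Lg h Lh x Lx; have Lhx := subgroupM subL' Lh Lx.
  by rewrite /ldiff /a' (aD g _ Lg Lhx) (aD g x Lg Lx) !rmorphD /= !addrK subrr.
have a1 h : L h -> a' h = 0.
  by move=> Lh; rewrite /a' -[h]mulg1 -(expg0 y) aX // rmorph0.
pose D i := ext (iter i (rdiff y) F).
pose P i x := (bin_poly k i).[a' x].
have RD i : regular L' (D i).
  apply: split_ext_regular; apply: (regular_sub LL'); split.
    by exists (d - i)%N; apply: iter_rdiff_polyf.
  exact: within_rdiff.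
have RP i : regular L' (P i) by exact: regular_horner.
(* The range is [d.+1] so that the term i = 0 can be split off even for [d = 0]. *)
have FDP x : L' x -> F x = \sum_(i < d.+1) P i x * D i x.
  apply: (@adjoin_eq F (fun x => \sum_(i < d.+1) P i x * D i x)) => //.
    apply: (@continuous_field_sum k (subspace L') 'I_d.+1 _ (fun i x => P i x * D i x)) => i.
    by have [_] := regular_mul subL' (RP i) (RD i).
  move=> l n Ll; have Hd' := polyfS subL' Hd.
  rewrite -(rpowE char0 subL' n L'y (LL' Ll) Hd'); apply: eq_bigr => i _.
  by rewrite /P /D extE // /a' aX // rmorph_nat.
pose B' (i : I + 'I_d) := match i with inl i => ext (B i) | inr i => D i.+1 end.
pose C' (i : I + 'I_d) := match i with inl i => ext (C i) | inr i => P i.+1 end.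
exists (I + 'I_d)%type, B', C'; split.
  have extJ phi (l s h : G) : L l -> Y s -> H h -> ext phi (l * s * h)%g = phi (l * (s * h * s^-1))%g.
    move=> Ll Ys Hh; have -> : (l * s * h = l * (s * h * s^-1) * s)%g.
      by rewrite !mulgA mulgVK.
    by apply: extE => //; apply: subgroupM => //; apply: HL; apply: normH.
  case=> i; rewrite /B' /C'; last first.
    split=> //; first by rewrite /P a1 ?bin_polyS_root0 //; exact: subgroup1.
    move=> x h Lx Hh; rewrite /P /a' aD //; last by apply: LL'; apply: HL.
    by rewrite rmorphD -/(a' h) a1 ?addr0 //; apply: HL.
  have [RB RC C1 CH] := BCP i; split; [exact: split_ext_regular|exact: split_ext_regular| |].
    by rewrite split_ext_base //; exact: subgroup1.
  move=> x h; rewrite L'E => -[l [s [Ll Ys ->]]] Hh.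
  by rewrite extJ // extE // CH //; apply: normH.
move=> x L'x; rewrite FDP // big_ord_recl /= {1}/P hornerC mul1r.
rewrite big_sumType /=; congr (_ + _); last first.
  by apply: eq_bigr => i _; rewrite mulrC.
move: L'x; rewrite L'E => -[l [s [Ll Ys ->]]].
by rewrite /D extE //= FE //; apply: eq_bigr => i _; rewrite !extE.
Qed.
End InfiniteOrder.

Section FiniteOrder.
Variable r : nat.
Hypotheses (r_gt0 : (0 < r)%N) (Lyr : L (y ^+ r)%g).

Let coset i : set G := [set g | L (g * (y ^+ i)^-1)%g].

Let coset_closed i : closed (coset i).
Proof. by apply: preimage_closed closedL => x _; exact: continuous_rmul. Qed.

Let coset_mod l n : L l -> coset (n %% r) (l * y ^+ n)%g.
Proof.
move=> Ll; rewrite /coset /= [in (y ^+ n)%g](divn_eq n r) expgnDr mulgA mulgK.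
by apply: subgroupM => //; rewrite mulnC expgnA; apply: subgroupX.
Qed.

Let cosets m : set G := [set g | exists2 i, (i < m)%N & coset i g].

Let cosets0 : cosets 0 = set0.
Proof. by apply/seteqP; split=> x // -[]. Qed.

Let cosetsS m : cosets m.+1 = cosets m `|` coset m.
Proof.
apply/seteqP; split=> x.
  move=> [i]; rewrite ltnS leq_eqVlt => /orP[/eqP -> | im] ci; first by right.
  by left; exists i.
by move=> [[i im ci]|cm]; [exists i => //; exact: ltnW | exists m].
Qed.

Let cosets_closed m : closed (cosets m).
Proof.
elim: m => [|m IH]; first by rewrite cosets0; exact: closed0.
by rewrite cosetsS; apply: closedU.
Qed.

Let L'E : L' = fin_ext_set L y.
Proof.
apply/seteqP; split; last by move=> _ [l [n [Ll ->]]]; exact: adjoin_pow.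
have cosetsE : cosets r `<=` fin_ext_set L y.
  by move=> x [i _ Lx]; exists (x * (y ^+ i)^-1)%g, i; rewrite mulgVK.
apply: subset_trans cosetsE; apply: (adjoin_smallest base) => // l n Ll.
by exists (n %% r)%N; [rewrite ltn_mod | exact: coset_mod].
Qed.

Let L'cosets : L' = cosets r.
Proof.
apply/seteqP; split; last first.
  by move=> x [i _ Lx]; rewrite L'E; exists (x * (y ^+ i)^-1)%g, i; rewrite mulgVK.
rewrite L'E => _ [l [n [Ll ->]]].
by exists (n %% r)%N; [rewrite ltn_mod | exact: coset_mod].
Qed.

Lemma fin_ext_exists phi : regular L phi ->
  exists psi, regular L' psi /\ forall x, L x -> psi x = phi x.
Proof.
move=> [[d Hd] cp]; pose psi := fin_ext L r y d phi.
have psiE l n : L l -> psi (l * y ^+ n)%g = rpow d (y ^+ r)%g (n%:R / r%:R) phi l.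
  exact: (fin_extE char0 subL r_gt0 Lyr n (leqnn d) Hd).
have Ppsi : polyf L' d psi.
  by rewrite L'E; apply: (fin_ext_polyf char0 subL normL c_gt0 gam_c r_gt0 Lyr (leqnn d) Hd).
exists psi; split; last first.
  by move=> x Lx; exact: (fin_ext_id char0 subL r_gt0 Lyr (leqnn d) Hd).
split; first by exists d.
(* [L'] is a finite union of closed cosets L y^m; on each, [psi] is a right translate of a
   continuous [rpow], and continuity is glued along this closed cover. *)
suff cm m : {within cosets m, continuous psi} by rewrite L'cosets.
elim: m => [|m IH].
  by rewrite cosets0; apply/subspace_continuousP => x [].
rewrite cosetsS; apply: withinU_continuous => //.
have /(within_closedP _ closedL) cR : {within L, continuous
    (rpow d (y ^+ r)%g (m%:R / r%:R) phi)}.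
  apply: (@continuous_field_sum k (subspace L) 'I_d _
    (fun i x => (bin_poly k i).[m%:R / r%:R] * iter i (rdiff (y ^+ r)%g) phi x)) => i.
  have := within_rdiff subL (j := i) closedL Lyr cp; apply: continuous_fieldM.
  by apply: continuous_ext_const.
apply/within_closedP => // Z cZ.
rewrite (_ : _ `&` _ = (fun x => x * (y ^+ m)^-1)%g @^-1`
    (L `&` rpow d (y ^+ r)%g (m%:R / r%:R) phi @^-1` Z)).
  by apply: preimage_closed (cR _ cZ) => x _; exact: continuous_rmul.
by apply/seteqP; split=> x [Lx]; rewrite /= -psiE // mulgVK.
Qed.

Lemma fin_unique phi psi : regular L' phi -> regular L' psi ->
  (forall x, L x -> phi x = psi x) -> forall x, L' x -> phi x = psi x.
Proof.
move=> [[d Hd] _] [[e He] _] E x L'x; apply/eqP; rewrite -subr_eq0; apply/eqP.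
have Hm : polyf L' (maxn d e) (fun x => phi x - psi x).
  apply: polyf_sub => //.
    by apply: polyfW Hd => //; exact: leq_maxl.
  by apply: polyfW He => //; exact: leq_maxr.
move: L'x Hm; rewrite L'E => L'x Hm.
apply: (fin_ext_unique char0 subL normL r_gt0 Lyr Hm) L'x => z Lz.
by rewrite E ?subrr.
Qed.

Lemma finite_extendable : extendable k H L -> extendable k H L'.
Proof.
move=> EL phi /EL [psi [/fin_ext_exists [psi' [R' E']] E]]; exists psi'; split=> // x Hx.
by rewrite E' ?E //; apply: HL.
Qed.

(** The functions [B i] and [C i] are extended to [L']; invariance and the formula for F persist
    because a regular function on [L'] is determined by its restriction to [L]. *)
Lemma finite_generated_ideal : generated_ideal k H L -> generated_ideal k H L'.
Proof.
move=> IL F RF F0; have [I [B [C [BCP FE]]]] := IL F (regular_sub LL' RF) F0.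
have /choice[B' B'P] i : exists psi, regular L' psi /\ forall x, L x -> psi x = B i x.
  by apply: fin_ext_exists; case: (BCP i).
have /choice[C' C'P] i : exists psi, regular L' psi /\ forall x, L x -> psi x = C i x.
  by apply: fin_ext_exists; case: (BCP i).
have RB' i : regular L' (B' i) by case: (B'P i).
have RC' i : regular L' (C' i) by case: (C'P i).
have rtr h (psi : G -> k) : L' h -> regular L' psi -> regular L' (fun x => psi (x * h)%g).
  move=> L'h [[d Hd] cp]; split; last exact: within_rtransl.
  by exists d; apply: polyf_rtransl.
exists I, B', C'; split=> [i|].
  have [_ _ C1 CH] := BCP i; have [_ C'E] := C'P i; split=> //.
    by rewrite C'E //; exact: subgroup1.
  move=> x h L'x Hh; have Lh := HL Hh.
  have E z : L z -> C' i (z * h)%g = C' i z.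
    by move=> Lz; rewrite !C'E ?CH //; exact: subgroupM.
  have Rh := rtr _ _ (LL' Lh) (RC' i).
  have := fin_unique Rh (RC' i) E. exact.
apply: fin_unique => // [|x Lx]; last first.
  by rewrite FE //; apply: eq_bigr => i _; rewrite (B'P i).2 ?(C'P i).2.
by apply: regular_sum => // i; apply: regular_mul.
Qed.
End FiniteOrder.

Lemma adjoin_step : extendable k H L /\ generated_ideal k H L ->
  extendable k H L' /\ generated_ideal k H L'.
Proof.
move=> [EL IL]; have [[r [r0 Lyr]]|nr] := pselect (exists r, (0 < r)%N /\ L (y ^+ r)%g).
  by split; [exact: (finite_extendable r0 Lyr) | exact: (finite_generated_ideal r0 Lyr)].
have y_free r : (0 < r)%N -> ~ L (y ^+ r)%g by move=> r0 Lyr; apply: nr; exists r.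
by split; [exact: infinite_extendable | exact: infinite_generated_ideal].
Qed.
End Step.

(** * Polynomial functions and exact sequences *)

Lemma dense_closed_setT (T : topologicalType) (D A : set T) : dense D -> closed A ->
  D `<=` A -> forall x, A x.
Proof.
move=> dD cA DA x; apply: contrapT => nAx.
have [z [nAz Dz]] := dD (~` A) (ex_intro _ x nAx) (closed_openC cA).
by apply: nAz; apply: DA.
Qed.

(** * Climbing to the whole group *)

Section Chain.
Variables (G : topologicalGroupType) (p c : nat).
Hypothesis G_hausdorff : hausdorff_space G.
Hypothesis G_compact : compact [set: G].
Hypothesis base : forall A : set G, nbhs 1%g A -> exists2 W, open_normal W & W `<=` A.
Hypothesis prime_powers : forall (W : set G) x, open_normal W ->
  exists e, W (x ^+ (p ^ e))%g.
Hypothesis p_prime : prime p.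
Hypothesis c_gt0 : (0 < c)%N.
Hypothesis gam_c : forall g : G, lower_central c g -> g = 1%g.
Variables (Qp k : topologicalFieldType) (HQp : is_Qp p Qp).
Hypothesis k_hausdorff : hausdorff_space k.
Variable j : {rmorphism Qp -> k}.
Hypothesis j_continuous : continuous j.
Hypothesis char0 : forall n, n.+1%:R != 0 :> k.
Variables (n : nat) (s : 'I_n -> G).
Hypothesis s_dense : dense (subgroup_generated (range s)).
Variable H : set G.
Hypothesis subH : is_subgroup H.
Hypothesis normH : forall s x, H x -> H (s * x * s^-1)%g.
Hypothesis closedH : closed H.

Definition closed_normal (L : set G) :=
  [/\ is_subgroup L, forall s x, L x -> L (s * x * s^-1)%g & closed L].

(** The elements commuting with [y] modulo [L] form a closed subgroup containing the topological
    generators. *)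
Lemma central_of_generators (L : set G) y : closed_normal L ->
  (forall i, L (commg y (s i))) -> forall g, L (g * y * g^-1 * y^-1)%g.
Proof.
move=> [subL normL cL] Ls.
pose C : set G := [set g | L (g * y * g^-1 * y^-1)%g].
have subC : is_subgroup C.
  have CM g h : C g -> C h -> C (g * h)%g.
    rewrite /C /= => Cg Ch; have := subgroupM subL (normL g _ Ch) Cg.
    by rewrite invgM -!mulgA !mulKg.
  have CV g : C g -> C (g^-1)%g.
    move=> /(subgroupV subL) /(normL g^-1%g); rewrite /C /= !invgM !invgK.
    by rewrite !mulgA mulgVK.
  split=> [|g h Cg Ch]; last by apply: CM => //; exact: CV.
  by rewrite /C /= mul1g invg1 mulg1 mulgV; exact: (subgroup1 subL).
have cC : closed C.
  apply: (@preimage_closed _ _ (fun g => g * y * g^-1 * y^-1)%g _ _ cL) => g _.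
  apply: (@continuous_comp _ _ _ (fun g => g * y * g^-1)%g (fun x => x * y^-1)%g).
    apply: (@continuous_comp _ (G * G)%type G (fun g => (g * y, g^-1))%g
      (fun z => z.1 * z.2)%g); last exact: gmul_continuous.
    by apply: cvg_pair; [exact: continuous_rmul | exact: ginv_continuous].
  exact: continuous_rmul.
move=> g; apply: (dense_closed_setT s_dense cC _ g); apply: gen_smallest => // _ [i _ <-].
rewrite -[s i]invgK; apply: (subgroupV subC).
have := normL y _ (Ls i); rewrite /C /= commgEl conjgE invgK.
by rewrite -!mulgA mulVKg.
Qed.

Definition good L := [/\ closed_normal L, H `<=` L &
  extendable k H L /\ generated_ideal k H L].

Lemma good_base : good H.
Proof.
split=> //; split; first by move=> phi Rphi; exists phi.
move=> F _ F0; exists void, (fun _ _ => 0), (fun _ _ => 0); split=> [[]|x Hx].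
by rewrite F0 // big_pred0 // => -[].
Qed.

Lemma good_adjoin L y : good L -> (forall i, L (commg y (s i))) -> good (adjoin L y).
Proof.
move=> [cnL HL PL] Ls; have yc := central_of_generators cnL Ls.
have [subL normL cL] := cnL; have p_gt0 := prime_gt0 p_prime.
split; first split.
- exact: (adjoin_subgroup y prime_powers p_gt0 subL normL).
- by move=> g x; apply: adjoin_conj.
- exact: adjoin_closed.
- by move=> x /HL; exact: adjoin_base.
- exact: (adjoin_step G_hausdorff G_compact base prime_powers p_prime c_gt0 gam_c HQp
    k_hausdorff j_continuous char0 y subL normL cL HL normH PL).
Qed.

Lemma good_adjoin_seq (t : seq G) L : good L ->
  (forall y i, y \in t -> L (commg y (s i))) ->
  exists L', [/\ good L', L `<=` L' & forall y, y \in t -> L' y].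
Proof.
elim: t L => [|y t IH] L gL Lt; first by exists L; split.
have gM : good (adjoin L y) by apply: good_adjoin => // i; apply: Lt; rewrite mem_head.
have LM : L `<=` adjoin L y by move=> x; exact: adjoin_base.
have [|L' [gL' ML' tL']] := IH _ gM.
  by move=> z i zt; apply: LM; apply: Lt; rewrite inE zt orbT.
exists L'; split=> //; first exact: subset_trans ML'.
move=> z; rewrite inE => /orP[/eqP ->|]; last exact: tL'.
by apply: ML'; apply: adjoin_elt; have [[subL _ _] _ _] := gL.
Qed.

Fixpoint left_commutators m : seq G :=
  if m is m'.+1 then [seq commg w (s i) | w <- left_commutators m', i <- enum 'I_n]
  else [seq s i | i <- enum 'I_n].

Lemma left_commutators_lower m x : x \in left_commutators m -> lower_central m x.
Proof.
elim: m x => [//|m IH] x /allpairsP [[w i] /= [wm _ ->]].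
by apply: lower_central_commg; exact: IH.
Qed.

Lemma good_setT : good [set: G].
Proof.
have E m : (m <= c)%N ->
    exists L, good L /\ forall x, x \in left_commutators (c - m) -> L x.
  elim: m => [_|m IH mc].
    exists H; split; first exact: good_base.
    (* Commutators of c + 1 generators are trivial, so [H] contains them from the start. *)
    move=> x; rewrite subn0 => /left_commutators_lower /gam_c ->; exact: (subgroup1 subH).
  have [L [gL Lm]] := IH (ltnW mc).
  have [|L' [gL' _ L't]] := good_adjoin_seq (t := left_commutators (c - m.+1)) gL.
    (* The commutator of such a word with a generator has the next higher weight, hence is already
       in [L]. *)
    move=> y i yt; apply: Lm; rewrite -subSS subSn //.
    by apply/allpairsP; exists (y, i); split=> //; rewrite mem_enum.
  by exists L'.
have [L [gL Ls]] := E c (leqnn c).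
suff -> : [set: G] = L by [].
have [[subL _ cL] _ _] := gL.
apply/seteqP; split=> // x _; apply: (dense_closed_setT s_dense cL _ x).
apply: gen_smallest => // _ [i _ <-]; apply: Ls; rewrite subnn.
by apply/mapP; exists i => //; rewrite mem_enum.
Qed.
End Chain.

Lemma polyf_surj (G K : groupType) (k : fieldType) (f : {multiplicative G -> K})
    (N : set G) (M : set K) d (phi : K -> k) :
  (forall y, M y -> exists2 x, N x & f x = y) -> polyf N d (phi \o f) -> polyf M d phi.
Proof.
move=> fN; elim: d phi => [|d IH] phi Hp.
  by move=> _ /fN [x Nx <-]; exact: Hp.
move=> _ /fN [g Ng <-]; apply: IH.
rewrite (_ : _ \o f = ldiff g (phi \o f)); first exact: Hp.
by apply/funext => x; rewrite /ldiff /= gmulfM.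
Qed.

Lemma multiplicative1 (G K : groupType) (f : {multiplicative G -> K}) : f 1%g = 1%g.
Proof. by apply: (mulgI (f 1%g)); rewrite -gmulfM !mulg1. Qed.

Lemma multiplicativeV (G K : groupType) (f : {multiplicative G -> K}) x :
  f (x^-1)%g = ((f x)^-1)%g.
Proof. by apply: (mulgI (f x)); rewrite -gmulfM !mulgV multiplicative1. Qed.

(** * Restriction of polynomial functions to G1, and its kernel *)

Section ExactSequence.
Variables (p : nat) (G1 G2 G3 : topologicalGroupType).
Variables (i : {multiplicative G1 -> G2}) (q : {multiplicative G2 -> G3}).
Hypothesis p_prime : prime p.
Hypotheses (i_cont : continuous i) (q_cont : continuous q).
Hypothesis iq_exact : short_exact_groups i q.
Hypothesis G1_compact : compact [set: G1].
Hypothesis G3_hausdorff : hausdorff_space G3.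
Hypothesis G2_prop : pro_p_group p G2.
Hypothesis G2_nil : nilpotent_group G2.
Hypothesis G2_fg : topologically_fg G2.
Variables (Qp k : topologicalFieldType) (HQp : is_Qp p Qp).
Hypothesis k_hausdorff : hausdorff_space k.
Variable j : {rmorphism Qp -> k}.
Hypothesis j_continuous : continuous j.
Hypothesis char0 : forall n, n.+1%:R != 0 :> k.

Let G2_hausdorff : hausdorff_space G2. Proof. by case: G2_prop. Qed.
Let G2_compact : compact [set: G2]. Proof. by case: G2_prop. Qed.
Let i_inj : injective i. Proof. by case: iq_exact. Qed.
Let qi y : q y = 1%g <-> range i y. Proof. by case: iq_exact => _ + _; apply. Qed.

Lemma closed_map (S T : topologicalType) (f : S -> T) (K : set S) :
  compact [set: S] -> hausdorff_space T -> continuous f -> closed K -> closed (f @` K).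
Proof.
move=> cS hT cf cK; apply: compact_closed => //; apply: continuous_compact.
  exact: continuous_subspaceT.
exact: (subclosed_compact cK cS).
Qed.

Let closed_range : closed (range i).
Proof. by apply: closed_map => //; exact: closedT. Qed.

Let exact_good : extendable k (range i) [set: G2] /\ generated_ideal k (range i) [set: G2].
Proof.
have [_ _ td pidx] := G2_prop.
have base := open_normal_base G2_hausdorff G2_compact td.
have [c cE] := G2_nil; have [n [s sd]] := G2_fg.
have pp W x : @open_normal G2 W -> exists e, W (x ^+ (p ^ e))%g.
  move=> [oW nW]; have [e We] := pidx W oW nW; exists e; exact: index_power.
(* The index is raised by one to be positive even when [G2] is trivial and c = 0. *)
have gam g : lower_central c.+1 g -> g = 1%g :> G2.
  by move=> /lower_central_S; rewrite cE.
suff [_ _ P] : good k (range i) [set: G2] by [].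
apply: (good_setT G2_hausdorff G2_compact base pp p_prime (ltn0Sn c) gam HQp k_hausdorff
  j_continuous char0 sd) => //.
  split; first by exists 1%g; rewrite ?multiplicative1.
  by move=> _ _ [x _ <-] [y _ <-]; exists (x * y^-1)%g => //; rewrite gmulfM multiplicativeV.
by move=> g x /qi qx; apply/qi; rewrite !gmulfM multiplicativeV qx mulg1 mulgV.
Qed.

Let continuous_setT (T : topologicalType) (f : T -> k) :
  continuous f <-> {within setT, continuous f}.
Proof.
split; first exact: continuous_subspaceT.
move=> /(within_closedP _ closedT) H; apply/continuous_closedP => Z /H.
by rewrite setTI.
Qed.

(** [i] is a closed injection, so [phi] becomes a regular function on [range i], to which
    [exact_good] applies. The value 0 off the range is arbitrary, since regularity there concerns
    [range i] alone. *)
Lemma polyalg_restrict_surj (phi : polyalg G1 k) :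
  exists psi : polyalg G2 k, forall x, psi (i x) = phi x.
Proof.
have [[d Hd] cphi] := poly_funP phi.
have [EL _] := exact_good.
pose phi' y : k := if pselect (exists x, i x = y) is left e then phi (projT1 (cid e)) else 0.
have phi'E x : phi' (i x) = phi x.
  rewrite /phi'; case: pselect => [e|[]]; last by exists x.
  by case: cid => z /= /i_inj ->.
have [|psi [[Hpsi cpsi] psiE]] := EL phi'.
  split.
    exists d; apply: (@polyf_surj _ _ _ i setT).
      by move=> _ [x _ <-]; exists x.
    by apply: polyf_ext Hd => // x _; rewrite /= phi'E.
  apply/within_closedP => // Z cZ.
  rewrite (_ : _ `&` _ = i @` (phi @^-1` Z)).
    by apply: closed_map => //; apply: preimage_closed cZ => x _; exact: cphi.
  apply/seteqP; split=> [_ [[x _ <-]]|_ [x Zx <-]].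
    by rewrite /= phi'E; exists x.
  by split; [exists x | rewrite /= phi'E].
exists (Polyalg (conj Hpsi ((continuous_setT _).2 cpsi))) => x /=.
by rewrite psiE //; exists x.
Qed.

(** The factors constant on cosets of i(G1) descend through any set-theoretic section of [q]; they
    stay continuous because [q] is a closed map. *)
Lemma polyalg_kernel_ideal (F : polyalg G2 k) : (forall x, F (i x) = 0) ->
  exists (I : finType) (B : I -> polyalg G2 k) (C : I -> polyalg G3 k),
    (forall l, C l 1%g = 0) /\ forall y, F y = \sum_l B l y * C l (q y).
Proof.
move=> F0; have [_ IL] := exact_good.
have RF : regular [set: G2] F.
  have [Hd cF] := poly_funP F; split; first exact: Hd.
  exact: (continuous_setT _).1 cF.
have [|I [B [C [BCP FE]]]] := IL F RF; first by move=> _ [x _ <-].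
have /choice[sec secP] z : exists y, q y = z.
  by have [_ _ /seteqP [_ /(_ z Logic.I) [y _ <-]]] := iq_exact; exists y.
have CE l y : C l (sec (q y)) = C l y.
  have [_ _ _ CH] := BCP l.
  have /qi Hy : q (y^-1 * sec (q y))%g = 1%g by rewrite gmulfM multiplicativeV secP mulVg.
  by rewrite -(CH y _ Logic.I Hy) mulVKg.
have PB l : (exists d, polyf setT d (B l)) /\ continuous (B l).
  by have [[Hd cB] _ _ _] := BCP l; split=> //; apply/continuous_setT.
have PC l : (exists d, polyf setT d (C l \o sec)) /\ continuous (C l \o sec).
  have [_ [[d Hd] wC] _ _] := BCP l; have cC := (continuous_setT _).2 wC; split.
    exists d; apply: (@polyf_surj _ _ _ q setT); first by move=> z _; exists (sec z).
    by apply: polyf_ext Hd => // y _; rewrite /= CE.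
  apply/continuous_closedP => Z cZ.
  rewrite (_ : _ @^-1` Z = q @` (C l @^-1` Z)).
    by apply: closed_map => //; apply: preimage_closed cZ => x _; exact: cC.
  apply/seteqP; split=> [z Zz|_ [y Zy <-]]; last by rewrite /= CE.
  by exists (sec z).
exists I, (fun l => Polyalg (PB l)), (fun l => Polyalg (PC l)); split=> [l|y] /=.
  by rewrite -(multiplicative1 q) CE; have [_ _ ->] := BCP l.
by rewrite FE //; apply: eq_bigr => l _; rewrite CE.
Qed.
End ExactSequence.

Lemma closedSubfield_continuous (F K : topologicalFieldType) (j : closedSubfield F K) :
  continuous (j : F -> K).
Proof. by apply/continuousP => B oB; apply/(subfield_topology j); exists B. Qed.

Theorem lemma4p13
    (p : nat) (p_prime : prime p)
    (G1 G2 G3 : topologicalGroupType)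
    (i : {multiplicative G1 -> G2}) (q : {multiplicative G2 -> G3})
    (i_cont : continuous i) (q_cont : continuous q)
    (iq_exact : short_exact_groups i q)
    (G1_prop : pro_p_group p G1) (G2_prop : pro_p_group p G2)
    (G3_prop : pro_p_group p G3)
    (G1_nil : nilpotent_group G1) (G2_nil : nilpotent_group G2)
    (G3_nil : nilpotent_group G3)
    (G1_fg : topologically_fg G1) (G2_fg : topologically_fg G2)
    (G3_fg : topologically_fg G3)
    (Qp k : topologicalFieldType) (HQp : is_Qp p Qp)
    (k_hausdorff : hausdorff_space k)
    (j : closedSubfield Qp k) (j_wc : weakly_cartesian_pair j)
    (M1 M2 M3 : affineGroup k)
    (eta1 : {multiplicative G1 -> top_kpoints M1})
    (eta2 : {multiplicative G2 -> top_kpoints M2})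
    (eta3 : {multiplicative G3 -> top_kpoints M3})
    (M1_malcev : is_malcev_completion eta1)
    (M2_malcev : is_malcev_completion eta2)
    (M3_malcev : is_malcev_completion eta3)
    (f : schemeHom M1 M2) (g : schemeHom M2 M3)
    (f_induced : is_induced eta1 eta2 i f)
    (g_induced : is_induced eta2 eta3 q g) :
  short_exact_schemes f g.
Proof.
have jc := @closedSubfield_continuous _ _ j.
have char0 n : n.+1%:R != 0 :> k.
  have [abs [_ _ _ abs_rat _]] := HQp.
  by rewrite -(rmorph_nat j) fmorph_eq0 (padic_char0 p_prime abs_rat).
have [_ qi q_surj] := iq_exact.
have [G1_compact _ _ _] := G1_prop; have [_ G3_hausdorff _ _] := G3_prop.
pose ev1 x (b : coord_alg M1) : k := eval_pt (eta1 x : kpoints M1) b.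
pose ev2 y (a : coord_alg M2) : k := eval_pt (eta2 y : kpoints M2) a.
pose ev3 z (c : coord_alg M3) : k := eval_pt (eta3 z : kpoints M3) c.
have ev_f x a : ev1 x (comap f a) = ev2 (i x) a.
  exact: (congr1 (fun h : {lrmorphism coord_alg M2 -> k^o} => h a) (f_induced x)).
have ev_g y c : ev2 y (comap g c) = ev3 (q y) c.
  exact: (congr1 (fun h : {lrmorphism coord_alg M3 -> k^o} => h c) (g_induced y)).
have ev3_1 c : ev3 1%g c = (counit M3 c : k) by rewrite /ev3 multiplicative1.
have inj1 := malcev_eval_inj k_hausdorff char0 G1_fg M1_malcev.
have inj2 := malcev_eval_inj k_hausdorff char0 G2_fg M2_malcev.
have inj3 := malcev_eval_inj k_hausdorff char0 G3_fg M3_malcev.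
have f_surj b : exists a, comap f a = b.
  pose phi := Polyalg (malcev_eval_poly char0 M1_malcev b).
  have [psi psiE] := polyalg_restrict_surj p_prime i_cont iq_exact G1_compact G2_prop
    G2_nil G2_fg HQp k_hausdorff jc char0 phi.
  have [a aE] := malcev_eval_surj k_hausdorff char0 G2_fg M2_malcev psi.
  exists a; apply: inj1 => x; rewrite -/(ev1 x _) ev_f.
  by rewrite /ev2 aE psiE.
have fg c : comap f (comap g c) = (counit M3 c : k)%:A.
  apply: inj1 => x; rewrite -/(ev1 x _) ev_f ev_g.
  have -> : q (i x) = 1%g by apply/qi; exists x.
  by rewrite ev3_1 linearZ /= rmorph1; exact: (esym (mulr1 _)).
have f_kernel a : comap f a = 0 -> exists (I : finType) (b : I -> coord_alg M2)
    (c : I -> coord_alg M3), (forall l, counit M3 (c l) = 0) /\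
    a = \sum_l b l * comap g (c l).
  move=> a0; pose F := Polyalg (malcev_eval_poly char0 M2_malcev a).
  have F0 x : F (i x) = 0 by rewrite /= -/(ev2 _ _) -ev_f a0 /ev1 rmorph0.
  have [I [B [C [C1 FE]]]] := polyalg_kernel_ideal p_prime i_cont q_cont iq_exact
    G1_compact G3_hausdorff G2_prop G2_nil G2_fg HQp k_hausdorff jc char0 F0.
  have /choice[b bE] l := malcev_eval_surj k_hausdorff char0 G2_fg M2_malcev (B l).
  have /choice[c cE] l := malcev_eval_surj k_hausdorff char0 G3_fg M3_malcev (C l).
  exists I, b, c; split=> [l|]; first by rewrite -ev3_1 /ev3 cE.
  apply: inj2 => y; rewrite raddf_sum; apply: etrans (FE y) _; apply: eq_bigr => l _.
  apply/esym; apply: etrans (rmorphM (eval_pt (eta2 y : kpoints M2)) _ _) _.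
  by congr (_ * _); [exact: bE | rewrite -cE; exact: ev_g].
split.
- move=> R x y xy; apply: lrmorphism_eq => b; have [a <-] := f_surj b.
  exact: (congr1 (fun h : {lrmorphism coord_alg M2 -> R} => h a) xy).
- move=> R y; split=> [y1|[x <-]]; last first.
    apply: lrmorphism_eq => c; rewrite pt_oneE /= fg.
    by rewrite linearZ /= rmorph1.
  have y_counit c : eval_pt y (comap g c) = (counit M3 c : k)%:A.
    rewrite -pt_oneE.
    exact: (congr1 (fun h : {lrmorphism coord_alg M3 -> R} => h c) y1).
  have y_kernel a : comap f a = 0 -> eval_pt y a = 0.
    move=> /f_kernel [I [b [c [c0 ->]]]]; rewrite raddf_sum big1 // => l _.
    apply: etrans (rmorphM (eval_pt y) _ _) _.
    have y0 : eval_pt y (comap g (c l)) = 0 by rewrite y_counit c0 scale0r.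
    exact: etrans (congr1 (fun z => eval_pt y (b l) * z) y0) (mulr0 _).
  have y_eq a a' : comap f a = comap f a' -> eval_pt y a = eval_pt y a'.
    move=> aa'; have aa'0 : comap f (a - a') = 0.
      by apply: etrans (raddfB (comap f) a a') _; apply/eqP; rewrite subr_eq0; exact/eqP.
    apply/eqP; rewrite -subr_eq0; apply/eqP.
    exact: etrans (esym (raddfB (eval_pt y) a a')) (y_kernel _ aa'0).
  have /choice[lift liftK] := f_surj.
  (* [y] kills the kernel of the surjection [comap f], hence factors through it; by [y_eq] the
     chosen preimages do not matter. *)
  pose x b := eval_pt y (lift b).
  have xf a : x (comap f a) = eval_pt y a by apply: y_eq; rewrite liftK.
  have x_linear : linear x.
    by move=> a u v; rewrite -[u]liftK -[v]liftK -linearP !xf linearP.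
  have x_monoid : monoid_morphism x.
    split; first by rewrite -(rmorph1 (comap f)) xf rmorph1.
    by move=> u v; rewrite -[u]liftK -[v]liftK -rmorphM !xf rmorphM.
  by exists (mk_lrmorphism x_linear x_monoid); apply: lrmorphism_eq => a; exact: xf.
(* Functions on [M3] are determined by their values on [G3], and [q] reaches all of [G3]. *)
- move=> c c' cc'; apply: inj3 => z.
  have /seteqP [_ /(_ z Logic.I) [y _ <-]] := q_surj.
  by rewrite -/(ev3 _ _) -/(ev3 _ c') -!ev_g cc'.
Qed.
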